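(* Assume $\lambda_1<\lambda_2$. There exists $\delta_0>0$ such that the following holds for every $u_0\in V$ with $\|u_0\|_b=1$ and $\inf_{w\in M(\lambda_1)}\|u_0-w\|_a\le\delta_0$ (that is, $u_0$ is an approximation to $M(\lambda_1)$ with sufficiently small error). Put $\mu_0=\dfrac{a(u_0,u_0)}{b(u_0,u_0)}$, $W=\mathbb{R}$, and define $$A_{\mu_0}(u,v)=a(u,v)-\mu_0\, b(u,v),\qquad B(v,\nu)=-\nu\, b(u_0,v)\qquad (u,v\in V,\ \nu\in W).$$ Then: 1. There exists $\alpha>0$ (depending on $\lambda_2-\lambda_1$) such that $$A_{\mu_0}(v,v)\ge \alpha\|v\|_a^2\qquad\text{for all } v\in V_0,$$ where $V_0=\{v\in V: B(v,\nu)=0\ \ \forall \nu\in W\}=\{v\in V: b(u_0,v)=0\}$. 2. There exists $\sigma>0$ (depending on $1/\mu_0$) such that $$\sup_{0\ne v\in V}\frac{B(v,\nu)}{\|v\|_a}\ge\sigma|\nu|\qquad\text{for all }\nu\in W.$$ Based on these two conditions, for every $f\in V'$ and $g\in W'$ the mixed problem: find $(u,\lambda)\in V\times W$ such that $$\begin{cases}A_{\mu_0}(u,v)+B(v,\lambda)=f(v),&\forall v\in V,\\ B(u,\nu)=g(\nu),&\forall\nu\in W,\end{cases}$$ has exactly one solution.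
   Context: $\Omega\subset\mathbb{R}^d$ ($d=2,3$) is a bounded domain, $V=H_0^1(\Omega)$ (real-valued functions), $a(u,v)=\int_\Omega\nabla u\cdot\nabla v\,d\Omega$, $b(u,v)=\int_\Omega uv\,d\Omega$, $\|v\|_a^2=a(v,v)$, $\|v\|_b^2=b(v,v)$. The eigenvalue problem is: find $(\lambda,u)\in\mathbb{R}\times V$ with $b(u,u)=1$ and $a(u,v)=\lambda b(u,v)$ for all $v\in V$. Its eigenvalues, repeated according to multiplicity, are $\lambda_1\le\lambda_2\le\cdots\to\infty$. $M(\lambda_1)\subset V$ is the eigenspace of $\lambda_1$ (all $w\in V$ with $a(w,v)=\lambda_1 b(w,v)$ for all $v\in V$). $V'$ and $W'$ denote dual spaces. *)

(* Defs.v *)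
From HB Require Import structures.
From mathcomp Require Import all_boot all_order all_algebra.
From mathcomp Require Import all_classical all_reals all_analysis.

Set Implicit Arguments.
Unset Strict Implicit.
Unset Printing Implicit Defensive.

Import Order.TTheory GRing.Theory Num.Theory.
Import numFieldNormedType.Exports.

Local Open Scope classical_set_scope.
Local Open Scope ring_scope.

(* The product (= Borel) sigma-algebra on R^n, generated by the coordinate
   maps as the library does for n.-tuple. *)
Section measurable_rV.
Context {R : realType} (n : nat).

Definition coord_rV (i : 'I_n) (x : 'rV[R]_n) : measurableTypeR R := x 0 i.

Let rV_set0 : g_sigma_preimage coord_rV set0.
Proof. exact: sigma_algebra0. Qed.

Let rV_setC A : g_sigma_preimage coord_rV A -> g_sigma_preimage coord_rV (~` A).
Proof. exact: sigma_algebraC. Qed.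

Let rV_bigcup (F : (set 'rV[R]_n)^nat) :
  (forall i, g_sigma_preimage coord_rV (F i)) ->
  g_sigma_preimage coord_rV (\bigcup_i F i).
Proof. exact: sigma_algebra_bigcup. Qed.

HB.instance Definition _ := @isMeasurable.Build default_measure_display
  'rV[R]_n (g_sigma_preimage coord_rV) rV_set0 rV_setC rV_bigcup.

End measurable_rV.

Section lebesgue_rV.
Context {R : realType}.

Lemma measurable_coord_rV n (i : 'I_n) :
  measurable_fun [set: 'rV[R]_n] (@coord_rV R n i).
Proof.
move=> _ Y mY; rewrite setTI; apply: sub_sigma_algebra => /=.
rewrite -bigcup_seq/=; exists i => /=; first by rewrite mem_index_enum.
by exists Y => //; rewrite setTI.
Qed.

Lemma measurable_fun_rV d (T : measurableType d) n (f : T -> 'rV[R]_n) :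
  (forall i, measurable_fun [set: T] (fun t => coord_rV i (f t))) ->
  measurable_fun [set: T] f.
Proof.
move=> mf.
pose S := [set A : set 'rV[R]_n | measurable (f @^-1` A)].
suff H : (@measurable _ 'rV[R]_n) `<=` S by move=> _ A mA; rewrite setTI; exact: H.
apply: smallest_sub.
  split=> [|A|F]; rewrite /S /=.
  - by rewrite preimage_set0.
  - by move=> mA; rewrite setTD preimage_setC; exact: measurableC.
  - by move=> mF; rewrite preimage_bigcup; exact: bigcupT_measurable.
move=> A; rewrite -bigcup_seq => -[i _ [B mB <-]].
by rewrite /S /= setTI; rewrite -[X in measurable X]setTI; exact: mf.
Qed.

Definition cons_rV n (p : measurableTypeR R * 'rV[R]_n) : 'rV[R]_n.+1 :=
  \row_(i < n.+1) (if unlift ord0 i is Some j then p.2 0 j else p.1).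

Definition uncons_rV n (x : 'rV[R]_n.+1) : measurableTypeR R * 'rV[R]_n :=
  (x 0 ord0, \row_(j < n) x 0 (lift ord0 j)).

Lemma cons_rVK n : cancel (@cons_rV n) (@uncons_rV n).
Proof.
move=> [a x]; congr pair => /=; first by rewrite mxE unlift_none.
by apply/rowP => j; rewrite !mxE liftK.
Qed.

Lemma uncons_rVK n : cancel (@uncons_rV n) (@cons_rV n).
Proof.
move=> x; apply/rowP => i; rewrite !mxE.
by case: unliftP => [j ->|-> //]; rewrite mxE.
Qed.

Lemma measurable_cons_rV n : measurable_fun [set: _] (@cons_rV n).
Proof.
apply: measurable_fun_rV => i; rewrite /coord_rV.
case: (unliftP ord0 i) => [j ->|->].
  rewrite (_ : (fun _ => _) = @coord_rV R n j \o snd); last first.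
    by apply/funext => p /=; rewrite mxE liftK.
  by apply: measurableT_comp; [exact: measurable_coord_rV|exact: measurable_snd].
rewrite (_ : (fun _ => _) = fst); first exact: measurable_fst.
by apply/funext => p /=; rewrite mxE unlift_none.
Qed.

Lemma measurable_uncons_rV n : measurable_fun [set: _] (@uncons_rV n).
Proof.
apply: measurable_fun_pair; first exact: measurable_coord_rV.
apply: measurable_fun_rV => i.
rewrite (_ : (fun _ => _) = @coord_rV R n.+1 (lift ord0 i)).
  exact: measurable_coord_rV.
by apply/funext => x; rewrite /coord_rV mxE.
Qed.

Section lebesgue_cons.
Context n (m : {sigma_finite_measure set 'rV[R]_n -> \bar R}).
Local Open Scope ereal_scope.

Definition lebesgue_cons : set 'rV[R]_n.+1 -> \bar R :=
  pushforward (@lebesgue_measure R \x m) (@cons_rV n).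

Let mcons : {measure set 'rV[R]_n.+1 -> \bar R} :=
  measure_function_pushforward__canonical__measure_function_Measure
    (@lebesgue_measure R \x m) (@measurable_cons_rV n).

Let lebesgue_cons0 : lebesgue_cons set0 = 0.
Proof. exact: (measure0 mcons). Qed.

Let lebesgue_cons_ge0 A : 0 <= lebesgue_cons A.
Proof. exact: (measure_ge0 mcons). Qed.

Let lebesgue_cons_sigma_additive : semi_sigma_additive lebesgue_cons.
Proof. exact: (@measure_semi_sigma_additive _ _ _ mcons). Qed.

HB.instance Definition _ := isMeasure.Build _ _ _ lebesgue_cons
  lebesgue_cons0 lebesgue_cons_ge0 lebesgue_cons_sigma_additive.

Let lebesgue_cons_sigma_finite : sigma_finite [set: 'rV[R]_n.+1] lebesgue_cons.
Proof.
have /sigma_finiteP[F [TF ndF Foo]] := sigma_finiteT (@lebesgue_measure R).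
have /sigma_finiteP[G [TG ndG Goo]] := sigma_finiteT m.
exists (fun k => @uncons_rV n @^-1` (F k `*` G k)) => [|k].
  rewrite -preimage_bigcup (_ : \bigcup_k (F k `*` G k) = setT)//.
  apply/seteqP; split=> // -[a x] _.
  have : [set: measurableTypeR R] a by []; rewrite TF => -[i _ Fia].
  have : [set: 'rV[R]_n] x by []; rewrite TG => -[j _ Gjx].
  exists (maxn i j) => //; split.
  - by move: Fia; exact/subsetPset/ndF/leq_maxl.
  - by move: Gjx; exact/subsetPset/ndG/leq_maxr.
have [mF Fk] := Foo k; have [mG Gk] := Goo k; split.
  rewrite -[X in measurable X]setTI; apply: measurable_uncons_rV => //.
  exact: measurableX.
rewrite /lebesgue_cons /pushforward -comp_preimage.
rewrite (_ : _ \o _ = id); last by apply/funext => p /=; rewrite cons_rVK.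
by rewrite preimage_id product_measure1E// lte_mul_pinfty// ge0_fin_numE.
Qed.

HB.instance Definition _ := Measure_isSigmaFinite.Build _ _ _ lebesgue_cons
  lebesgue_cons_sigma_finite.

End lebesgue_cons.

Section lebesgue_nil.
Local Open Scope ereal_scope.

Definition lebesgue_nil : set 'rV[R]_0 -> \bar R := dirac (0%R : 'rV[R]_0).

HB.instance Definition _ := Measure.on lebesgue_nil.

Let lebesgue_nil_sigma_finite : sigma_finite [set: 'rV[R]_0] lebesgue_nil.
Proof.
exists (fun=> setT) => [|k]; first by rewrite bigcup_const.
by split => //; rewrite [ltLHS]diracT ltry.
Qed.

HB.instance Definition _ := Measure_isSigmaFinite.Build _ _ _ lebesgue_nil
  lebesgue_nil_sigma_finite.

End lebesgue_nil.

(* Lebesgue measure on R^n (restricted to Borel sets), as an iterated product. *)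
Fixpoint lebesgue_rV n : {sigma_finite_measure set 'rV[R]_n -> \bar R} :=
  if n is k.+1 then lebesgue_cons (lebesgue_rV k) else lebesgue_nil.

Lemma lebesgue_rV_box n (A : 'I_n -> set (measurableTypeR R)) :
  (forall i, measurable (A i)) ->
  (lebesgue_rV n [set x | forall i, A i (x 0%R i)] =
   \prod_(i < n) lebesgue_measure (A i))%E.
Proof.
elim: n A => [|n IHn] A mA /=.
  rewrite big_ord0 -[RHS](diracT R (0 : 'rV[R]_0)); congr (lebesgue_nil _).
  by apply/seteqP; split => x // _ [].
pose B := [set x : 'rV[R]_n | forall i, A (lift ord0 i) (x 0%R i)].
transitivity ((@lebesgue_measure R \x lebesgue_rV n) (A ord0 `*` B))%E.
  congr (product_measure1 _ _ _).
  apply/seteqP; split => -[a x] /=.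
    move=> H; split; first by have := H ord0; rewrite mxE unlift_none.
    by move=> i; have := H (lift ord0 i); rewrite mxE liftK.
  move=> [Aa Ax] i; rewrite mxE; case: (unliftP ord0 i) => [j ->|->] //=.
rewrite product_measure1E//; last first.
  rewrite (_ : B =
      \bigcap_(i in [set: 'I_n]) (@coord_rV R n i @^-1` A (lift ord0 i))).
    apply: fin_bigcap_measurable => // i _.
    by rewrite -[X in measurable X]setTI; exact: measurable_coord_rV.
  by apply/seteqP; split => x /= H i => [_|]; exact: H.
by rewrite big_ord_recl; congr (_ * _)%E;
  exact: (IHn (fun i => A (lift ord0 i))).
Qed.

End lebesgue_rV.
Arguments lebesgue_rV {R} n.

Section sobolev.
Context {R : realType} {d : nat}.
Local Notation E := 'rV[R]_d.
Local Notation mu := (lebesgue_rV d).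
Implicit Types (Omega : set E) (u v phi : E -> R) (i : 'I_d).

Definition is_domain Omega := [/\ open Omega, connected Omega & Omega !=set0].

Definition partial i phi : E -> R :=
  fun x => 'D_(delta_mx 0 i : E) (phi : E -> R^o) x.

(* s lists the directions of an iterated partial derivative. *)
Definition partials (s : seq 'I_d) phi : E -> R := foldr partial phi s.

Definition smooth phi := forall s : seq 'I_d,
  continuous (partials s phi) /\
  forall i x, derivable (partials s phi : E -> R^o) x (delta_mx 0 i : E).

Definition test_function Omega phi :=
  [/\ smooth phi, compact (closure [set x | phi x != 0])
    & closure [set x | phi x != 0] `<=` Omega].

(* Elements of the function spaces below are represented by functions on R^d
   of which only the values on Omega matter; equality in these spaces is
   almost everywhere equality on Omega. *)
Definition eqae Omega u v := u = v %[ae mu in Omega].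

Definition L2 Omega u :=
  measurable_fun Omega u /\ mu.-integrable Omega (fun x => (u x ^+ 2)%:E).

Definition is_weak_deriv Omega i u g :=
  L2 Omega g /\ forall phi, test_function Omega phi ->
    \int[mu]_(x in Omega) (u x * partial i phi x) =
    - \int[mu]_(x in Omega) (g x * phi x).

Definition H1 Omega u :=
  L2 Omega u /\ forall i, exists g, is_weak_deriv Omega i u g.

(* A representative of the weak derivative, which is unique up to almost
   everywhere equality on Omega; meaningful when H1 Omega u. *)
Definition weak_deriv Omega i u : E -> R :=
  xget (cst 0) [set g | is_weak_deriv Omega i u g].

Definition a_form Omega u v : R := \sum_(i < d)
  \int[mu]_(x in Omega) (weak_deriv Omega i u x * weak_deriv Omega i v x).

Definition b_form Omega u v : R := \int[mu]_(x in Omega) (u x * v x).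

Definition norm_a Omega v : R := Num.sqrt (a_form Omega v v).
Definition norm_b Omega v : R := Num.sqrt (b_form Omega v v).
Definition norm_H1 Omega v : R :=
  Num.sqrt (b_form Omega v v + a_form Omega v v).

(* H^1_0(Omega): the closure of the test functions in H^1(Omega). *)
Definition H10 Omega : set (E -> R) := [set u | H1 Omega u /\
  exists2 phi : nat -> E -> R, forall n, test_function Omega (phi n) &
    norm_H1 Omega (u \- phi n) @[n --> \oo] --> (0 : R)].

Definition eigfun_space Omega (l : R) : set (E -> R) :=
  [set w | H10 Omega w /\
    forall v, H10 Omega v -> a_form Omega w v = l * b_form Omega w v].

Definition has_dim Omega (U : set (E -> R)) (n : nat) :=
  exists e : 'I_n -> E -> R, (forall k, U (e k)) /\
    forall w, U w -> exists! c : 'rV[R]_n,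
      eqae Omega w (fun x => \sum_(k < n) c 0 k * e k x).

(* The eigenvalues in nondecreasing order, repeated according to multiplicity:
   every real l occurs dim (eigfun_space l) times, i.e. 0 times when it is not
   an eigenvalue.  Indexing starts at 0. *)
Definition eigenvalue_sequence Omega (lambda : nat -> R) :=
  [/\ {homo lambda : m n / (m <= n)%N >-> m <= n},
      lambda n @[n --> \oo] --> +oo
    & forall l, exists2 n, ([set k | lambda k = l] #= `I_n)%card
        & has_dim Omega (eigfun_space Omega l) n].

(* Continuous linear functionals on H^1_0(Omega); boundedness makes them
   invariant under almost everywhere equality. *)
Definition H10_dual Omega (f : (E -> R) -> R) :=
  (forall (c : R) u v, H10 Omega u -> H10 Omega v ->
     f (fun x => c * u x + v x) = c * f u + f v) /\
  exists C, forall v, H10 Omega v -> `|f v| <= C * norm_H1 Omega v.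

Definition A_form Omega (m : R) u v : R :=
  a_form Omega u v - m * b_form Omega u v.

Definition B_form Omega u0 v (nu : R) : R := - nu * b_form Omega u0 v.

Definition V0 Omega u0 : set (E -> R) :=
  [set v | H10 Omega v /\ forall nu, B_form Omega u0 v nu = 0].

Definition mixed_solution Omega (m : R) u0 (f : (E -> R) -> R) (g : R -> R)
    u (l : R) :=
  [/\ H10 Omega u,
      forall v, H10 Omega v -> A_form Omega m u v + B_form Omega u0 v l = f v
    & forall nu, B_form Omega u0 u nu = g nu].

End sobolev.

(* Main.v *)
(* The eigenvalues only enter through the inequality a(v,v) >= lambda_2 b(v,v) for
   v b-orthogonal to M(lambda_1) = <e>. It holds because the infimum m of the
   Rayleigh quotient on the orthogonal of e is itself an eigenvalue: a - m b is
   nonnegative and coercive on a subspace of finite codimension, hence either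
   coercive, which contradicts the choice of m, or degenerate, and a null vector
   is an eigenvector. The finite codimension replaces Rellich's theorem: by a
   Poincare inequality on small cells, finitely many averages of v control
   |v|_b^2 up to eps |v|_a^2. Given this gap, u0 = c e + r with r small, and v
   with b(u0, v) = 0 is almost orthogonal to e, so that A_mu0 is coercive on V0;
   the saddle point problem then reduces to the Riesz representation theorem on
   V0. The Hilbert space theory is applied to H^1_0, which requires the
   uniqueness of weak derivatives (du Bois-Reymond) and the completeness of
   L^2. *)
Require Import Defs.
From mathcomp Require Import all_boot all_order all_algebra.
From mathcomp Require Import all_classical all_reals all_analysis.
From mathcomp Require Import measurable_realfun ring lra.

Set Implicit Arguments.
Unset Strict Implicit.
Unset Printing Implicit Defensive.

Import Order.TTheory GRing.Theory Num.Theory.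
Import numFieldNormedType.Exports.

Local Open Scope classical_set_scope.
Local Open Scope ring_scope.

(** * Quadratic forms on Hilbert spaces *)

Section hilbert.
Context {R : realType} {T : lmodType R}.
Implicit Types (V : set T) (a b c : T -> T -> R) (l f : T -> R) (u v w : T).

(** Function spaces are sets of functions here, not quotients by almost everywhere equality, and
    [a_form] rests on weak derivatives picked by choice, so that it is bilinear only on H^1. The
    Hilbert space part therefore speaks of positive semidefinite forms on a subset of an [lmodType],
    with limits determined up to null vectors, and works with squares instead of norms. Definiteness
    returns only at the end: by Friedrichs' inequality a function that is null for a is null for b,
    hence zero almost everywhere.

    The analytic inequalities are proved for test functions only. Extended by zero to a box
    containing Omega, these obey the fundamental theorem of calculus on every coordinate line, so
    that slicing and Fubini suffice and the shape of the boundary never enters. The closure then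
    carries the inequalities over to H^1_0 at the cost of a constant factor. *)

Definition subspace V := V 0 /\ forall k u v, V u -> V v -> V (k *: u + v).

Definition linear_on V l :=
  forall k u v, V u -> V v -> l (k *: u + v) = k * l u + l v.

Record psd_form V a := PsdForm {
  psd_sym : forall u v, V u -> V v -> a u v = a v u;
  psd_lin : forall w, V w -> linear_on V (a w);
  psd_ge0 : forall v, V v -> 0 <= a v v }.

Definition tends_to a (u_ : nat -> T) u :=
  forall e, 0 < e -> exists N, forall n, (N <= n)%N ->
    a (u_ n - u) (u_ n - u) <= e.

Definition complete_for V a := forall u_ : nat -> T, (forall n, V (u_ n)) ->
  (forall e, 0 < e -> exists N, forall m n, (N <= m)%N -> (N <= n)%N ->
     a (u_ m - u_ n) (u_ m - u_ n) <= e) ->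
  exists2 u, V u & tends_to a u_ u.

Definition bounded_for V a l := exists C, forall v, V v -> l v ^+ 2 <= C * a v v.

Section subspace_theory.
Variable V : set T.
Hypothesis sV : subspace V.

Lemma subspaceD u v : V u -> V v -> V (u + v).
Proof. by move=> Vu Vv; rewrite -[u]scale1r; exact: sV.2. Qed.

Lemma subspaceZ k u : V u -> V (k *: u).
Proof. by move=> Vu; rewrite -[_ *: _]addr0; apply: sV.2 => //; exact: sV.1. Qed.

Lemma subspaceB u v : V u -> V v -> V (u - v).
Proof. by move=> Vu Vv; rewrite addrC -scaleN1r; exact: sV.2. Qed.

Section linear_theory.
Variable l : T -> R.
Hypothesis lV : linear_on V l.

Lemma linear_onD u v : V u -> V v -> l (u + v) = l u + l v.
Proof. by move=> Vu Vv; rewrite -[u in LHS]scale1r lV// mul1r. Qed.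

Lemma linear_on0 : l 0 = 0.
Proof.
have V0 := sV.1; have := linear_onD V0 V0.
by rewrite addr0 => /esym /eqP; rewrite -subr_eq0 addrK => /eqP.
Qed.

Lemma linear_onZ k u : V u -> l (k *: u) = k * l u.
Proof.
by move=> Vu; rewrite -[_ *: _]addr0 lV//; [rewrite linear_on0 addr0|exact: sV.1].
Qed.

Lemma linear_onB u v : V u -> V v -> l (u - v) = l u - l v.
Proof.
by move=> Vu Vv; rewrite addrC -scaleN1r lV// mulN1r addrC.
Qed.

Lemma subspace_ker : subspace [set v | V v /\ l v = 0].
Proof.
split; first by split; [exact: sV.1|exact: linear_on0].
move=> k u v [Vu lu] [Vv lv]; split; first exact: sV.2.
by rewrite lV// lu lv mulr0 addr0.
Qed.

End linear_theory.

Section form_theory.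
Variable a : T -> T -> R.
Hypothesis aV : psd_form V a.

Lemma psd_linl w : V w -> linear_on V (a ^~ w).
Proof.
move=> Vw k u v Vu Vv; have Vs := sV.2 k _ _ Vu Vv.
by rewrite (psd_sym aV Vs Vw) (psd_lin aV Vw)// !(psd_sym aV _ Vw).
Qed.

Lemma psdD u v : V u -> V v -> a (u + v) (u + v) = a u u + 2 * a u v + a v v.
Proof.
move=> Vu Vv; have Vs := subspaceD Vu Vv.
rewrite (linear_onD (psd_lin aV Vs))// !(linear_onD (psd_linl _))//.
rewrite (psd_sym aV Vv Vu); ring.
Qed.

Lemma psdZ k u : V u -> a (k *: u) (k *: u) = k ^+ 2 * a u u.
Proof.
move=> Vu; rewrite (linear_onZ (psd_lin aV (subspaceZ k Vu)))//.
by rewrite (linear_onZ (psd_linl Vu))// mulrA.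
Qed.

Lemma psdDZ t u v : V u -> V v ->
  a (u + t *: v) (u + t *: v) = a u u + 2 * t * a u v + t ^+ 2 * a v v.
Proof.
move=> Vu Vv; rewrite psdD ?psdZ//; last exact: subspaceZ.
by rewrite (linear_onZ (psd_lin aV Vu))// mulrA.
Qed.

Lemma psdB u v : V u -> V v -> a (u - v) (u - v) = a u u - 2 * a u v + a v v.
Proof. by move=> Vu Vv; rewrite -scaleN1r psdDZ// sqrrN expr1n; ring. Qed.

Lemma psdD_le u v : V u -> V v -> a (u + v) (u + v) <= 2 * a u u + 2 * a v v.
Proof.
move=> Vu Vv; rewrite psdD//; have := psd_ge0 aV (subspaceB Vu Vv).
by rewrite psdB//; lra.
Qed.

Lemma psd_opp u v : V u -> V v -> a (u - v) (u - v) = a (v - u) (v - u).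
Proof. by move=> Vu Vv; rewrite !psdB// (psd_sym aV Vu Vv); ring. Qed.

End form_theory.

End subspace_theory.

(** The discriminant of a nonnegative quadratic polynomial. It yields Cauchy-Schwarz, the
    approximate Euler equation in [riesz] and Jensen's inequality; the case [r = 0] is what lets
    forms be degenerate. *)
Lemma quadratic_ge0 (p q r : R) :
  (forall t, 0 <= p + 2 * t * q + t ^+ 2 * r) -> 0 <= r -> q ^+ 2 <= p * r.
Proof.
move=> H r0; have [r0'|] := eqVneq r 0.
  rewrite r0' mulr0; suff -> : q = 0 by rewrite expr0n.
  apply/eqP; apply: contraT => q0.
  (* At this t the affine function p + 2 t q takes the value -1. *)
  have := H (- (p + 1) / (2 * q)); rewrite r0'.
  suff -> : p + 2 * (- (p + 1) / (2 * q)) * q +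
    (- (p + 1) / (2 * q)) ^+ 2 * 0 = -1 by lra.
  by field.
move=> rn0; have rp : 0 < r by rewrite lt_def rn0.
have := H (- q / r).
have -> : p + 2 * (- q / r) * q + (- q / r) ^+ 2 * r = (p * r - q ^+ 2) / r.
  by field.
by rewrite pmulr_lge0 ?invr_gt0// subr_ge0.
Qed.

Lemma psd_cauchy_schwarz V a u v : subspace V -> psd_form V a -> V u -> V v ->
  a u v ^+ 2 <= a u u * a v v.
Proof.
move=> sV aV Vu Vv; apply: quadratic_ge0; last exact: psd_ge0 aV _ Vv.
move=> t; rewrite -(psdDZ sV aV)//; apply: (psd_ge0 aV).
by apply: subspaceD => //; exact: subspaceZ sV _ _ Vv.
Qed.

Lemma psd_formS V V' a : V' `<=` V -> psd_form V a -> psd_form V' a.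
Proof.
move=> VV' [s l p]; split => [u v /VV' ? /VV' ?|w /VV' Vw k u v /VV' ? /VV' ?|
  v /VV' ?]; [exact: s|exact: l|exact: p].
Qed.

Lemma psd_formD V a b : psd_form V a -> psd_form V b ->
  psd_form V (fun u v => a u v + b u v).
Proof.
move=> aV bV; split=> [u v Vu Vv|w Vw k u v Vu Vv|v Vv].
- by rewrite (psd_sym aV)// (psd_sym bV).
- by rewrite (psd_lin aV Vw)// (psd_lin bV Vw)//; ring.
- by rewrite addr_ge0// ?(psd_ge0 aV)// (psd_ge0 bV).
Qed.

(** * The Riesz representation theorem *)

Section riesz.
Variables (V : set T) (a : T -> T -> R) (f : T -> R).
Hypotheses (sV : subspace V) (aV : psd_form V a) (cV : complete_for V a).
Hypotheses (fV : linear_on V f) (bf : bounded_for V a f).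

Let J v : R := a v v - 2 * f v.

Let JD t u v : V u -> V v ->
  J (u + t *: v) = J u + 2 * t * (a u v - f v) + t ^+ 2 * a v v.
Proof.
move=> Vu Vv; rewrite /J (psdDZ sV aV)// (linear_onD fV)//; last exact: subspaceZ.
by rewrite (linear_onZ sV fV)//; ring.
Qed.

Let J_bounded : exists M : R, forall v, V v -> M <= J v.
Proof.
have [C0 bC0] := bf; pose C := `|C0|.
have C0' : 0 <= C by rewrite normr_ge0.
have bC v : V v -> f v ^+ 2 <= C * a v v.
  move=> Vv; apply: le_trans (bC0 _ Vv) _.
  by rewrite ler_wpM2r// ?ler_norm//; exact: psd_ge0 aV _ Vv.
exists (- C) => v Vv; rewrite /J; have := bC _ Vv; have := psd_ge0 aV Vv.
set x := a v v; set y := f v => x0 yC.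
(* From y^2 <= C x, by the arithmetic-geometric mean inequality. *)
suff : 2 * y <= C + x by lra.
have [|y0] := leP y 0; first by lra.
have : (2 * y) ^+ 2 <= (C + x) ^+ 2 by have := sqr_ge0 (C - x); nra.
by rewrite ler_sqr ?nnegrE//; lra.
Qed.

(* The Dirichlet principle: a minimizing sequence of J is Cauchy by the
   parallelogram identity, and the limit satisfies the Euler equation. *)
Lemma riesz : exists2 z, V z & forall v, V v -> a z v = f v.
Proof.
have [M JM] := J_bounded.
pose S : set R := J @` V.
have S0 : S !=set0 by exists (J 0); exists 0 => //; exact: sV.1.
have lS : has_lbound S by exists M => _ [v Vv <-]; exact: JM.
pose m : R := inf S.
have mJ v : V v -> m <= J v by move=> Vv; apply: ge_inf => //; exists v.
have /choice[v_ Hv_] : forall n : nat, exists v, V v /\ J v <= m + n.+1%:R^-1.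
  move=> n; have : 0 < n.+1%:R^-1 :> R by rewrite invr_gt0.
  by move=> /inf_adherent/(_ (conj S0 lS))[_ [v Vv <-]] Jv; exists v; split => //;
    exact: ltW.
have Vv_ n : V (v_ n) by have [] := Hv_ n.
have Jv_ n : J (v_ n) <= m + n.+1%:R^-1 by have [] := Hv_ n.
have par j k : a (v_ j - v_ k) (v_ j - v_ k) <= 2 * (j.+1%:R^-1 + k.+1%:R^-1).
  have Vd := subspaceB sV (Vv_ k) (Vv_ j).
  rewrite (psd_opp sV aV (Vv_ j) (Vv_ k)).
  (* With t = 1 the expansion gives J at [v_ k], with t = 1 / 2 at the midpoint. As the midpoint
     value is at least m, half of the squared distance is at most the sum of the two excesses over
     m. *)
  have := JD 1 (Vv_ j) Vd; rewrite scale1r [_ + (_ - _)]addrC subrK => J1.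
  have := mJ _ (subspaceD sV (Vv_ j) (subspaceZ sV (1 / 2) Vd)).
  rewrite (JD _ (Vv_ j) Vd); have := Jv_ j; have := Jv_ k.
  rewrite {}J1; set x := a (v_ j) _ - _; set q := a _ _; set p := J _.
  by move: j.+1%:R^-1 k.+1%:R^-1 => ej ek H1 H2 H3; lra.
have [|z Vz vz] := cV Vv_.
  move=> e e0; have := near_infty_natSinv_lt (PosNum (divr_gt0 e0 (@ltr0n R 4))).
  move=> [N _ HN]; exists N => j k Nj Nk.
  apply: le_trans (par j k) _; have /= := ltW (HN _ Nj); have /= := ltW (HN _ Nk).
  by move: j.+1%:R^-1 k.+1%:R^-1 => ej ek ? ?; lra.
exists z => // w Vw.
have aw0 := psd_ge0 aV Vw.
(* J (v_ n + t w) >= m >= J (v_ n) - 1 / (n + 1) for every t: a nonnegative quadratic polynomial in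
   t. *)
have euler n : (a (v_ n) w - f w) ^+ 2 <= n.+1%:R^-1 * a w w.
  apply: quadratic_ge0 => // t.
  have := mJ _ (subspaceD sV (Vv_ n) (subspaceZ sV t Vw)).
  rewrite JD//; have := Jv_ n; set x := a (v_ n) w - _; set p := J _.
  by move: n.+1%:R^-1 => en ? ?; lra.
suff : (a z w - f w) ^+ 2 <= 0.
  by rewrite real_exprn_even_le0 ?num_real//= subr_eq0 => /eqP.
apply/ler_addgt0Pr => e e0; rewrite add0r.
have d0 : 0 < e / (4 * (a w w + 1)) by apply: divr_gt0 => //; lra.
have [N1 HN1] := vz _ d0; have [N2 _ HN2] := near_infty_natSinv_lt (PosNum d0).
pose n := maxn N1 N2.
have := HN1 n (leq_maxl _ _); have := ltW (HN2 n (leq_maxr _ _)) => /= H2 H1.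
have Vd := subspaceB sV (Vv_ n) Vz.
have := psd_cauchy_schwarz sV aV Vd Vw.
rewrite (linear_onB (psd_linl sV aV Vw))//.
have := euler n; set x := a (v_ n) w; set y := a z w; set fw := f w => Hx Hy.
have {}Hx : (x - fw) ^+ 2 <= e / 4.
  apply: le_trans Hx _; apply: le_trans (ler_wpM2r aw0 H2) _.
  rewrite -mulrA ler_wpM2l//; first exact: ltW.
  by rewrite invfM -mulrA ler_piMr// mulrC ler_pdivrMr; lra.
have {}Hy : (x - y) ^+ 2 <= e / 4.
  apply: le_trans Hy _; apply: le_trans (ler_wpM2r aw0 H1) _.
  rewrite -mulrA ler_wpM2l//; first exact: ltW.
  by rewrite invfM -mulrA ler_piMr// mulrC ler_pdivrMr; lra.
by have := sqr_ge0 ((x - fw) + (x - y)); nra.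
Qed.

End riesz.

Lemma bounded_for_cvg V a l (u_ : nat -> T) u : subspace V -> psd_form V a -> linear_on V l ->
  bounded_for V a l -> V u -> (forall n, V (u_ n)) -> tends_to a u_ u ->
  (forall n, l (u_ n) = 0) -> l u = 0.
Proof.
move=> sV aV lV [C bC] Vu Vu_ uu lu.
suff : l u ^+ 2 <= 0 by rewrite real_exprn_even_le0 ?num_real//= => /eqP.
apply/ler_addgt0Pr => e e0; rewrite add0r.
have d0 : 0 < e / (`|C| + 1) by rewrite divr_gt0// ltr_wpDl.
have [N HN] := uu _ d0; have := HN N (leqnn _) => HNN.
have := bC _ (subspaceB sV (Vu_ N) Vu); rewrite (linear_onB lV)// lu sub0r sqrrN.
move=> /le_trans; apply; set q := a _ _ in HNN *.
have q0 : 0 <= q by apply: (psd_ge0 aV); exact: subspaceB.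
apply: le_trans (ler_wpM2r q0 (ler_norm C)) _.
apply: le_trans (ler_wpM2l (normr_ge0 C) HNN) _.
rewrite mulrCA ler_piMr//; first exact: ltW.
by rewrite ler_pdivrMr ?mul1r ?lerDl// ltr_wpDl.
Qed.

Lemma tends_to_cvg V a (u_ : nat -> T) u w : subspace V -> psd_form V a ->
  (forall n, V (u_ n)) -> V u -> V w -> tends_to a u_ u ->
  a (u_ n) w @[n --> \oo] --> a u w.
Proof.
move=> sV aV Vu_ Vu Vw uu; apply/cvgrPdist_le => e e0.
have aw0 := psd_ge0 aV Vw.
have d0 : 0 < e ^+ 2 / (a w w + 1) by rewrite divr_gt0 ?exprn_gt0// ltr_wpDl.
have [N HN] := uu _ d0; exists N => // n /= /HN H.
suff : (a u w - a (u_ n) w) ^+ 2 <= e ^+ 2.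
  by set x : R := _ - _ => xe; rewrite ler_norml; apply/andP; split; nra.
rewrite -sqrrN opprB -(linear_onB (psd_linl sV aV Vw))//.
have Vd := subspaceB sV (Vu_ n) Vu.
apply: le_trans (psd_cauchy_schwarz sV aV Vd Vw) _.
apply: le_trans (ler_wpM2r aw0 H) _.
rewrite mulrAC ler_pdivrMr ?ltr_wpDl// ler_wpM2l ?lerDl//.
exact: sqr_ge0.
Qed.

Lemma complete_ker V a l : subspace V -> psd_form V a -> complete_for V a ->
  linear_on V l -> bounded_for V a l ->
  complete_for [set v | V v /\ l v = 0] a.
Proof.
move=> sV aV cV lV bl u_ Vu_ /cV[n|u Vu uu]; first by have [] := Vu_ n.
exists u => //; split=> //; apply: (bounded_for_cvg sV aV lV bl Vu _ uu) => n.
  by have [] := Vu_ n.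
by have [] := Vu_ n.
Qed.

Definition coercive_on V a c :=
  exists2 e, 0 < e & forall v, V v -> e * a v v <= c v v.

(** Two-sided comparison of c with a gives both forms the same Cauchy sequences and limits. This
    allows [riesz] to be applied to a shifted form instead of a. *)
Lemma complete_equiv V a c K : subspace V -> psd_form V a ->
  complete_for V a -> (forall v, V v -> c v v <= K * a v v) ->
  coercive_on V a c -> complete_for V c.
Proof.
move=> sV aV cV cK [e e0 ec] u_ Vu_ cauchy.
have [d d0|u Vu uu] := cV u_ Vu_.
  have [N HN] := cauchy (e * d) (mulr_gt0 e0 d0); exists N => m n Nm Nn.
  rewrite -(ler_pM2l e0); apply: le_trans (HN m n Nm Nn).
  by apply: ec; exact: subspaceB.
exists u => // d d0.
have K0 : 0 < `|K| + 1 by rewrite ltr_wpDl.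
have [N HN] := uu _ (divr_gt0 d0 K0); exists N => n Nn.
have Vd := subspaceB sV (Vu_ n) Vu.
apply: le_trans (cK _ Vd) _.
apply: (@le_trans _ _ ((`|K| + 1) * a (u_ n - u) (u_ n - u))).
  rewrite ler_wpM2r ?(psd_ge0 aV)// (le_trans (ler_norm _))//.
  by rewrite lerDl.
by rewrite mulrC -ler_pdivlMr//; exact: HN.
Qed.

(** * Coercivity on a subspace of finite codimension *)

Section alternative.
Variables (a c : T -> T -> R) (K : R).

(* If u = w - z is the c-orthogonal component of some w with l w = 1, then
   V is the c-orthogonal sum of ker l and the line spanned by u. *)
Lemma coercive_extend V l : subspace V -> psd_form V a -> psd_form V c ->
  complete_for V a -> (forall v, V v -> c v v <= K * a v v) ->
  linear_on V l -> bounded_for V a l ->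
  coercive_on [set v | V v /\ l v = 0] a c ->
  coercive_on V a c \/ exists u, [/\ V u, c u u = 0 & a u u != 0].
Proof.
move=> sV aV pcV cV cK lV bl coZ.
have [[w0 [Vw0 lw0]]|nw0] := pselect (exists w0, V w0 /\ l w0 != 0); last first.
  left; have [e e0 ec] := coZ; exists e => // v Vv; apply: ec; split => //.
  by apply/eqP; apply: contraT => lv; exfalso; apply: nw0; exists v.
set Z := [set v | V v /\ l v = 0] in coZ.
have ZV : Z `<=` V by move=> v [].
have sZ : subspace Z by exact: subspace_ker.
have aZ := psd_formS ZV aV; have cZ := psd_formS ZV pcV.
have cmZ : complete_for Z c.
  apply: (@complete_equiv Z a c K) => //; first exact: complete_ker.
  by move=> v /ZV; exact: cK.
pose w := (l w0)^-1 *: w0.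
have Vw : V w by exact: subspaceZ.
have lw : l w = 1 by rewrite (linear_onZ sV lV)// mulVf.
(* z is the c-orthogonal projection of w onto Z, which is complete for c by coercivity there. *)
have [||z Zz cz] := @riesz Z c (c w) sZ cZ cmZ.
- by move=> k u v /ZV Vu /ZV Vv; exact: (psd_lin pcV).
- by exists (c w w) => v /ZV Vv; exact: psd_cauchy_schwarz sV pcV Vw Vv.
have Vz := ZV _ Zz.
pose u := w - z; have Vu : V u by exact: subspaceB.
have lu : l u = 1 by rewrite (linear_onB lV)// lw Zz.2 subr0.
have cu v : Z v -> c u v = 0.
  move=> Zv; have Vv := ZV _ Zv.
  by rewrite (linear_onB (psd_linl sV pcV Vv))// cz// subrr.
have au0 : a u u != 0.
  have [C /(_ _ Vu)] := bl; rewrite lu expr1n; apply: contraTneq => ->.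
  by rewrite mulr0 -ltNge.
have [cuu|cuu] := eqVneq (c u u) 0; first by right; exists u.
have {cuu}cu0 : 0 < c u u by rewrite lt_def cuu (psd_ge0 pcV).
have {}au0 : 0 < a u u by rewrite lt_def au0 (psd_ge0 aV).
left; have [e e0 ec] := coZ.
have den : 0 < c u u + e * a u u by rewrite addr_gt0// mulr_gt0.
(* On Z one has p <= cp / e, and on the line t^2 r = (r / s) t^2 s, where s = c u u and r = a u u.
   The constant is half of the reciprocal of 1 / e + r / s; the half pays for the cross term between
   Z and the line, which are not a-orthogonal. *)
exists (e * c u u / (2 * (c u u + e * a u u))) => [|v Vv].
  by rewrite divr_gt0// ?mulr_gt0.
have Zz' : Z (v - l v *: u).
  split; first by apply: subspaceB => //; exact: subspaceZ.
  rewrite (linear_onB lV)//; last exact: subspaceZ.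
  by rewrite (linear_onZ sV lV)// lu mulr1 subrr.
have Vz' := ZV _ Zz'.
have cvv : c v v = c (v - l v *: u) (v - l v *: u) + l v ^+ 2 * c u u.
  rewrite -[v in LHS](subrK (l v *: u)) (psdDZ sV pcV)//.
  by rewrite (psd_sym pcV Vz' Vu) cu// mulr0 addr0.
have avv : a v v <= 2 * a (v - l v *: u) (v - l v *: u) + 2 * l v ^+ 2 * a u u.
  rewrite -[v in leLHS](subrK (l v *: u)) (psdDZ sV aV)//.
  have := psd_ge0 aV (subspaceD sV Vz' (subspaceZ sV (- l v) Vu)).
  rewrite (psdDZ sV aV)// sqrrN; set z' := v - _.
  set p := a z' z'; set q := a z' u; set r := a u u; set t := l v; lra.
have := ec _ Zz'; rewrite cvv.
move: (psd_ge0 aV Vz') (psd_ge0 aV Vv) avv.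
set p := a (v - _) _; set cp := c (v - _) _; set r := a u u; set s := c u u.
set t := l v; set q := a v v => p0 q0 qpr ecp.
rewrite mulrAC ler_pdivrMr ?mulr_gt0//.
apply: (@le_trans _ _ (e * s * (2 * p + 2 * t ^+ 2 * r))).
  by rewrite ler_pM2l// mulr_gt0.
have t2 := sqr_ge0 t.
have er : 0 < e * r by rewrite mulr_gt0.
have h1 : s * (e * p) <= s * cp by rewrite ler_wpM2l// ltW.
have cp0 : 0 <= cp by apply: le_trans ecp; rewrite mulr_ge0// ltW.
have h2 : 0 <= e * r * cp by rewrite mulr_ge0// ltW.
have h3 : 0 <= t ^+ 2 * (s * s) by rewrite mulr_ge0// mulr_ge0// ltW.
by lra.
Qed.

(** Induction on [ls], lifting one constraint at a time: a null vector in the kernel of the head is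
    one in V, and coercivity on that kernel passes to V by [coercive_extend]. *)
Lemma coercive_or_null V (ls : seq (T -> R)) :
  subspace V -> psd_form V a -> psd_form V c ->
  complete_for V a -> (forall v, V v -> c v v <= K * a v v) ->
  (forall l, List.In l ls -> linear_on V l /\ bounded_for V a l) ->
  coercive_on [set v | V v /\ forall l, List.In l ls -> l v = 0] a c ->
  coercive_on V a c \/ exists u, [/\ V u, c u u = 0 & a u u != 0].
Proof.
elim: ls V => [|l ls IH] V sV aV pcV cV cK lsV coZ.
  by left; case: coZ => e e0 ec; exists e => // v Vv; exact: ec.
have [lV bl] := lsV l (or_introl erefl).
set Z := [set v | V v /\ l v = 0].
have ZV : Z `<=` V by move=> v [].
have [||||||||[u [Zu cu au]]] := IH Z.
- exact: subspace_ker.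
- exact: psd_formS ZV aV.
- exact: psd_formS ZV pcV.
- exact: complete_ker.
- by move=> v /ZV; exact: cK.
- move=> l' /(@or_intror (l = l'))/lsV[lV' [C bC]]; split.
    by move=> k u v /ZV Vu /ZV Vv; exact: lV'.
  by exists C => v /ZV; exact: bC.
- case: coZ => e e0 ec; exists e => // v [[Vv lv] lsv]; apply: ec; split => // l'.
  by move=> [<-//|]; exact: lsv.
- exact: coercive_extend.
- by right; exists u; split => //; exact: ZV.
Qed.

End alternative.

(** * The minimum of the Rayleigh quotient *)

Section rayleigh.
Variables (V : set T) (a b : T -> T -> R) (C : R).
Hypotheses (sV : subspace V) (aV : psd_form V a) (bV : psd_form V b).
Hypotheses (cV : complete_for V a) (bC : forall v, V v -> b v v <= C * a v v).
(* How the compactness of the embedding (V, a) -> (V, b) is used: finitely many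
   linear conditions make b smaller than any multiple of a. *)
Hypothesis compact_b : forall e, 0 < e -> exists ls : seq (T -> R),
  (forall l, List.In l ls -> linear_on V l /\ bounded_for V a l) /\
  forall v, V v -> (forall l, List.In l ls -> l v = 0) -> b v v <= e * a v v.

(* The form a - m b, with m the infimum of the Rayleigh quotient, is coercive
   on a subspace of finite codimension but not on V, so it has a null vector. *)
Lemma rayleigh_min : (exists2 v, V v & 0 < b v v) ->
  exists m u, [/\ V u, 0 < b u u, forall v, V v -> a u v = m * b u v &
    forall v, V v -> m * b v v <= a v v].
Proof.
move=> [v0 Vv0 bv0].
have C0 : 0 < C.
  have := lt_le_trans bv0 (bC Vv0); have := psd_ge0 aV Vv0.
  by rewrite le_eqVlt => /orP[/eqP <-|ap]; rewrite ?mulr0 ?ltxx// pmulr_lgt0.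
have apos v : V v -> 0 < b v v -> 0 < a v v.
  by move=> Vv bv; have := lt_le_trans bv (bC Vv); rewrite pmulr_rgt0.
pose S : set R := [set a v v / b v v | v in [set v | V v /\ 0 < b v v]].
have S0 : S !=set0 by exists (a v0 v0 / b v0 v0); exists v0.
have CS x : S x -> C^-1 <= x.
  move=> [v [Vv bv] <-]; rewrite ler_pdivlMr// mulrC ler_pdivrMr//.
  by rewrite mulrC; exact: bC.
have lS : has_lbound S by exists C^-1.
pose m : R := inf S.
have m0 : 0 < m.
  by apply: (@lt_le_trans _ _ C^-1); [rewrite invr_gt0|exact: lb_le_inf].
have mb v : V v -> m * b v v <= a v v.
  move=> Vv; have [bv|bv] := ltP 0 (b v v); last first.
    by apply: (@le_trans _ _ 0); [rewrite pmulr_rle0|exact: (psd_ge0 aV)].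
  by rewrite -ler_pdivlMr//; apply: ge_inf => //; exists v.
pose c u v : R := a u v - m * b u v.
have pc : psd_form V c.
  split=> [u v Vu Vv|w Vw k u v Vu Vv|v Vv].
  - by rewrite /c (psd_sym aV)// (psd_sym bV).
  - by rewrite /c (psd_lin aV Vw)// (psd_lin bV Vw)//; ring.
  - by rewrite /c subr_ge0; exact: mb.
have cK v : V v -> c v v <= 1 * a v v.
  by move=> Vv; rewrite mul1r gerBl mulr_ge0 ?(psd_ge0 bV)// ltW.
(* With this tolerance m b <= a / 2 under the linear conditions, so that c >= a / 2 there. *)
have e0 : 0 < (2 * m)^-1 by rewrite invr_gt0 mulr_gt0.
have [ls [lsV lsb]] := compact_b e0.
have [|[e ep ec]|[u [Vu cu au]]] := coercive_or_null sV aV pc cV cK lsV.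
- exists (1 / 2); first by rewrite divr_gt0.
  move=> v [Vv lv]; have := lsb _ Vv lv; rewrite /c.
  rewrite mulrC ler_pdivlMr ?mulr_gt0//; set p := a v v; set q := b v v.
  by lra.
- exfalso.
  (* Coercivity with constant e reads m b <= (1 - e) a. This fails at v0 if e >= 1; otherwise every
     quotient is at least m / (1 - e) > m, against the choice of m. *)
  have [e1|e1] := leP 1 e.
    have := ec _ Vv0; rewrite /c; apply/negP; rewrite -ltNge.
    have := mulr_gt0 m0 bv0; have := apos _ Vv0 bv0.
    by move: (a v0 v0) (b v0 v0) => p q p0 q0; nra.
  have me : m < m / (1 - e).
    by rewrite ltr_pdivlMr ?subr_gt0// gtr_pMr// ltrBlDr ltrDl.
  have me0 : 0 < m / (1 - e) - m by rewrite subr_gt0.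
  have [_ [v [Vv bv] <-]] := inf_adherent me0 (conj S0 lS).
  rewrite -/m addrC subrK ltr_pdivrMr// mulrAC ltr_pdivlMr ?subr_gt0//.
  have := ec _ Vv; rewrite /c; move: (a v v) (m * b v v) => p q; lra.
- exists m, u; split => //.
    rewrite lt_def (psd_ge0 bV)// andbT; apply: contra_neq au => bu.
    by move: cu; rewrite /c bu mulr0 subr0.
  (* By Cauchy-Schwarz a null vector of the semidefinite form c is c-orthogonal to all of V, which
     is the eigenvector equation. *)
  move=> v Vv; apply/eqP; rewrite -subr_eq0 -/(c u v) -sqrf_eq0.
  rewrite eq_le sqr_ge0 andbT (le_trans (psd_cauchy_schwarz sV pc Vu Vv))//.
  by rewrite cu mul0r.
Qed.

End rayleigh.

Lemma bounded_for_form V a b C w : subspace V -> psd_form V b -> V w ->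
  (forall v, V v -> b v v <= C * a v v) -> bounded_for V a (b w).
Proof.
move=> sV bV Vw bC; exists (b w w * C) => v Vv.
apply: le_trans (psd_cauchy_schwarz sV bV Vw Vv) _.
by rewrite -mulrA ler_wpM2l// ?(psd_ge0 bV)// bC.
Qed.

(** * The spectral gap and the shifted form *)

Section spectral_gap.
Variables (V : set T) (a b : T -> T -> R) (C : R).
Hypotheses (sV : subspace V) (aV : psd_form V a) (bV : psd_form V b).
Hypotheses (cV : complete_for V a) (bC : forall v, V v -> b v v <= C * a v v).
Hypothesis compact_b : forall e, 0 < e -> exists ls : seq (T -> R),
  (forall l, List.In l ls -> linear_on V l /\ bounded_for V a l) /\
  forall v, V v -> (forall l, List.In l ls -> l v = 0) -> b v v <= e * a v v.
Variables (e : T) (lambda0 lambda1 : R).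
Hypotheses (Ve : V e) (bee : b e e = 1).
Hypothesis eig_e : forall v, V v -> a e v = lambda0 * b e v.
Hypothesis second : forall m u, V u -> 0 < b u u -> b e u = 0 ->
  (forall v, V v -> a u v = m * b u v) -> lambda1 <= m.

Lemma rayleigh_orthogonal v : V v -> b e v = 0 -> lambda1 * b v v <= a v v.
Proof.
move=> Vv bev; have [bv|bv] := ltP 0 (b v v); last first.
  have -> : b v v = 0 by apply/eqP; rewrite eq_le bv (psd_ge0 bV).
  by rewrite mulr0 (psd_ge0 aV).
set Z := [set v | V v /\ b e v = 0].
have ZV : Z `<=` V by move=> ? [].
have le := psd_lin bV Ve; have be := bounded_for_form sV bV Ve bC.
have sZ : subspace Z by exact: subspace_ker.
have aZ := psd_formS ZV aV; have bZ := psd_formS ZV bV.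
have cZ : complete_for Z a by exact: complete_ker.
have [|||m [u [Zu bu eigu mb]]] := @rayleigh_min Z a b C sZ aZ bZ cZ.
- by move=> ? /ZV; exact: bC.
- move=> d d0; have [ls [lsV lsb]] := compact_b d0; exists ls; split.
    move=> l /lsV[lV [K bK]]; split; last by exists K => ? /ZV; exact: bK.
    by move=> k ? ? /ZV ? /ZV ?; exact: lV.
  by move=> ? /ZV ?; exact: lsb.
- by exists v.
have [Vu beu] := Zu.
have : lambda1 <= m.
  apply: (second Vu bu beu) => w Vw.
  (* The minimizer satisfies its equation against Z only. Against e both sides vanish, because e is
     an eigenvector and b e u = 0, so the equation holds on V and [second] applies. *)
  have Vk := subspaceZ sV (b e w) Ve.
  have Zw : Z (w - b e w *: e).
    split; first exact: subspaceB.
    by rewrite (linear_onB le)// (linear_onZ sV le)// bee mulr1 subrr.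
  rewrite -(subrK (b e w *: e) w); have Vw' := ZV _ Zw.
  rewrite (linear_onD (psd_lin aV Vu))// (linear_onD (psd_lin bV Vu))// eigu//.
  rewrite (linear_onZ sV (psd_lin aV Vu))// (linear_onZ sV (psd_lin bV Vu))//.
  by rewrite (psd_sym aV Vu Ve) (psd_sym bV Vu Ve) eig_e// beu; ring.
move=> lm; apply: (@le_trans _ _ (m * b v v)); last exact: mb.
by rewrite ler_wpM2r// (psd_ge0 bV).
Qed.

(** The eigenvector equation makes the remainder orthogonal to e for a as well as for b, so both
    forms split without cross terms. *)
Lemma decompose v : V v -> exists2 z, V z & [/\ b e z = 0, v = b e v *: e + z,
  a v v = b e v ^+ 2 * lambda0 + a z z & b v v = b e v ^+ 2 + b z z].
Proof.
move=> Vv; have Vk := subspaceZ sV (b e v) Ve.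
have Vz : V (v - b e v *: e) by exact: subspaceB.
exists (v - b e v *: e) => //.
have bz : b e (v - b e v *: e) = 0.
  rewrite (linear_onB (psd_lin bV Ve))// (linear_onZ sV (psd_lin bV Ve))//.
  by rewrite bee mulr1 subrr.
have az : a (v - b e v *: e) e = 0.
  by rewrite (psd_sym aV)// eig_e// bz mulr0.
split => //; first by rewrite addrC subrK.
  rewrite -{1 2}[v](subrK (b e v *: e)) (psdDZ sV aV)// az eig_e// bee; ring.
rewrite -{1 2}[v](subrK (b e v *: e)) (psdDZ sV bV)// bee (psd_sym bV Vz Ve) bz.
ring.
Qed.

Hypotheses (l01 : lambda0 < lambda1) (l0 : 0 < lambda0).

(* With u0 = c e + r and v = s e + z, closeness to the eigenspace makes r small
   and the constraint c s + b(r, z) = 0 then makes s small compared to z. *)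
Lemma shifted_form_coercive u0 w : V u0 -> b u0 u0 = 1 -> V w ->
  (forall v, V v -> a w v = lambda0 * b w v) ->
  a (u0 - w) (u0 - w) <= (lambda1 - lambda0) / 4 ->
  forall v, V v -> b u0 v = 0 ->
  (lambda1 - lambda0) / (4 * lambda1) * a v v <= a v v - a u0 u0 * b v v.
Proof.
move=> Vu0 bu0 Vw eigw close v Vv b0v.
have l0' := l0; have l1 : 0 < lambda1 by exact: lt_trans l01.
have [r Vr [ber u0r au0 bu0r]] := decompose Vu0.
have [z Vz [bez vz av bv]] := decompose Vv.
have lb := psd_lin bV; have la := psd_lin aV.
(* The part r' of w orthogonal to e is a-null, since its Rayleigh quotient would otherwise be
   lambda0 < lambda1. Hence u0 - w is r - r' plus a multiple of e, a-orthogonally, and its energy is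
   at least that of r. *)
have Dr : a r r <= (lambda1 - lambda0) / 4.
  apply: le_trans close; have Vd := subspaceB sV Vu0 Vw.
  have [r' Vr' [ber' wr' aw bw]] := decompose Vw.
  have r'0 : a r' r' = 0.
    have := eigw _ Vw; rewrite aw bw => H.
    have {}H : a r' r' = lambda0 * b r' r' by lra.
    have := rayleigh_orthogonal Vr' ber'; have := psd_ge0 bV Vr'.
    rewrite H le_eqVlt => /orP[/eqP <-|bp]; first by rewrite !mulr0.
    by rewrite ler_pM2r// leNgt l01.
  have rr' : a r r' = 0.
    apply/eqP; rewrite -sqrf_eq0 eq_le sqr_ge0 andbT.
    by rewrite (le_trans (psd_cauchy_schwarz sV aV Vr Vr'))// r'0 mulr0.
  have Vrr : V (r - r') by exact: subspaceB.
  have -> : u0 - w = (r - r') + (b e u0 - b e w) *: e.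
    rewrite {1}u0r {1}wr' scalerBl opprD addrACA; exact: addrC.
  rewrite (psdDZ sV aV)// (psdB sV aV)// r'0 rr' (psd_sym aV Vrr Ve) eig_e//.
  rewrite (linear_onB (lb _ Ve))// ber ber' eig_e// bee.
  by have := mulr_ge0 (sqr_ge0 (b e u0 - b e w)) (ltW l0); lra.
have rb := rayleigh_orthogonal Vr ber; have zb := rayleigh_orthogonal Vz bez.
have csx : b e u0 * b e v + b r z = 0.
  rewrite -b0v [in RHS]u0r [in RHS]vz.
  have Vk := subspaceZ sV (b e u0) Ve; have Vk' := subspaceZ sV (b e v) Ve.
  have Vs := subspaceD sV Vk Vr.
  rewrite (linear_onD (lb _ Vs))// (linear_onZ sV (lb _ Vs))//.
  rewrite !(linear_onD (psd_linl sV bV _))// !(linear_onZ sV (psd_linl sV bV _))//.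
  by rewrite bee bez (psd_sym bV Vr Ve) ber; ring.
have x2 := psd_cauchy_schwarz sV bV Vr Vz.
have := psd_ge0 bV Vz; have := psd_ge0 bV Vr; have := psd_ge0 aV Vz.
move: csx x2 rb zb Dr; rewrite au0 av bv; move: bu0r; rewrite bu0.
move: (b e u0) (b e v) (b r z) (a r r) (a z z) (b r r) (b z z).
move=> c s x D A beta B c2 csx x2 rb zb Dr A0 beta0 B0.
have {}csx : x = - (c * s) by lra.
have G0 : 0 < lambda1 - lambda0 by rewrite subr_gt0.
(* lambda1 beta <= D <= lambda1 / 4. Then c^2 = 1 - beta >= 3 / 4, and the constraint c s = - x with
   x^2 <= beta B gives s^2 <= B / 3. *)
have beta4 : beta <= 1 / 4.
  by rewrite -(ler_pM2l l1); apply: le_trans rb _; lra.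
have s0 := sqr_ge0 s.
have s2 : s ^+ 2 <= B / 3.
  have h : c ^+ 2 * s ^+ 2 <= beta * B by rewrite -exprMn -sqrrN -csx.
  have h1 : 0 <= (1 / 4 - beta) * B by rewrite mulr_ge0// subr_ge0.
  have h2 : 0 <= (c ^+ 2 - 3 / 4) * s ^+ 2 by rewrite mulr_ge0// subr_ge0; lra.
  by lra.
have D0 : 0 <= D by apply: le_trans rb; rewrite mulr_ge0// ltW.
have c1 : c ^+ 2 * lambda0 <= lambda0 by rewrite ger_pMl//; lra.
set mu := c ^+ 2 * lambda0 + D.
have mu1 : mu <= lambda0 + (lambda1 - lambda0) / 4 by rewrite lerD.
have m1 : mu * (s ^+ 2 + B) <=
    (lambda0 + (lambda1 - lambda0) / 4) * (s ^+ 2 + B).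
  by rewrite ler_wpM2r// addr_ge0.
have m2 : (lambda1 - lambda0) * s ^+ 2 <= (lambda1 - lambda0) * (B / 3).
  by rewrite ler_wpM2l// ltW.
(* With G = lambda1 - lambda0, the excess of mu over lambda0 costs G / 4 times s^2 + B, and s^2 <= B
   / 3 turns this into G / 4 + G / 12 = G / 3 times B. *)
have rhs : A - (lambda0 + (lambda1 - lambda0) / 3) * B <=
    s ^+ 2 * lambda0 + A - mu * (s ^+ 2 + B) by lra.
(* Since lambda1 B <= A, what remains is at least 2 G A / (3 lambda1), while s^2 lambda0 + A <= 4 A
   / 3. The factor G / (4 lambda1) therefore leaves a margin of 2. *)
apply: le_trans rhs; rewrite mulrAC ler_pdivrMr ?mulr_gt0//.
have q1 : s ^+ 2 * lambda0 <= B / 3 * lambda0 by rewrite ler_wpM2r// ltW.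
have q2 : B * lambda0 <= A.
  by apply: le_trans zb; rewrite mulrC ler_wpM2r// ltW.
have q3 : (lambda1 - lambda0) * (s ^+ 2 * lambda0 + A) <=
   (lambda1 - lambda0) * (A * (4 / 3)) by rewrite (ler_wpM2l (ltW G0))//; lra.
apply: le_trans q3 _.
have q4 : (lambda0 + (lambda1 - lambda0) / 3) * (lambda1 * B) <=
   (lambda0 + (lambda1 - lambda0) / 3) * A by rewrite ler_wpM2l//; lra.
by have := mulr_ge0 (ltW G0) A0; lra.
Qed.

End spectral_gap.

(** * The saddle point problem *)

Section saddle.
Variables (V : set T) (a b : T -> T -> R) (C mu : R) (u0 : T).
Hypotheses (sV : subspace V) (aV : psd_form V a) (bV : psd_form V b).
Hypotheses (cV : complete_for V a) (bC : forall v, V v -> b v v <= C * a v v).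
Hypotheses (Vu0 : V u0) (bu0 : b u0 u0 = 1).

Let A u v : R := a u v - mu * b u v.
Let Z := [set v | V v /\ b u0 v = 0].

Hypothesis coA : coercive_on Z a A.

(** As b u0 u0 = 1, V is the sum of Z and the line of u0. The constraint fixes the component g u0 of
    the solution, [riesz] on Z gives the rest, and testing with u0 gives the multiplier. The
    difference of two solutions lies in Z and is A-null, hence a-null by coercivity. *)
Lemma saddle_point f (g : R) : linear_on V f -> bounded_for V a f ->
  exists u (l : R), [/\ V u, forall v, V v -> A u v - l * b u0 v = f v,
    b u0 u = g & forall u' (l' : R), V u' ->
    (forall v, V v -> A u' v - l' * b u0 v = f v) -> b u0 u' = g ->
    a (u' - u) (u' - u) = 0 /\ l' = l].
Proof.
move=> fV bf.
have ZV : Z `<=` V by move=> ? [].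
have l0 := psd_lin bV Vu0; have b0 := bounded_for_form sV bV Vu0 bC.
have sZ : subspace Z by exact: subspace_ker.
have aZ := psd_formS ZV aV; have bZ := psd_formS ZV bV.
have cZ : complete_for Z a by exact: complete_ker.
have AV w : V w -> linear_on V (A w).
  by move=> Vw k u v Vu Vv; rewrite /A (psd_lin aV Vw)// (psd_lin bV Vw)//; ring.
have As u v : V u -> V v -> A u v = A v u.
  by move=> Vu Vv; rewrite /A (psd_sym aV)// (psd_sym bV).
have [e e0 ec] := coA.
have AZ : psd_form Z A.
  split=> [u v /ZV Vu /ZV Vv|w /ZV Vw k u v /ZV Vu /ZV Vv|v Zv].
  - exact: As.
  - exact: AV.
  - by apply: le_trans (ec _ Zv); rewrite mulr_ge0 ?(psd_ge0 aZ)// ltW.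
have AK v : Z v -> A v v <= (1 + `|mu| * C) * a v v.
  move=> /ZV Vv; rewrite /A mulrDl mul1r lerD2l -mulrA.
  apply: (@le_trans _ _ (`|mu| * b v v)).
    by rewrite -mulNr ler_wpM2r ?(psd_ge0 bV)// -normrN ler_norm.
  by rewrite ler_wpM2l//; exact: bC.
have cA : complete_for Z A by exact: (@complete_equiv Z a A _ sZ aZ cZ AK coA).
have Vg : V (g *: u0) by exact: subspaceZ.
have [||z Zz Az] := @riesz Z A (fun v => f v - A (g *: u0) v) sZ AZ cA.
- by move=> k u v /ZV Vu /ZV Vv; rewrite fV// (AV _ Vg)//; ring.
- have bmu := bounded_for_form sV bV Vg bC.
  have ba : bounded_for V a (a (g *: u0)).
    by apply: (@bounded_for_form V a a 1) => // v Vv; rewrite mul1r.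
  have [K1 H1] := bf; have [K2 H2] := ba; have [K3 H3] := bmu.
  (* The square of a sum of three terms is at most three times the sum of the squares; 1 / e
     converts a bound by a into one by A on Z. *)
  exists (3 * (`|K1| + `|K2| + mu ^+ 2 * `|K3|) / e) => v Zv; have Vv := ZV _ Zv.
  have q0 := psd_ge0 aV Vv.
  have {}H1 := le_trans (H1 _ Vv) (ler_wpM2r q0 (ler_norm _)).
  have {}H2 := le_trans (H2 _ Vv) (ler_wpM2r q0 (ler_norm _)).
  have {}H3 := le_trans (H3 _ Vv) (ler_wpM2r q0 (ler_norm _)).
  have {}H3 := ler_wpM2l (sqr_ge0 mu) H3.
  rewrite mulrAC ler_pdivlMr// mulrC.
  apply: (@le_trans _ _ (3 * (`|K1| + `|K2| + mu ^+ 2 * `|K3|) * (e * a v v)));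
    last first.
    rewrite ler_wpM2l ?ec// mulr_ge0// addr_ge0 ?addr_ge0//.
    by rewrite mulr_ge0// sqr_ge0.
  rewrite [leRHS]mulrCA (ler_pM2l e0) /A; move: H1 H2 H3.
  move: (f v) (a _ v) (b _ v) (a v v) `|K1| `|K2| `|K3| => x y t q k1 k2 k3 H1 H2 H3.
  have h : (x - (y - mu * t)) ^+ 2 <= 3 * (x ^+ 2 + y ^+ 2 + mu ^+ 2 * t ^+ 2).
    have := sqr_ge0 (x + y); have := sqr_ge0 (x - mu * t).
    by have := sqr_ge0 (y + mu * t); lra.
  by lra.
have Vz := ZV _ Zz.
pose u := g *: u0 + z; have Vu : V u by exact: subspaceD.
have solZ v : Z v -> A u v = f v.
  move=> Zv; have Vv := ZV _ Zv; rewrite As//.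
  rewrite (linear_onD (AV _ Vv))// As// [A v z]As// Az//; ring.
have sol v : V v -> A u v - (A u u0 - f u0) * b u0 v = f v.
  move=> Vv; have Vk := subspaceZ sV (b u0 v) Vu0.
  have Zw : Z (v - b u0 v *: u0).
    split; first exact: subspaceB.
    by rewrite (linear_onB l0)// (linear_onZ sV l0)// bu0 mulr1 subrr.
  have Vw := ZV _ Zw; have := solZ _ Zw.
  rewrite (linear_onB (AV _ Vu))// (linear_onB fV)//.
  by rewrite (linear_onZ sV (AV _ Vu))// (linear_onZ sV fV)//; lra.
have bu : b u0 u = g.
  by rewrite (linear_onD l0)// (linear_onZ sV l0)// bu0 Zz.2 mulr1 addr0.
exists u, (A u u0 - f u0); split => // u' l' Vu' sol' bu'.
have Vd : V (u' - u) by exact: subspaceB.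
have Zd : Z (u' - u) by split=> //; rewrite (linear_onB l0)// bu bu' subrr.
have l'E : A u' u0 - f u0 = l' by have := sol' _ Vu0; rewrite bu0; lra.
have Add : A (u' - u) (u' - u) = 0.
  rewrite (linear_onB (AV _ Vd))// !(As (u' - u))//.
  by have := sol' _ Vd; have := sol _ Vd; rewrite Zd.2; lra.
have add : a (u' - u) (u' - u) = 0.
  apply/eqP; rewrite eq_le (psd_ge0 aV)// andbT.
  by have := ec _ Zd; rewrite Add pmulr_rle0.
split => //; rewrite -l'E; congr (_ - _).
have ad0 : a (u' - u) u0 = 0.
  apply/eqP; rewrite -sqrf_eq0 eq_le sqr_ge0 andbT.
  by rewrite (le_trans (psd_cauchy_schwarz sV aV Vd Vu0))// add mul0r.
have : A (u' - u) u0 = 0.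
  by rewrite /A ad0 (psd_sym bV)// Zd.2 mulr0 subr0.
by rewrite As// (linear_onB (AV _ Vu0))// !(As u0)//; lra.
Qed.

End saddle.

(** * The closure of a subspace for a form *)

Section form_closure.
Variables (V S : set T) (h : T -> T -> R).
Hypotheses (sV : subspace V) (hV : psd_form V h) (sS : subspace S).
Hypothesis (SV : S `<=` V).

(** H^1_0 is the case where V is H^1, S consists of the test functions and h is b + a. *)
Definition form_closure : set T := [set u | V u /\
  forall e, 0 < e -> exists2 s, S s & h (u - s) (u - s) <= e].

Lemma form_closure_subspace : subspace form_closure.
Proof.
split.
  split; first exact: sV.1.
  move=> e e0; exists 0; first exact: sS.1.
  by rewrite subrr (linear_on0 sV (psd_lin hV sV.1)) ltW.
move=> k u v [Vu au] [Vv av]; split; first exact: sV.2.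
move=> e e0.
have d1 : 0 < e / (4 * (k ^+ 2 + 1)) by rewrite divr_gt0 ?mulr_gt0 ?ltr_wpDl ?sqr_ge0.
have d2 : 0 < e / 4 by rewrite divr_gt0.
have [s Ss Hs] := au _ d1; have [t St Ht] := av _ d2.
exists (k *: s + t); first exact: sS.2.
rewrite opprD addrACA -scalerBr.
have Vd1 := subspaceB sV Vu (SV Ss); have Vd2 := subspaceB sV Vv (SV St).
apply: le_trans (psdD_le sV hV (subspaceZ sV k Vd1) Vd2) _.
rewrite (psdZ sV hV)//.
have h1 : k ^+ 2 * h (u - s) (u - s) <= e / 4.
  apply: le_trans (ler_wpM2l (sqr_ge0 k) Hs) _.
  rewrite mulrA ler_pdivrMr ?mulr_gt0 ?ltr_wpDl ?sqr_ge0//.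
  have -> : e / 4 * (4 * (k ^+ 2 + 1)) = k ^+ 2 * e + e by field.
  by rewrite lerDl ltW.
by move: h1 Ht; lra.
Qed.

Lemma form_closure_complete : complete_for V h -> complete_for form_closure h.
Proof.
move=> cV u_ cu /cV[n|u Vu uu]; first by have [] := cu n.
exists u => //; split => // e e0; have d0 : 0 < e / 4 by rewrite divr_gt0.
have [N /(_ N (leqnn _)) HN] := uu _ d0; have [VN /(_ _ d0)[s Ss Hs]] := cu N.
exists s => //; rewrite -[u](subrK (u_ N)) -addrA.
have Vd1 := subspaceB sV Vu VN; have Vd2 := subspaceB sV VN (SV Ss).
apply: le_trans (psdD_le sV hV Vd1 Vd2) _.
rewrite (psd_opp sV hV Vu VN); move: HN Hs.
by move: (h _ _) (h _ _) => x y; lra.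
Qed.

Section inequalities.
Variables a b : T -> T -> R.
Hypotheses (aV : psd_form V a) (bV : psd_form V b).
Hypothesis h_E : forall u v, h u v = b u v + a u v.

Lemma form_closure_split u e : form_closure u -> 0 < e -> exists s,
  [/\ S s, b u u <= 2 * e + 2 * b s s, a s s <= 2 * e + 2 * a u u &
    0 <= b (u - s) (u - s) <= e].
Proof.
move=> [Vu H] /H[s Ss]; rewrite h_E => He; exists s.
have Vs := SV Ss; have Vd := subspaceB sV Vu Vs.
have := psd_ge0 aV Vd; have := psd_ge0 bV Vd.
have := psdD_le sV bV Vd Vs; rewrite subrK.
have := psdD_le sV aV (subspaceB sV Vs Vu) Vu; rewrite subrK (psd_opp sV aV Vs Vu).
move: He; set x := a (u - s) _; set y := b (u - s) _ => ? ? ? ? ?.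
by split => //; [lra|lra|apply/andP; split; lra].
Qed.

(** Passing from u to an approximant s in b, and back from s to u in a, costs a factor 2 each time;
    hence the 4. *)
Lemma form_closure_le C : 0 < C -> (forall s, S s -> b s s <= C * a s s) ->
  forall u, form_closure u -> b u u <= 4 * C * a u u.
Proof.
move=> C0 SC u cu; apply/ler_addgt0Pr => e e0.
have d0 : 0 < e / (4 * C + 2) by rewrite divr_gt0// addr_gt0// mulr_gt0.
have [s [Ss H1 H2 _]] := form_closure_split cu d0.
have := SC _ Ss; have := ler_wpM2l (ltW C0) H2.
have E_ : (e / (4 * C + 2)) * (4 * C + 2) = e.
  by rewrite divfK// gt_eqF// addr_gt0// mulr_gt0.
by move: H1 E_; set d := e / _; lra.
Qed.

(** The conditions on u do not annihilate the approximant s, but l j s = - l j (u - s) is small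
    because l j is bounded for b. M collects the coefficients of the error e / M in the final
    estimate. *)
Lemma form_closure_compact (J : finType) (l : J -> T -> R) (eps K B : R) :
  0 < eps -> 0 <= K -> 0 <= B -> (forall j, linear_on V (l j)) ->
  (forall j v, V v -> l j v ^+ 2 <= B * b v v) ->
  (forall s, S s -> b s s <= eps * a s s + K * \sum_j l j s ^+ 2) ->
  forall u, form_closure u -> (forall j, l j u = 0) -> b u u <= 4 * eps * a u u.
Proof.
move=> eps0 K0 B0 lV lB SC u cu lu; apply/ler_addgt0Pr => e e0.
pose M := 2 + 4 * eps + 2 * (K * (#|J|%:R * B)).
have M0 : 0 < M.
  by rewrite ltr_wpDr ?addr_gt0 ?mulr_gt0// !mulr_ge0.
have d0 : 0 < e / M by rewrite divr_gt0.
have [s [Ss H1 H2 /andP[H3 H3']]] := form_closure_split cu d0.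
have Vu := cu.1; have Vs := SV Ss; have Vd := subspaceB sV Vu Vs.
have ls : \sum_j l j s ^+ 2 <= #|J|%:R * B * (e / M).
  rewrite -mulrA mulr_natl -sumr_const; apply: ler_sum => j _.
  have -> : l j s ^+ 2 = l j (u - s) ^+ 2.
    by rewrite (linear_onB (lV j))// lu sub0r sqrrN.
  by apply: le_trans (lB j _ Vd) _; rewrite ler_wpM2l.
have := SC _ Ss; have := ler_wpM2l (ltW eps0) H2; have := ler_wpM2l K0 ls.
have : (e / M) * (2 + 4 * eps + 2 * (K * (#|J|%:R * B))) = e.
  by rewrite divfK// gt_eqF.
by move: H1; set d := e / M; set z := \sum_j _; set w := #|J|%:R; lra.
Qed.

End inequalities.

End form_closure.

End hilbert.

(** * Integration on R^n along coordinates *)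

Section bounded_support.
Context d (T : measurableType d) {R : realType}.
Variable mu : {measure set T -> \bar R}.
Implicit Types (D : set T) (f g : T -> R).

(** A class stable under sums, products, slices and partial integrals, whose members are integrable
    as soon as D has finite measure. It discharges the side conditions of linearity and Fubini. *)
Definition bsupp D f := [/\ measurable_fun [set: T] f,
  exists B, forall x, `|f x| <= B & forall x, ~ D x -> f x = 0].

Lemma bsupp_mul_bounded D f g : bsupp D f -> measurable_fun [set: T] g ->
  (exists B, forall x, `|g x| <= B) -> bsupp D (fun x => f x * g x).
Proof.
move=> [mf [B fB] f0] mg [C gC]; split; first exact: measurable_funM.
  by exists (B * C) => x; rewrite normrM ler_pM.
by move=> x /f0 ->; rewrite mul0r.
Qed.

Lemma bsuppM D f g : bsupp D f -> bsupp D g -> bsupp D (fun x => f x * g x).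
Proof. by move=> bf [mg bg _]; exact: bsupp_mul_bounded. Qed.

Lemma bsuppX D f n : bsupp D f -> bsupp D (fun x => f x ^+ n.+1).
Proof.
move=> bf; elim: n => [|n IH]; first by rewrite (_ : (fun _ => _) = f).
by under eq_fun do rewrite exprS; exact: bsuppM.
Qed.

Lemma bsuppD D f g : bsupp D f -> bsupp D g -> bsupp D (fun x => f x + g x).
Proof.
move=> [mf [B fB] f0] [mg [C gC] g0]; split; first exact: measurable_funD.
  by exists (B + C) => x; apply: le_trans (ler_normD _ _) _; exact: lerD.
by move=> x Dx; rewrite f0// g0// addr0.
Qed.

Lemma bsuppZ D k f : bsupp D f -> bsupp D (fun x => k * f x).
Proof.
move=> [mf [B fB] f0]; split; first exact: measurable_funM.
  by exists (`|k| * B) => x; rewrite normrM ler_wpM2l.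
by move=> x Dx; rewrite f0// mulr0.
Qed.

Lemma bsuppB D f g : bsupp D f -> bsupp D g -> bsupp D (fun x => f x - g x).
Proof.
move=> bf bg; have := bsuppD bf (bsuppZ (-1) bg).
by under eq_fun do rewrite mulN1r.
Qed.

Lemma bsupp0 D : bsupp D (fun=> 0).
Proof. by split => //; exists 0 => x; rewrite normr0. Qed.

Lemma bsupp_sum D (I : Type) (r : seq I) (P : pred I) (F : I -> T -> R) :
  (forall i, bsupp D (F i)) -> bsupp D (fun x => \sum_(i <- r | P i) F i x).
Proof.
move=> bF; elim: r => [|i r IH].
  by under eq_fun do rewrite big_nil; exact: bsupp0.
under eq_fun do rewrite big_cons; case: (P i) => //; exact: bsuppD.
Qed.

Lemma bsupp_indicM D f S : bsupp D f -> measurable S ->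
  bsupp D (fun x => \1_S x * f x).
Proof.
move=> bf mS; under eq_fun do rewrite mulrC; apply: bsupp_mul_bounded => //.
by exists 1 => x; rewrite indicE; case: (_ \in _); rewrite ?normr1 ?normr0.
Qed.

Section integral.
Variable D : set T.
Hypotheses (mD : measurable D) (muD : (mu D < +oo)%E).

Lemma bsupp_integrable f : bsupp D f -> mu.-integrable setT (EFin \o f).
Proof.
move=> [mf [B fB] f0].
have -> : EFin \o f = (EFin \o f) \_ D.
  apply/funext => x; rewrite patchE; case: ifPn => //=.
  by rewrite notin_setE => /f0 ->.
apply/(integrable_mkcond (EFin \o f) mD).
apply: measurable_bounded_integrable => //; first exact: measurable_funTS.
exists B; split; first exact: num_real.
by move=> M BM x _; apply: le_trans (fB x) _; exact: ltW.
Qed.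

Lemma bsupp_RintegralD f g : bsupp D f -> bsupp D g ->
  \int[mu]_x (f x + g x) = \int[mu]_x f x + \int[mu]_x g x.
Proof.
by move=> bf bg; rewrite RintegralD//; exact: bsupp_integrable.
Qed.

Lemma bsupp_RintegralB f g : bsupp D f -> bsupp D g ->
  \int[mu]_x (f x - g x) = \int[mu]_x f x - \int[mu]_x g x.
Proof.
by move=> bf bg; rewrite RintegralB//; exact: bsupp_integrable.
Qed.

Lemma bsupp_RintegralZ k f : bsupp D f ->
  \int[mu]_x (k * f x) = k * \int[mu]_x f x.
Proof.
by move=> bf; rewrite RintegralZl//; exact: bsupp_integrable.
Qed.

Lemma bsupp_Rintegral_sum (I : Type) (r : seq I) (P : pred I) (F : I -> T -> R) :
  (forall i, bsupp D (F i)) ->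
  \int[mu]_x (\sum_(i <- r | P i) F i x) = \sum_(i <- r | P i) \int[mu]_x F i x.
Proof.
move=> bF; elim: r => [|i r IH].
  rewrite big_nil; under eq_Rintegral do rewrite big_nil.
  by rewrite /Rintegral integral0.
rewrite big_cons; under eq_Rintegral do rewrite big_cons.
by case: (P i) => //; rewrite bsupp_RintegralD ?IH//; exact: bsupp_sum.
Qed.

Lemma bsupp_le_Rintegral f g : bsupp D f -> bsupp D g ->
  (forall x, f x <= g x) -> \int[mu]_x f x <= \int[mu]_x g x.
Proof.
by move=> bf bg fg; apply: le_Rintegral => //; exact: bsupp_integrable.
Qed.

Lemma bsupp_indic S : measurable S -> S `<=` D -> bsupp D \1_S.
Proof.
move=> mS SD; split; first exact: measurable_indic.
  by exists 1 => x; rewrite indicE; case: (_ \in _); rewrite ?normr1 ?normr0.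
by move=> x Dx; rewrite indicE memNset// => /SD.
Qed.

Lemma Rintegral_indic S : measurable S -> \int[mu]_x \1_S x = fine (mu S).
Proof. by move=> mS; rewrite /Rintegral integral_indic// setIT. Qed.

Lemma bsupp_norm f : bsupp D f -> bsupp D (fun x => `|f x|).
Proof.
move=> [mf [B fB] f0]; split; first exact: measurableT_comp.
  by exists B => x; rewrite normr_id.
by move=> x /f0 ->; rewrite normr0.
Qed.

Lemma bsupp_Rintegral_bound f B : (forall x, `|f x| <= B) -> bsupp D f ->
  `|\int[mu]_x f x| <= B * fine (mu D).
Proof.
move=> fB bf; have [mf _ f0] := bf.
have bD : bsupp D \1_D by exact: bsupp_indic.
apply: le_trans (le_normr_Rintegral measurableT (bsupp_integrable bf)) _.
rewrite -(Rintegral_indic mD) -bsupp_RintegralZ//.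
apply: bsupp_le_Rintegral; [exact: bsupp_norm|exact: bsuppZ|move=> x].
have [Dx|Dx] := pselect (D x); first by rewrite indicE mem_set// mulr1.
by rewrite f0// normr0 indicE memNset// mulr0.
Qed.

(* Jensen: integrate [0 <= (f + t)^2] over D, for every constant t. *)
Lemma bsupp_sqr_Rintegral f : bsupp D f ->
  (\int[mu]_x f x) ^+ 2 <= fine (mu D) * \int[mu]_x (f x ^+ 2).
Proof.
move=> bf; have bD : bsupp D \1_D by exact: bsupp_indic.
have b2 : bsupp D (fun x => f x ^+ 2) by exact: bsuppX.
rewrite mulrC; apply: quadratic_ge0; last exact: fine_ge0.
move=> t; rewrite -(Rintegral_indic mD) [2 * t * _](_ : _ = \int[mu]_x (2 * t * f x)).
  have b3 := bsuppZ (2 * t) bf; have b4 := bsuppZ (t ^+ 2) bD.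
  have b5 := bsuppD b2 b3.
  rewrite -bsupp_RintegralZ// -!bsupp_RintegralD//.
  apply: Rintegral_ge0 => x _; have [_ _ f0] := bf.
  have [Dx|Dx] := pselect (D x).
    rewrite indicE mem_set// mulr1; have := sqr_ge0 (f x + t); lra.
  by rewrite f0// indicE memNset// !mulr0 expr0n !addr0.
by rewrite bsupp_RintegralZ.
Qed.

End integral.

End bounded_support.


(** * Slices of functions supported in a box *)

Section rV_boxes.
Context {R : realType}.
Local Notation leb := (@lebesgue_measure R).

Lemma measurable_rV_box n (A : 'I_n -> set (measurableTypeR R)) :
  (forall i, measurable (A i)) ->
  measurable [set x : 'rV[R]_n | forall i, A i (x 0 i)].
Proof.
move=> mA; rewrite (_ : [set x | _] =
    \bigcap_(i in [set: 'I_n]) (@coord_rV R n i @^-1` A i)).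
  apply: fin_bigcap_measurable => // i _.
  by rewrite -[X in measurable X]setTI; exact: measurable_coord_rV.
by apply/seteqP; split => x /= H i => [_|]; exact: H.
Qed.

(** The sides are half-open so that intervals of the form [a, a + h[ tile them exactly. *)
Definition box n (M : R) : set 'rV[R]_n :=
  [set x | forall i, `[- M, M[%classic (x 0 i)].

Lemma measurable_box n M : measurable (@box n M).
Proof.
by apply: (@measurable_rV_box n (fun=> `[- M, M[%classic)) => i; exact: measurable_itv.
Qed.

Lemma lebesgue_itv_lty (M N : R) : (leb `[M, N[%classic < +oo)%E.
Proof. by rewrite lebesgue_measure_itv/=; case: ifP => _; rewrite ?ltry. Qed.

Lemma lebesgue_box_lty n M : (lebesgue_rV n (@box n M) < +oo)%E.
Proof.
have -> : box M = [set x : 'rV[R]_n | forall i, `[- M, M[%classic (x 0 i)] by [].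
rewrite (@lebesgue_rV_box R n (fun=> `[- M, M[%classic))//.
suff /andP[] : (0 <= \prod_(i < n) leb `[(- M)%R, M[%classic < +oo)%E by [].
apply: (big_ind (fun x : \bar R => (0 <= x < +oo)%E)).
- by rewrite lee01 ltry.
- move=> x y /andP[x0 xoo] /andP[y0 yoo]; rewrite mule_ge0//=.
  by rewrite lte_mul_pinfty// ge0_fin_numE.
- by move=> i _; rewrite measure_ge0; exact: lebesgue_itv_lty.
Qed.

Lemma box_cons n M t (y : 'rV[R]_n) :
  box M (cons_rV (t, y)) <-> `[- M, M[%classic t /\ box M y.
Proof.
split=> [H|[Ht Hy] i].
  split; first by have := H ord0; rewrite mxE unlift_none.
  by move=> i; have := H (lift ord0 i); rewrite mxE liftK.
by rewrite mxE; case: (unliftP ord0 i) => [j _|_].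
Qed.

Section slices.
Variables (n : nat) (M : R) (f : 'rV[R]_n.+1 -> R).
Hypothesis bf : bsupp (box M) f.

Lemma bsupp_sliceR t : bsupp (box M) (fun y : 'rV[R]_n => f (cons_rV (t, y))).
Proof.
have [mf [B fB] f0] := bf; split; last 2 first.
- by exists B.
- by move=> y By; apply: f0; rewrite box_cons; tauto.
apply: (measurableT_comp mf); apply: (measurableT_comp (@measurable_cons_rV R n)).
exact: measurable_pair1.
Qed.

Lemma bsupp_sliceL y :
  bsupp `[- M, M[%classic (fun t : measurableTypeR R => f (cons_rV (t, y))).
Proof.
have [mf [B fB] f0] := bf; split; last 2 first.
- by exists B.
- by move=> t By; apply: f0; rewrite box_cons; tauto.
apply: (measurableT_comp mf); apply: (measurableT_comp (@measurable_cons_rV R n)).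
exact: measurable_pair2.
Qed.

(** The measure on R^(n+1) is the image of a product measure under [cons_rV]; pulling f back to the
    product makes Fubini available. *)
Let fc (p : measurableTypeR R * 'rV[R]_n) := (f (cons_rV p))%:E.

Let fc_integrable : (leb \x lebesgue_rV n)%E.-integrable setT fc.
Proof.
have := bsupp_integrable (@measurable_box n.+1 M) (@lebesgue_box_lty n.+1 M) bf.
move=> /integrableP[mf foo]; apply/integrableP; split.
  apply/measurable_EFinP; have [mf' _ _] := bf.
  exact: (measurableT_comp mf' (@measurable_cons_rV R n)).
move: foo => /=.
rewrite (@ge0_integral_pushforward _ _ _ _ _ _ (@measurable_cons_rV R n))//=.
by apply/measurable_EFinP; case: bf => mf0 _ _; exact: measurableT_comp.
Qed.

Let integral_fc : (\int[lebesgue_rV n.+1]_x (f x)%:E =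
   \int[leb \x lebesgue_rV n]_p fc p)%E.
Proof.
have mf : measurable_fun setT (EFin \o f) by apply/measurable_EFinP; case: bf.
rewrite [LHS]/= (@integral_pushforward _ _ _ _ _ (@cons_rV R n)
  (@measurable_cons_rV R n) (leb \x lebesgue_rV n)%E setT)//=.
Qed.

Lemma Rintegral_consL : \int[lebesgue_rV n.+1]_x f x =
  \int[leb]_t \int[lebesgue_rV n]_y f (cons_rV (t, y)).
Proof.
rewrite /Rintegral; congr fine; rewrite integral_fc.
rewrite -integral12_prod_meas1//; apply: eq_integral => t _ /=.
rewrite /fubini_F fineK//; apply: integrable_fin_num => //.
exact: (bsupp_integrable (@measurable_box n M) (@lebesgue_box_lty n M)
  (bsupp_sliceR t)).
Qed.

Lemma Rintegral_consR : \int[lebesgue_rV n.+1]_x f x =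
  \int[lebesgue_rV n]_y \int[leb]_t f (cons_rV (t, y)).
Proof.
rewrite /Rintegral; congr fine; rewrite integral_fc.
rewrite -integral21_prod_meas1//; apply: eq_integral => t _ /=.
rewrite /fubini_G fineK//; apply: integrable_fin_num => //.
exact: (@bsupp_integrable _ _ _ leb _ (measurable_itv `[- M, M[)
  (lebesgue_itv_lty _ _) _ (bsupp_sliceL t)).
Qed.

Lemma bsupp_RintegralL : bsupp `[- M, M[%classic
  (fun t : measurableTypeR R => \int[lebesgue_rV n]_y f (cons_rV (t, y))).
Proof.
have [_ [B fB] f0] := bf; split; last 2 first.
- exists (B * fine (lebesgue_rV n (@box n M))) => t.
  apply: bsupp_Rintegral_bound => //; first exact: measurable_box.
    exact: lebesgue_box_lty.
  exact: bsupp_sliceR.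
- move=> t nt; rewrite /Rintegral integral0_eq// => y _.
  by rewrite f0// => /box_cons[].
apply/measurable_EFinP; have := measurable_fubini_F fc_integrable.
congr (measurable_fun _ _); apply/funext => t /=; rewrite /fubini_F fineK//.
apply: integrable_fin_num => //.
exact: (bsupp_integrable (@measurable_box n M) (@lebesgue_box_lty n M)
  (bsupp_sliceR t)).
Qed.

Lemma bsupp_RintegralR : bsupp (box M)
  (fun y : 'rV[R]_n => \int[leb]_t f (cons_rV (t, y))).
Proof.
have [_ [B fB] f0] := bf; split; last 2 first.
- exists (B * fine (leb `[- M, M[%classic)) => y.
  apply: bsupp_Rintegral_bound => //.
    exact: lebesgue_itv_lty.
  exact: bsupp_sliceL.
- move=> t nt; rewrite /Rintegral integral0_eq// => y _.
  by rewrite f0// => /box_cons[].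
apply/measurable_EFinP; have := measurable_fubini_G fc_integrable.
congr (measurable_fun _ _); apply/funext => t /=; rewrite /fubini_G fineK//.
apply: integrable_fin_num => //.
exact: (@bsupp_integrable _ _ _ leb _ (measurable_itv `[- M, M[)
  (lebesgue_itv_lty _ _) _ (bsupp_sliceL t)).
Qed.

End slices.

End rV_boxes.


(** * A Poincare inequality on small intervals *)

Section partition.
Context {R : realType}.
Local Notation leb := (@lebesgue_measure R).
Local Notation co M := (`[- M, M[%classic : set (measurableTypeR R)).
Implicit Types G E : measurableTypeR R -> R.

Lemma indic_itv_split (a b c : R) x : a <= b -> b <= c ->
  \1_(`[a, c[%classic) x = \1_(`[a, b[%classic) x + \1_(`[b, c[%classic) x :> R.
Proof.
move=> ab bc; rewrite !indicE !mem_setE/= !in_itv/=.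
have [ax|xa] := leP a x; have [xb|bx] := ltP x b => /=.
- by rewrite (lt_le_trans xb)//= addr0.
- by rewrite add0r.
- by rewrite addr0.
- by have := lt_le_trans xa (le_trans ab bx); rewrite ltxx.
Qed.

Lemma indic_itv_sum (a h : R) N x : 0 <= h ->
  \1_(`[a, a + N%:R * h[%classic) x =
  \sum_(j < N) \1_(`[a + j%:R * h, a + j.+1%:R * h[%classic) x :> R.
Proof.
move=> h0; elim: N => [|N IH].
  rewrite big_ord0 mulr0n mul0r addr0 indicE mem_setE/= in_itv/=; by case: leP.
rewrite big_ord_recr /= -IH; apply: indic_itv_split.
  by rewrite lerDl mulr_ge0.
by rewrite lerD2l ler_wpM2r// ler_nat.
Qed.

Lemma indicX2 T (S : set T) x : \1_S x ^+ 2 = \1_S x :> R.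
Proof. by rewrite indicE; case: (_ \in _); rewrite ?expr1n ?expr0n. Qed.

Variables (M : R).

Let mM := measurable_itv `[- M, M[.
Let fM := lebesgue_itv_lty (- M) M.

(** On I, h G t - m is the integral over s of G t - G s, so Jensen and the bound on increments
    control its square. Integrating (h G - m)^2 over I and expanding leaves h^2 times the integral
    of G^2 minus h m^2. *)
Lemma oscillation_variance (c a h : R) G E : 0 <= c -> 0 < h ->
  - M <= a -> a + h <= M ->
  bsupp (co M) G -> bsupp (co M) E -> (forall x, 0 <= E x) ->
  (forall s t, s <= t -> (G t - G s) ^+ 2 <=
     c * (t - s) * \int[leb]_x (\1_(`[s, t]%classic) x * E x)) ->
  \int[leb]_x (\1_(`[a, a + h[%classic) x * G x ^+ 2) <=
  c * h ^+ 2 * \int[leb]_x (\1_(`[a, a + h[%classic) x * E x) +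
  h^-1 * (\int[leb]_x (\1_(`[a, a + h[%classic) x * G x)) ^+ 2.
Proof.
move=> c0 h0 Ma aM bG bE E0 GE.
set I := `[a, a + h[%classic.
have mI : measurable (I : set (measurableTypeR R)) by exact: measurable_itv.
have IM : I `<=` `[- M, M[%classic.
  move=> x; rewrite /I /= !in_itv/= => /andP[ax xa].
  by rewrite (le_trans Ma)//= (lt_le_trans xa).
have lI : fine (leb I) = h.
  by rewrite /I lebesgue_measure_itv/= lte_fin ltrDl h0 -EFinD/= addrAC subrr add0r.
have fI : (leb I < +oo)%E by exact: lebesgue_itv_lty.
have bIG := bsupp_indicM bG mI; have bIE := bsupp_indicM bE mI.
have b1 : bsupp (co M) (\1_I : measurableTypeR R -> R) by exact: bsupp_indic.
set D := \int[leb]_x (\1_I x * E x).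
set m := \int[leb]_x (\1_I x * G x).
have osc s t : I s -> I t -> (G t - G s) ^+ 2 <= c * h * D.
  wlog st : s t / s <= t => [H|].
    case: (leP s t) => [|/ltW] st Is It; first exact: H.
    by rewrite -sqrrN opprB; exact: H.
  move=> Is It; apply: le_trans (GE _ _ st) _.
  have ts : t - s <= h.
    by move: Is It; rewrite /I /= !in_itv/= => /andP[? ?] /andP[? ?]; lra.
  apply: ler_pM; [|by apply: Rintegral_ge0 => x _; rewrite mulr_ge0| |].
  - by rewrite mulr_ge0// subr_ge0.
  - by rewrite ler_wpM2l.
  - apply: (@bsupp_le_Rintegral _ _ _ leb _ mM fM) => //.
      by apply: bsupp_indicM => //; exact: measurable_itv.
    move=> x; rewrite ler_wpM2r// !indicE ler_nat.
    case: (boolP (x \in `[s, t]%classic)) => //; rewrite !inE => xst.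
    rewrite mem_set//; move: Is It xst; rewrite /I /= !in_itv/=.
    move=> /andP[? ?] /andP[? ?] /andP[? ?]; apply/andP; split; first by lra.
    by apply: le_lt_trans (_ : t < _); lra.
have D0 : 0 <= D by apply: Rintegral_ge0 => x _; rewrite mulr_ge0.
have osc2 t : I t -> (h * G t - m) ^+ 2 <= c * h ^+ 3 * D.
  move=> It; have bd : bsupp I (fun s => \1_I s * (G t - G s)).
    split; last 2 first.
    - have [_ [B GB] _] := bG; exists (1 * (B + B)) => s; rewrite normrM ler_pM//.
        by rewrite indicE; case: (_ \in _); rewrite ?normr1 ?normr0.
      by apply: le_trans (ler_normB _ _) _; rewrite lerD.
    - by move=> s Is; rewrite indicE memNset// mul0r.
    apply: measurable_funM; first exact: measurable_indic.
    by apply: measurable_funB => //; case: bG.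
  have bd' := bsuppX 1 bd; have bGt := bsuppZ (G t) b1.
  have -> : h * G t - m = \int[leb]_s (\1_I s * (G t - G s)).
    rewrite -lI -(Rintegral_indic leb mI) mulrC -(bsupp_RintegralZ (mu := leb) mM fM)//.
    rewrite -(bsupp_RintegralB (mu := leb) mM fM)//; apply: eq_Rintegral => s _; ring.
  apply: le_trans (bsupp_sqr_Rintegral (mu := leb) mI fI bd) _; rewrite lI.
  apply: (@le_trans _ _ (h * \int[leb]_x (c * h * D * \1_I x))).
    rewrite ler_pM2l//; apply: (bsupp_le_Rintegral (mu := leb) mI fI) => //.
      by apply: bsuppZ; exact: bsupp_indic.
    move=> s; rewrite exprMn indicX2 mulrC.
    have [Is|Is] := pselect (I s); last by rewrite indicE memNset// !mulr0.
    by rewrite indicE mem_set// !mulr1; exact: osc.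
  rewrite (bsupp_RintegralZ (mu := leb) mM fM)// Rintegral_indic// lI.
  by rewrite le_eqVlt; apply/orP; left; apply/eqP; ring.
have b2 : bsupp (co M) (fun x => \1_I x * G x ^+ 2).
  by apply: bsupp_indicM => //; exact: bsuppX.
have key : h ^+ 2 * \int[leb]_x (\1_I x * G x ^+ 2) - 2 * h * m * m +
    m ^+ 2 * h <= c * h ^+ 3 * D * h.
  have bb1 := bsuppZ (h ^+ 2) b2; have bb2 := bsuppZ (2 * h * m) bIG.
  have bb3 := bsuppZ (m ^+ 2) b1; have bb12 := bsuppB bb1 bb2.
  have bb := bsuppD bb12 bb3; have bb4 := bsuppZ (c * h ^+ 3 * D) b1.
  have <- : \int[leb]_x (h ^+ 2 * (\1_I x * G x ^+ 2) - 2 * h * m * (\1_I x * G x) +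
      m ^+ 2 * \1_I x) = h ^+ 2 * \int[leb]_x (\1_I x * G x ^+ 2) - 2 * h * m * m +
      m ^+ 2 * h.
    rewrite (bsupp_RintegralD (mu := leb) mM fM)//.
    rewrite (bsupp_RintegralB (mu := leb) mM fM)//.
    rewrite !(bsupp_RintegralZ (mu := leb) mM fM)//.
    by rewrite (Rintegral_indic leb mI) lI.
  have <- : \int[leb]_x (c * h ^+ 3 * D * \1_I x) = c * h ^+ 3 * D * h.
    by rewrite (bsupp_RintegralZ (mu := leb) mM fM)// (Rintegral_indic leb mI) lI.
  apply: (bsupp_le_Rintegral (mu := leb) mM fM) => // x.
  have [Is|Is] := pselect (I x); last by rewrite indicE memNset// !(mul0r, mulr0) subr0 addr0.
  by rewrite indicE mem_set// !mulr1 !mul1r; have := osc2 _ Is; lra.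
rewrite -(ler_pM2l (exprn_gt0 2 h0)) [leRHS]mulrDr.
have -> : h ^+ 2 * (h^-1 * m ^+ 2) = h * m ^+ 2 by field; rewrite gt_eqF.
by move: key; set X := \int[leb]_x _; lra.
Qed.

(** Sum the preceding inequality over N cells of length h = 2 M / N with c h^2 <= delta; the
    constant K is then 1 / h. *)
Lemma partition_inequality (c delta : R) : 0 < M -> 0 <= c -> 0 < delta ->
  exists (N : nat) (I_ : nat -> set (measurableTypeR R)) (K : R),
    [/\ 0 <= K, forall j, measurable (I_ j) &
     forall G E, bsupp (co M) G -> bsupp (co M) E -> (forall x, 0 <= E x) ->
       (forall s t, s <= t -> (G t - G s) ^+ 2 <=
         c * (t - s) * \int[leb]_x (\1_(`[s, t]%classic) x * E x)) ->
       \int[leb]_x (G x ^+ 2) <= delta * \int[leb]_x E x +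
         K * \sum_(j < N) (\int[leb]_x (\1_(I_ j) x * G x)) ^+ 2].
Proof.
move=> M0 c0 d0.
have [N N0 HN] : exists2 N, (0 < N)%N & c * (2 * M / N%:R) ^+ 2 <= delta.
  (* The requirement is N^2 >= k, and N >= 1 with N > k suffices as N^2 >= N. *)
  pose k := c * (2 * M) ^+ 2 / delta.
  exists (Num.truncn k).+1 => //; have := truncnS_gt k.
  set N := (_.+1)%:R => kN; have N1 : 1 <= N by rewrite ler1n.
  rewrite expr_div_n mulrA ler_pdivrMr ?exprn_gt0 ?(lt_le_trans _ N1)//.
  rewrite -ler_pdivrMl// mulrC; apply: le_trans (ltW kN) _.
  by rewrite expr2 ler_peMr// (le_trans _ N1).
set h := 2 * M / N%:R in HN; have h0 : 0 < h by rewrite divr_gt0 ?ltr0n// mulr_gt0.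
have Nh : - M + N%:R * h = M.
  by rewrite /h; field; rewrite pnatr_eq0 -lt0n.
pose I_ j : set (measurableTypeR R) := `[- M + j%:R * h, - M + j.+1%:R * h[%classic.
have mI j : measurable (I_ j) by exact: measurable_itv.
exists N, I_, h^-1; split => //; first by rewrite invr_ge0 ltW.
move=> G E bG bE E0 GE.
have split_sum F : bsupp (co M) F ->
    \int[leb]_x F x = \sum_(j < N) \int[leb]_x (\1_(I_ j) x * F x).
  move=> bF; have bIF j : bsupp (co M) (fun x => \1_(I_ j) x * F x).
    exact: bsupp_indicM.
  rewrite -(bsupp_Rintegral_sum (mu := leb) mM fM)//; apply: eq_Rintegral => x _.
  rewrite -mulr_suml; have [Mx|Mx] := pselect (co M x); last first.
    by case: bF => _ _ ->//; rewrite mulr0.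
  have := indic_itv_sum (- M) N x (ltW h0); rewrite Nh indicE mem_set// => <-.
  by rewrite mul1r.
have bG2 : bsupp (co M) (fun x => G x ^+ 2) by exact: bsuppX.
rewrite (split_sum _ bG2) (split_sum _ bE) !mulr_sumr -big_split/=.
apply: ler_sum => j _; have jN := ltn_ord j.
have I_E : I_ j = `[- M + j%:R * h, - M + j%:R * h + h[%classic.
  by rewrite /I_ -natr1 mulrDl mul1r addrA.
rewrite I_E; apply: le_trans (oscillation_variance c0 h0 _ _ bG bE E0 GE) _.
- by rewrite lerDl mulr_ge0// ltW.
- rewrite -{2}Nh -addrA lerD2l -{2}[h]mul1r -mulrDl natr1 ler_wpM2r ?ler_nat//.
  exact: ltW.
rewrite lerD2r ler_wpM2r//; apply: Rintegral_ge0 => x _.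
by rewrite mulr_ge0// indicE.
Qed.

End partition.


(** * Compactness and Friedrichs inequalities in a box *)

Section compactness.
Context {R : realType}.
Local Notation leb := (@lebesgue_measure R).

Definition upd n (x : 'rV[R]_n) (i : 'I_n) (t : R) : 'rV[R]_n :=
  \row_j (if j == i then t else x 0 j).

Lemma upd_cons0 n s t (y : 'rV[R]_n) :
  upd (cons_rV (s, y)) ord0 t = cons_rV (t, y).
Proof.
apply/rowP => j; rewrite !mxE; case: (unliftP ord0 j) => [k ->|->].
  by rewrite eq_sym (negbTE (neq_lift _ _)).
by rewrite eqxx.
Qed.

Lemma upd_consS n s t (y : 'rV[R]_n) j :
  upd (cons_rV (s, y)) (lift ord0 j) t = cons_rV (s, upd y j t).
Proof.
apply/rowP => k; rewrite !mxE; case: (unliftP ord0 k) => [l ->|->].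
  by rewrite (inj_eq lift_inj) mxE.
by rewrite (negbTE (neq_lift _ _)).
Qed.

(* The fundamental theorem of calculus along coordinate lines is all that the
   arguments below need to know about f and its partial derivatives g, and it
   is inherited by slices. *)
Definition C1supp n (M : R) (f : 'rV[R]_n -> R) (g : 'I_n -> 'rV[R]_n -> R) :=
  [/\ bsupp (box M) f, forall i, bsupp (box M) (g i) &
    forall x i s t, s <= t -> f (upd x i t) - f (upd x i s) =
      \int[leb]_r (\1_(`[s, t]%classic) r * g i (upd x i r))].

Section slice.
Variables (n : nat) (M : R) (f : 'rV[R]_n.+1 -> R) (g : 'I_n.+1 -> 'rV[R]_n.+1 -> R).
Hypothesis C1f : C1supp M f g.

Lemma C1supp_slice t : C1supp M (fun y => f (cons_rV (t, y)))
  (fun j y => g (lift ord0 j) (cons_rV (t, y))).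
Proof.
have [bf bg fg] := C1f; split; [exact: bsupp_sliceR| |].
  by move=> i; exact: bsupp_sliceR.
move=> x i s r sr; rewrite -!upd_consS fg//.
by apply: eq_Rintegral => z _; rewrite upd_consS.
Qed.

Lemma C1supp_increment s t y : s <= t ->
  f (cons_rV (t, y)) - f (cons_rV (s, y)) =
    \int[leb]_r (\1_(`[s, t]%classic) r * g ord0 (cons_rV (r, y))).
Proof.
have [_ _ fg] := C1f => /(fg (cons_rV (s, y)) ord0); rewrite !upd_cons0 => ->.
by apply: eq_Rintegral => z _; rewrite upd_cons0.
Qed.

(** Jensen on [s, t] for the integral of the derivative, an indicator being its own square. *)
Lemma C1supp_increment_sqr s t y : s <= t ->
  (f (cons_rV (t, y)) - f (cons_rV (s, y))) ^+ 2 <= (t - s) *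
    \int[leb]_r (\1_(`[s, t]%classic) r * g ord0 (cons_rV (r, y)) ^+ 2).
Proof.
move=> st; rewrite C1supp_increment//; have [_ bg _] := C1f.
set I := `[s, t]%classic.
have mI : measurable (I : set (measurableTypeR R)) by exact: measurable_itv.
have lI : leb I = (t - s)%:E.
  rewrite lebesgue_measure_itv/= lte_fin; case: ltP => // ts.
  by rewrite (le_anti (introT andP (conj st ts))) subrr.
have bs := bsupp_sliceL (bg ord0) y.
have b1 : bsupp I (fun r : measurableTypeR R => \1_I r * g ord0 (cons_rV (r, y))).
  have [m1 [B m2] _] := bsupp_indicM bs mI.
  by split => //; [exists B|move=> r rI; rewrite indicE memNset// mul0r].
have fI : (leb I < +oo)%E by rewrite lI ltry.
have -> : t - s = fine (leb I) by rewrite lI.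
under [X in _ <= _ * X]eq_Rintegral do rewrite -[\1__ _]indicX2 -exprMn.
exact: (bsupp_sqr_Rintegral (mu := leb) mI fI b1).
Qed.

Let bg2 : bsupp (box M) (fun x => g ord0 x ^+ 2).
Proof. by have [_ bg _] := C1f; exact: bsuppX. Qed.

Let mI (s t : R) : measurable
  [set x : 'rV[R]_n.+1 | (`[s, t]%classic : set (measurableTypeR R)) (x 0 ord0)].
Proof.
rewrite -[X in measurable X]setTI.
by apply: (@measurable_coord_rV R n.+1 ord0) => //; exact: measurable_itv.
Qed.

Section slab.
Variables s t : R.

Let S := [set x : 'rV[R]_n.+1 | `[s, t]%classic (x 0 ord0)].

Let S_E r y : \1_S (cons_rV (r, y)) = \1_(`[s, t]%classic) r :> R.
Proof.
rewrite !indicE; congr (nat_of_bool _)%:R.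
by apply/idP/idP; rewrite !inE /S /= mxE unlift_none.
Qed.

Let bS : bsupp (box M) (fun x => \1_S x * g ord0 x ^+ 2).
Proof. by apply: bsupp_indicM => //; exact: mI. Qed.

Lemma Rintegral_slab :
  \int[leb]_r (\1_(`[s, t]%classic) r *
     \int[lebesgue_rV n]_y (g ord0 (cons_rV (r, y)) ^+ 2)) =
  \int[lebesgue_rV n]_y \int[leb]_r (\1_(`[s, t]%classic) r *
     g ord0 (cons_rV (r, y)) ^+ 2).
Proof.
transitivity (\int[lebesgue_rV n.+1]_x (\1_S x * g ord0 x ^+ 2)).
  rewrite (Rintegral_consL bS); apply: eq_Rintegral => r _.
  rewrite -(bsupp_RintegralZ (@measurable_box R n M) (@lebesgue_box_lty R n M)).
    by apply: eq_Rintegral => y _; rewrite S_E.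
  exact: (bsupp_sliceR bg2 r).
rewrite (Rintegral_consR bS); apply: eq_Rintegral => y _.
by apply: eq_Rintegral => r _; rewrite S_E.
Qed.

Lemma bsupp_slab : bsupp (box M) (fun y => \int[leb]_r
  (\1_(`[s, t]%classic) r * g ord0 (cons_rV (r, y)) ^+ 2)).
Proof.
have := bsupp_RintegralR bS; congr bsupp; apply/funext => y.
by apply: eq_Rintegral => r _; rewrite S_E.
Qed.

End slab.

End slice.

Let mB n M := @measurable_box R n M.
Let fB n M := @lebesgue_box_lty R n M.

Definition cons_set n (I : set (measurableTypeR R)) (S : set 'rV[R]_n) :
  set 'rV[R]_n.+1 := @uncons_rV R n @^-1` (I `*` S).

Lemma measurable_cons_set n I S : measurable I -> measurable S ->
  measurable (@cons_set n I S).
Proof.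
move=> mI mS; rewrite -[X in measurable X]setTI.
by apply: measurable_uncons_rV => //; exact: measurableX.
Qed.

Lemma indic_cons_set n I S t (y : 'rV[R]_n) :
  \1_(cons_set I S) (cons_rV (t, y)) = \1_I t * \1_S y :> R.
Proof.
rewrite !indicE -natrM mulnb; congr (nat_of_bool _)%:R.
have memE : cons_set I S (cons_rV (t, y)) = (I `*` S) (t, y).
  by rewrite -[in RHS](cons_rVK (t, y)).
by apply/idP/andP; rewrite !inE memE.
Qed.

Lemma lebesgue_rV0_Rintegral (f : 'rV[R]_0 -> R) : measurable_fun setT f ->
  \int[lebesgue_rV 0]_x f x = f 0.
Proof.
move=> mf; rewrite /Rintegral [lebesgue_rV 0]/= integral_dirac//=.
  by rewrite indicT mul1r.
exact/measurable_EFinP.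
Qed.

(* Induction on the dimension: on each slice use the inequality in one
   dimension less, then apply the one-dimensional inequality to the
   functions t |-> int_S f (t, y) dy. *)
Lemma compactness_inequality n (M eps : R) : 0 < M -> 0 < eps ->
  exists (J : finType) (S : J -> set 'rV[R]_n) (K : R),
    [/\ 0 <= K, forall j, measurable (S j) & forall f g, C1supp M f g ->
      \int[lebesgue_rV n]_x (f x ^+ 2) <=
        eps * \sum_i \int[lebesgue_rV n]_x (g i x ^+ 2) +
        K * \sum_j (\int[lebesgue_rV n]_x (\1_(S j) x * f x)) ^+ 2].
Proof.
move=> M0; elim: n eps => [|n IH] eps eps0.
  (* R^0 is a point of mass 1, where a single average over the whole space determines f. *)
  exists unit, (fun=> setT), 1; split => // f g [[mf _ _] _ _].
  rewrite big_ord0 mulr0 add0r mul1r (bigD1 tt)//= big1 ?addr0; last by case.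
  under [in leRHS]eq_Rintegral do rewrite indicT mul1r.
  by rewrite !lebesgue_rV0_Rintegral//; exact: measurable_funX.
have [J [S [K [K0 mS HS]]]] := IH _ eps0.
pose c := fine (lebesgue_rV n (box M)).
have c0 : 0 <= c by exact: fine_ge0.
(* Each of the #|J| functions G j contributes d times the energy in the first direction, weighted by
   K, and K #|J| d <= eps. *)
have d0 : 0 < eps / (K * #|J|%:R + 1) by rewrite divr_gt0// ltr_wpDl// mulr_ge0.
have [N [I_ [K' [K'0 mI HI]]]] := partition_inequality M0 c0 d0.
exists (J * 'I_N)%type, (fun p : J * 'I_N => cons_set (I_ p.2) (S p.1)), (K * K'); split.
- exact: mulr_ge0.
- by move=> p; exact: measurable_cons_set.
move=> f g C1f; have [bf bg _] := C1f.
have bf2 : bsupp (box M) (fun x => f x ^+ 2) by exact: bsuppX.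
have bg2 i : bsupp (box M) (fun x => g i x ^+ 2) by exact: bsuppX.
pose G j t := \int[lebesgue_rV n]_y (\1_(S j) y * f (cons_rV (t, y))).
pose Sc j : set 'rV[R]_n.+1 := cons_set setT (S j).
have mSc j : measurable (Sc j) by exact: measurable_cons_set.
have Sc_E j t y : \1_(Sc j) (cons_rV (t, y)) = \1_(S j) y :> R.
  by rewrite indic_cons_set indicT mul1r.
have bScf j : bsupp (box M) (fun x => \1_(Sc j) x * f x) by exact: bsupp_indicM.
have G_E j : G j = (fun t => \int[lebesgue_rV n]_y
    (\1_(Sc j) (cons_rV (t, y)) * f (cons_rV (t, y)))).
  by apply/funext => t; apply: eq_Rintegral => y _; rewrite Sc_E.
have bG j : bsupp `[- M, M[%classic (G j : measurableTypeR R -> R).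
  by rewrite G_E; exact: bsupp_RintegralL (bScf j).
have bG2 j : bsupp `[- M, M[%classic (fun t : measurableTypeR R => G j t ^+ 2).
  exact: bsuppX.
have bE i := bsupp_RintegralL (bg2 i).
pose E (t : measurableTypeR R) :=
  \int[lebesgue_rV n]_y (g ord0 (cons_rV (t, y)) ^+ 2).
have E0 t : 0 <= E t by apply: Rintegral_ge0 => y _; exact: sqr_ge0.
(* Jensen over y in the box produces the factor c; the increment estimate on each line and Fubini on
   the slab give the rest. *)
have GE j s t : s <= t -> (G j t - G j s) ^+ 2 <=
    c * (t - s) * \int[leb]_r (\1_(`[s, t]%classic) r * E r).
  move=> st.
  have bs r : bsupp (box M) (fun y => \1_(S j) y * f (cons_rV (r, y))).
    by apply: bsupp_indicM => //; exact: bsupp_sliceR.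
  rewrite -(bsupp_RintegralB (@mB n M) (@fB n M))//.
  have bd := bsuppB (bs t) (bs s); have bd2 := bsuppX 1 bd.
  apply: le_trans (bsupp_sqr_Rintegral (@mB n M) (@fB n M) bd) _.
  rewrite -mulrA ler_wpM2l// (Rintegral_slab C1f).
  have bsl := bsupp_slab C1f s t.
  rewrite -(bsupp_RintegralZ (@mB n M) (@fB n M))//.
  apply: (bsupp_le_Rintegral (@mB n M) (@fB n M)) => //; first exact: bsuppZ.
  move=> y; rewrite -mulrBr exprMn indicX2; apply: le_trans (C1supp_increment_sqr C1f y st).
  by rewrite ler_piMl ?sqr_ge0// indicE; case: (_ \in _).
have mM := measurable_itv `[- M, M[; have fM := lebesgue_itv_lty (- M) M.
rewrite (Rintegral_consL bf2).
have bsl i : bsupp `[- M, M[%classic (fun t : measurableTypeR R =>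
   \int[lebesgue_rV n]_y (g (lift ord0 i) (cons_rV (t, y)) ^+ 2)) by exact: bE.
have bslsum : bsupp `[- M, M[%classic (fun t : measurableTypeR R =>
   \sum_i \int[lebesgue_rV n]_y (g (lift ord0 i) (cons_rV (t, y)) ^+ 2)).
  exact: bsupp_sum.
have bGsum : bsupp `[- M, M[%classic (fun t : measurableTypeR R =>
   \sum_j G j t ^+ 2) by exact: bsupp_sum.
have slice_le t := HS _ _ (C1supp_slice C1f t).
have bA := bsuppZ eps bslsum; have bB := bsuppZ K bGsum.
have bF2 := bsupp_RintegralL bf2; have bAB := bsuppD bA bB.
apply: le_trans (bsupp_le_Rintegral (mu := leb) mM fM bF2 bAB slice_le) _.
rewrite (bsupp_RintegralD (mu := leb) mM fM)// !(bsupp_RintegralZ (mu := leb) mM fM)//.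
rewrite !(bsupp_Rintegral_sum (mu := leb) mM fM)//.
have -> : \sum_(i < n) \int[leb]_t \int[lebesgue_rV n]_y
    (g (lift ord0 i) (cons_rV (t, y)) ^+ 2) =
    \sum_(i < n) \int[lebesgue_rV n.+1]_x (g (lift ord0 i) x ^+ 2).
  by apply: eq_bigr => i _; rewrite (Rintegral_consL (bg2 _)).
have E_E : \int[leb]_t E t = \int[lebesgue_rV n.+1]_x (g ord0 x ^+ 2).
  by rewrite (Rintegral_consL (bg2 _)).
set X := \int[lebesgue_rV n.+1]_x (g ord0 x ^+ 2) in E_E.
have X0 : 0 <= X by apply: Rintegral_ge0 => x _; exact: sqr_ge0.
set d := eps / _ in d0 HI.
have -> : \sum_(p : J * 'I_N) (\int[lebesgue_rV n.+1]_x
      (\1_(cons_set (I_ p.2) (S p.1)) x * f x)) ^+ 2 =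
    \sum_j \sum_(k < N) (\int[leb]_t (\1_(I_ k) t * G j t)) ^+ 2.
  rewrite pair_big/=; apply: eq_bigr => -[j k] _ /=; congr (_ ^+ 2).
  have bIS := bsupp_indicM bf (measurable_cons_set (mI k) (mS j)).
  rewrite (Rintegral_consL bIS); apply: eq_Rintegral => t _.
  rewrite -(bsupp_RintegralZ (@mB n M) (@fB n M)).
    by apply: eq_Rintegral => y _; rewrite indic_cons_set mulrA.
  by apply: bsupp_indicM => //; exact: bsupp_sliceR.
have sumG : \sum_j \int[leb]_t (G j t ^+ 2) <= \sum_(j : J) d * X +
    K' * \sum_j \sum_(k < N) (\int[leb]_t (\1_(I_ k) t * G j t)) ^+ 2.
  rewrite mulr_sumr -big_split/=; apply: ler_sum => j _; rewrite -E_E.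
  apply: (HI _ E); [exact: bG|exact: (bE ord0)|exact: E0|exact: GE].
move: sumG; rewrite sumr_const -mulr_natl big_ord_recl -/X.
set A := \sum_(i < n) _; set Y := \sum_j \sum_(k < N) _; set Z := \sum_j _ => sumG.
have KZ := ler_wpM2l K0 sumG.
have dX : K * (#|J|%:R * (d * X)) <= eps * X.
  rewrite !mulrA ler_wpM2r// ler_pdivrMr; last by rewrite ltr_wpDl// mulr_ge0.
  by rewrite mulrC ler_wpM2l ?lerDl// ltW.
by lra.
Qed.

(** On each line f starts from 0 to the left of the box, so f^2 is at most 2 M + 1 times the
    integral of the squared derivative; integration over the side contributes 2 M. *)
Lemma friedrichs n (M : R) (f : 'rV[R]_n.+1 -> R) g : 0 < M -> C1supp M f g ->
  \int[lebesgue_rV n.+1]_x (f x ^+ 2) <=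
    (2 * M + 1) * (2 * M) * \int[lebesgue_rV n.+1]_x (g ord0 x ^+ 2).
Proof.
move=> M0 C1f; have [bf bg _] := C1f.
have bf2 : bsupp (box M) (fun x => f x ^+ 2) by exact: bsuppX.
have bg2 : bsupp (box M) (fun x => g ord0 x ^+ 2) by exact: bsuppX.
have mM := measurable_itv `[- M, M[; have fM := lebesgue_itv_lty (- M) M.
have lM : fine (leb `[- M, M[%classic) = 2 * M.
  rewrite lebesgue_measure_itv/= lte_fin ifT; last by lra.
  by rewrite -EFinD/=; lra.
pose X y := \int[leb]_t (g ord0 (cons_rV (t, y)) ^+ 2).
have bX : bsupp (box M) X by exact: (bsupp_RintegralR bg2).
rewrite (Rintegral_consR bf2) (Rintegral_consR bg2) -(bsupp_RintegralZ (@mB n M) (@fB n M))//.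
apply: (bsupp_le_Rintegral (@mB n M) (@fB n M)).
- exact: (bsupp_RintegralR bf2).
- exact: bsuppZ.
move=> y; have b1 : bsupp `[- M, M[%classic
    (\1_(`[- M, M[%classic) : measurableTypeR R -> R) by exact: bsupp_indic.
rewrite -/(X y) -mulrA [2 * M * _]mulrC mulrA -lM -(Rintegral_indic leb mM).
rewrite -(bsupp_RintegralZ (mu := leb) mM fM)//.
apply: (bsupp_le_Rintegral (mu := leb) mM fM).
- exact: (bsupp_sliceL bf2).
- exact: bsuppZ.
move=> t; have [Mt|Mt] := pselect (`[- M, M[%classic t); last first.
  have [_ _ f0] := bf; rewrite f0 => [|/box_cons[]//].
  by rewrite expr0n indicE memNset// mulr0.
rewrite indicE mem_set// mulr1.
move: Mt; rewrite /= in_itv/= => /andP[tM Mt].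
(* The box contains its left face, so the starting point must lie strictly beyond -M. *)
have st : - M - 1 <= t by lra.
have := C1supp_increment_sqr C1f y st.
have [_ _ f0] := bf; rewrite [f (cons_rV (- M - 1, y))]f0; last first.
  by move=> /box_cons[+ _]; rewrite /= in_itv/=; lra.
rewrite subr0 => /le_trans; apply; apply: ler_pM.
- by lra.
- by apply: Rintegral_ge0 => r _; rewrite mulr_ge0// ?sqr_ge0// indicE.
- by rewrite (Rintegral_indic leb mM) lM; lra.
have bs := bsupp_sliceL bg2 y.
apply: (bsupp_le_Rintegral (mu := leb) mM fM) => //.
  by apply: bsupp_indicM => //; exact: measurable_itv.
move=> r; rewrite ler_piMl ?sqr_ge0// indicE; by case: (_ \in _).
Qed.

(** In the first direction each line integral is the increment of f between -M - 1 and M, both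
    outside the half-open box; other directions reduce to slices. Applied to a product, this is
    integration by parts. *)
Lemma Rintegral_partial0 n (M : R) (f : 'rV[R]_n -> R) g i : 0 < M -> C1supp M f g ->
  \int[lebesgue_rV n]_x g i x = 0.
Proof.
move=> M0; elim: n f g i => [|n IH] f g i C1f; first by case: i.
have [bf bg _] := C1f.
case: (unliftP ord0 i) => [j ->|->].
  rewrite (Rintegral_consL (bg _)) [LHS](_ : _ = \int[leb]_t 0).
    by rewrite /Rintegral integral0.
  by apply: eq_Rintegral => t _; exact: IH (C1supp_slice C1f t).
rewrite (Rintegral_consR (bg _)) [LHS](_ : _ = \int[lebesgue_rV n]_y 0).
  by rewrite /Rintegral integral0.
apply: eq_Rintegral => y _; have [_ _ f0] := bf; have [_ _ g0] := bg ord0.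
have st : - M - 1 <= M by lra.
have := C1supp_increment C1f y st.
rewrite !f0 ?subrr; [|by move=> /box_cons[+ _]; rewrite /= in_itv/=; lra..].
move=> ->; apply: eq_Rintegral => r _.
have [Mr|Mr] := pselect (`[- M, M[%classic r); last first.
  by rewrite g0 ?mulr0// => /box_cons[].
rewrite indicE mem_set ?mul1r//; move: Mr; rewrite /= !in_itv/= => /andP[? ?].
by apply/andP; split; lra.
Qed.

End compactness.

(** * Completeness of L^2 *)

Lemma exists_geometric_le {R : realType} (e : R) : 0 < e ->
  exists k, (1 / 2) ^+ k <= e.
Proof.
move=> e0; exists (Num.truncn e^-1); set k := Num.truncn _.
rewrite div1r exprVn -[e]invrK lef_pV2 ?posrE ?exprn_gt0 ?invr_gt0//.
apply: le_trans (ltW (truncnS_gt _)) _; rewrite -/k.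
by rewrite -natrX ler_nat ltn_expl.
Qed.

Section square_integrable.
Context d (T : measurableType d) {R : realType}.
Variables (mu : {measure set T -> \bar R}) (D : set T).
Hypothesis mD : measurable D.
Implicit Types u v w : T -> R.

(** [L2] for an arbitrary measure, with values in R^o so that the functions form an [lmodType]. *)
Definition sq_integrable : set (T -> R^o) := [set u |
  measurable_fun D (u : T -> R) /\ mu.-integrable D (fun x => (u x ^+ 2)%:E)].

Definition dotp (u v : T -> R^o) : R := \int[mu]_(x in D) (u x * v x).

Let L := sq_integrable.

Lemma sq_integrableM u v : L u -> L v -> mu.-integrable D (EFin \o (fun x => u x * v x)).
Proof.
move=> [mu_ iu] [mv iv].
have /= iuv := integrableD mD iu iv.
apply: le_integrable iuv => //.
  by apply/measurable_EFinP; exact: measurable_funM.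
move=> x Dx /=; rewrite lee_fin normrM [leRHS]ger0_norm ?addr_ge0 ?sqr_ge0//.
have := sqr_ge0 (`|u x| - `|v x|); rewrite -[u x ^+ 2]real_normK ?num_real//.
rewrite -[v x ^+ 2]real_normK ?num_real//.
have := normr_ge0 (u x); have := normr_ge0 (v x); nra.
Qed.

Lemma sq_integrable_subspace : subspace L.
Proof.
split.
  split; first exact: measurable_cst.
  by under eq_fun do rewrite /= expr0n/=; exact: integrable0.
move=> k u v Lu Lv; have [mu_ iu] := Lu; have [mv iv] := Lv; split.
  by apply: measurable_funD => //; exact: measurable_funM.
have i1 := integrableZl mD (k ^+ 2) iu.
have i2 := integrableZl mD (2 * k) (sq_integrableM Lu Lv).
have := integrableD mD (integrableD mD i1 i2) iv.
apply: eq_integrable => // x _ /=; rewrite -!EFinM -!EFinD; congr EFin.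
by have -> : (k *: u + v) x = k * u x + v x by []; ring.
Qed.

Lemma dotp_psd : psd_form L dotp.
Proof.
split=> [u v Lu Lv|w Lw k u v Lu Lv|v Lv].
- by apply: eq_Rintegral => x _; rewrite mulrC.
- have iu := sq_integrableM Lw Lu; have iv := sq_integrableM Lw Lv.
  rewrite /dotp -RintegralZl// -RintegralD//; last exact: (integrableZl mD k iu).
  apply: eq_Rintegral => x _; have -> : (k *: u + v) x = k * u x + v x by [].
  by ring.
- by apply: Rintegral_ge0 => x _; rewrite -expr2 sqr_ge0.
Qed.

Lemma dotp_ae u u' v : L u -> L u' -> L v -> u = u' %[ae mu in D] ->
  dotp u v = dotp u' v.
Proof.
move=> Lu Lu' Lv uu'; rewrite /dotp /Rintegral; congr fine.
apply: ae_eq_integral => //.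
- by case/integrableP: (sq_integrableM Lu Lv).
- by case/integrableP: (sq_integrableM Lu' Lv).
- by apply: filterS uu' => x uu' Dx; rewrite /= uu'.
Qed.

Lemma dotp_eq0 u : L u -> dotp u u = 0 -> u = (cst 0) %[ae mu in D].
Proof.
move=> Lu; have iu := sq_integrableM Lu Lu; rewrite /dotp /Rintegral => u0.
have {}u0 : (\int[mu]_(x in D) (u x * u x)%:E = 0)%E.
  by rewrite -[LHS]fineK ?u0//; exact: integrable_fin_num.
have [mf _] := integrableP _ _ _ iu.
have [+ _] := ae_eq_integral_abs mu mD mf.
have {}u0 : (\int[mu]_(x in D) `|(u x * u x)%:E| = 0)%E.
  by rewrite -[RHS]u0; apply: eq_integral => x _; rewrite gee0_abs// lee_fin -expr2 sqr_ge0.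
move=> /(_ u0); apply: filterS => x /= + Dx => /(_ Dx) [] /eqP.
by rewrite mulf_eq0 orbb => /eqP.
Qed.

Lemma ae_eq0_dotp u : u = (cst 0) %[ae mu in D] -> L u -> dotp u u = 0.
Proof.
move=> u0 Lu; have L0 : L (cst 0) by exact: (sq_integrable_subspace).1.
rewrite (dotp_ae Lu L0 Lu u0) /dotp /Rintegral integral0_eq// => x _.
by rewrite mul0r.
Qed.

Lemma dotp_EFin u : L u -> (\int[mu]_(x in D) (u x ^+ 2)%:E = (dotp u u)%:E)%E.
Proof.
move=> Lu; rewrite /dotp /Rintegral fineK.
  by apply: eq_integral => x _; rewrite expr2.
by apply: integrable_fin_num => //; exact: (sq_integrableM Lu Lu).
Qed.

Section complete.
Variable v : nat -> T -> R^o.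
Hypothesis Lv : forall k, L (v k).
Hypothesis v_close : forall k,
  dotp (v k.+1 - v k) (v k.+1 - v k) <= (1 / 8) ^+ k.

(* The series S is integrable, and 4^k (v j - v k)^2 <= 4 S for all j >= k. *)
Let F k x : \bar R := (4 ^+ k * (v k.+1 x - v k x) ^+ 2)%:E.
Let S x : \bar R := (\sum_(0 <= k <oo) F k x)%E.

Let Ld k : L (v k.+1 - v k).
Proof. exact: (subspaceB sq_integrable_subspace (Lv _) (Lv _)). Qed.

Let F0 k x : (0 <= F k x)%E.
Proof. by rewrite lee_fin mulr_ge0 ?sqr_ge0// exprn_ge0. Qed.

Let mF k : measurable_fun D (F k).
Proof.
apply/measurable_EFinP; apply: measurable_funM => //.
by apply: measurable_funX; have [] := Ld k.
Qed.

Let mS : measurable_fun D S.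
Proof. by apply: ge0_emeasurable_sum => // k x _ _; exact: F0. Qed.

(** The weights 4^k against the rate (1/8)^k leave a geometric series of ratio 1 / 2, whose sum is
    2. *)
Let intS : (\int[mu]_(x in D) S x <= 2%:E)%E.
Proof.
rewrite integral_nneseries//; apply: lime_le.
  by apply: is_cvg_nneseries => k _ _; exact: integral_ge0.
apply: nearW => n; rewrite (_ : (\sum_(0 <= k < n) _)%E =
    (\sum_(0 <= k < n) 4 ^+ k * dotp (v k.+1 - v k) (v k.+1 - v k))%:E); last first.
  rewrite -sumEFin; apply: eq_bigr => k _; rewrite /F.
  under eq_integral do rewrite EFinM.
  rewrite ge0_integralZl_EFin ?exprn_ge0//.
  - by rewrite EFinM -(dotp_EFin (Ld k)).
  - by move=> x _; rewrite lee_fin sqr_ge0.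
  - by apply/measurable_EFinP/measurable_funX; have [] := Ld k.
rewrite lee_fin; apply: (@le_trans _ _ (2 - 2 * (1 / 2) ^+ n)); last first.
  by rewrite gerBl mulr_ge0// exprn_ge0.
elim: n => [|n IH]; first by rewrite big_nil expr0; lra.
rewrite big_nat_recr//=.
have : 4 ^+ n * dotp (v n.+1 - v n) (v n.+1 - v n) <= (1 / 2) ^+ n.
  rewrite (_ : (1 / 2) ^+ n = 4 ^+ n * (1 / 8) ^+ n).
    by rewrite ler_pM2l ?exprn_gt0//; exact: v_close.
  by rewrite -exprMn; congr (_ ^+ _); field.
by move: IH; rewrite [(1 / 2) ^+ n.+1]exprS; set X := \sum_(0 <= k < n) _; lra.
Qed.

Let step x k : (S x < +oo)%E ->
  `|v k.+1 x - v k x| <= (1 / 2) ^+ k * Num.sqrt (fine (S x)).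
Proof.
move=> Sx; have S0 : (0 <= S x)%E by exact: nneseries_ge0.
have : (F k x <= S x)%E.
  apply: le_trans (nneseries_lim_ge k.+1 _); last by [].
  by rewrite big_nat_recr//= leeDr// sume_ge0.
rewrite -[S x in X in X -> _]fineK ?ge0_fin_numE// lee_fin => FS.
rewrite -[leLHS]sqrtr_sqr -[(1 / 2) ^+ k]ger0_norm ?exprn_ge0// -sqrtr_sqr.
rewrite -sqrtrM ?sqr_ge0// ler_sqrt ?mulr_ge0 ?sqr_ge0 ?fine_ge0//.
rewrite -(ler_pM2l (exprn_gt0 k (ltr0n R 4))).
apply: le_trans FS _; rewrite mulrA -exprM muln2 -addnn exprD.
rewrite mulrA -!exprMn.
rewrite (_ : 4 * (1 / 2) * (1 / 2) = 1 :> R) ?expr1n ?mul1r//; by field.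
Qed.

Let tail x k p : (S x < +oo)%E ->
  `|v (k + p)%N x - v k x| <= 2 * (1 / 2) ^+ k * Num.sqrt (fine (S x)).
Proof.
move=> Sx; set r := Num.sqrt _; have r0 : 0 <= r by exact: sqrtr_ge0.
apply: (@le_trans _ _ ((2 - 2 * (1 / 2) ^+ p) * (1 / 2) ^+ k * r)); last first.
  rewrite ler_wpM2r// ler_wpM2r ?exprn_ge0// gerBl mulr_ge0// exprn_ge0//.
elim: p => [|p IH]; first by rewrite addn0 subrr normr0 expr0 mulr1 subrr !mul0r.
have := step (k + p) Sx; rewrite -/r addnS => H.
rewrite (_ : v (k + p).+1 x - v k x =
  (v (k + p).+1 x - v (k + p)%N x) + (v (k + p)%N x - v k x)); last by ring.
apply: le_trans (ler_normD _ _) _; apply: le_trans (lerD H IH) _.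
rewrite exprD exprS le_eqVlt; apply/orP; left; apply/eqP; by field.
Qed.

Let A := D `&` [set x | (S x < +oo)%E].

Let mA : measurable A.
Proof. exact: emeasurable_fun_infty_o. Qed.

(** The cutoff makes the sequence converge at every point, to 0 where S is infinite, so that the
    limit is measurable as a pointwise limit. *)
Let w k x : R := v k x * \1_A x.

Let w_cvg x : cvgn (w ^~ x).
Proof.
have [Ax|nAx] := pselect (A x); last first.
  rewrite (_ : w ^~ x = cst 0); first exact: is_cvg_cst.
  by apply/funext => k; rewrite /w indicE memNset// mulr0.
rewrite (_ : w ^~ x = v ^~ x); last first.
  by apply/funext => k; rewrite /w indicE mem_set// mulr1.
have [_ Sx] := Ax; set r := Num.sqrt (fine (S x)).
apply/cauchy_cvgP/cauchy_exP => e e0.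
have r0 : 0 <= r by exact: sqrtr_ge0.
have [k Hk] : exists k, 2 * (1 / 2) ^+ k * r < e.
  have d0 : 0 < e / (2 * (r + 1)) by rewrite divr_gt0// mulr_gt0// ltr_wpDl.
  have [k] := exists_geometric_le d0; rewrite ler_pdivlMr; last by rewrite mulr_gt0// ltr_wpDl.
  move=> Hk; exists k; apply: lt_le_trans Hk.
  by have := exprn_gt0 k (_ : 0 < 1 / 2 :> R); set h := _ ^+ k => /(_ _); lra.
exists (v k x); exists k => // n /= kn; rewrite /ball/= -normrN opprB.
by rewrite -(subnKC kn); apply: le_lt_trans (tail _ _ Sx) Hk.
Qed.

Let W x : R := limn (w ^~ x).

Let mW : measurable_fun D W.
Proof.
apply: (@measurable_fun_cvg _ _ _ _ w) => [k|x _]; last exact: w_cvg.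
apply: measurable_funM; last exact: measurable_indic.
by have [] := Lv k.
Qed.

Let W_close k x : D x -> (((v k x - W x) ^+ 2)%:E <= (4 * (1 / 4) ^+ k)%:E * S x)%E.
Proof.
move=> Dx; have S0 : (0 <= S x)%E by exact: nneseries_ge0.
have [Sx|] := ltP (S x) +oo%E; last first.
  by rewrite leye_eq => /eqP ->; rewrite gt0_muley ?leey// lte_fin mulr_gt0// exprn_gt0.
have Ax : A x by [].
rewrite -[S x in leRHS]fineK ?ge0_fin_numE// -EFinM lee_fin.
set r := Num.sqrt (fine (S x)).
have H : `|v k x - W x| <= 2 * (1 / 2) ^+ k * r.
  have c : v k x - w n x @[n --> \oo] --> v k x - W x.
    by apply: cvgB; [exact: cvg_cst|exact: w_cvg].
  rewrite -(cvg_lim _ (cvg_norm c))//; apply: limr_le.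
    by apply/cvg_ex; eexists; exact: cvg_norm c.
  near=> n; rewrite /w indicE mem_set// mulr1 -normrN opprB.
  have kn : (k <= n)%N by near: n; exact: nbhs_infty_ge.
  by rewrite -(subnKC kn); exact: tail.
have : `|v k x - W x| ^+ 2 <= (2 * (1 / 2) ^+ k * r) ^+ 2.
  by rewrite ler_sqr ?nnegrE// !mulr_ge0 ?exprn_ge0 ?sqrtr_ge0.
rewrite real_normK ?num_real// => /le_trans; apply.
rewrite (_ : _ ^+ 2 = 4 * ((1 / 2) ^+ k) ^+ 2 * r ^+ 2); last by ring.
rewrite sqr_sqrtr ?fine_ge0// -exprM mulnC exprM.
by rewrite (_ : (1 / 2) ^+ 2 = 1 / 4 :> R)//; field.
Unshelve. all: by end_near. Qed.

Let intW k : (\int[mu]_(x in D) ((v k x - W x) ^+ 2)%:E <= (8 * (1 / 4) ^+ k)%:E)%E.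
Proof.
have c0 : 0 <= 4 * (1 / 4) ^+ k :> R by rewrite mulr_ge0// exprn_ge0.
apply: (@le_trans _ _ (\int[mu]_(x in D) ((4 * (1 / 4) ^+ k)%:E * S x))%E).
  apply: ge0_le_integral => //.
  - by move=> x _; rewrite lee_fin sqr_ge0.
  - by apply/measurable_EFinP/measurable_funX/measurable_funB => //; have [] := Lv k.
  - exact: measurable_funeM.
  - by move=> x; exact: W_close.
rewrite ge0_integralZl_EFin//; last by move=> x _; exact: nneseries_ge0.
rewrite (_ : 8 * (1 / 4) ^+ k = 4 * (1 / 4) ^+ k * 2 :> R); last by ring.
by rewrite [leRHS]EFinM; apply: lee_wpmul2l => //; rewrite lee_fin.
Qed.

Let LW : L W.
Proof.
have Lvk : L (fun x => v 0%N x - W x).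
  have md : measurable_fun D (fun x => v 0%N x - W x).
    by apply: measurable_funB => //; have [] := Lv 0.
  split => //; apply/integrableP; split; first by apply/measurable_EFinP/measurable_funX.
  rewrite (eq_integral (fun x => ((v 0%N x - W x) ^+ 2)%:E)).
    by apply: le_lt_trans (intW 0) _; rewrite ltry.
  by move=> x _; rewrite gee0_abs// lee_fin sqr_ge0.
have := subspaceB sq_integrable_subspace (Lv 0) Lvk.
by congr L; apply/funext => x; rewrite -[RHS](subKr (v 0%N x)).
Qed.

Lemma sq_integrable_fast_limit : exists2 W', L W' &
  forall k, dotp (v k - W') (v k - W') <= 8 * (1 / 4) ^+ k.
Proof.
exists W => // k; have Lk := subspaceB sq_integrable_subspace (Lv k) LW.
by rewrite -lee_fin -(dotp_EFin Lk); exact: intW.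
Qed.

End complete.

Lemma sq_integrable_complete : complete_for L dotp.
Proof.
move=> u_ Lu cauchy.
have /choice[N HN] : forall k : nat, exists N, forall m n, (N <= m)%N -> (N <= n)%N ->
    dotp (u_ m - u_ n) (u_ m - u_ n) <= (1 / 8) ^+ k.
  by move=> k; apply: cauchy; rewrite exprn_gt0.
(* A running maximum, so that [phi k] and [phi k.+1] both lie beyond [N k]. *)
pose phi k := \max_(j < k.+1) N j.
have Nphi j k : (j <= k)%N -> (N j <= phi k)%N.
  by move=> jk; exact: (@leq_bigmax _ (fun i : 'I_k.+1 => N i) (Ordinal (jk : (j < k.+1)%N))).
have Lv k : L (u_ (phi k)) by [].
have [k|W LW HW] := sq_integrable_fast_limit Lv.
  by apply: HN; exact: Nphi.
exists W => // e e0.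
(* The two errors add up to at most 2 (1/8)^K + 16 (1/4)^K <= 18 (1/2)^K. *)
have [K HK] := exists_geometric_le (divr_gt0 e0 (ltr0n R 32)).
exists (N K) => n Nn; have sL := sq_integrable_subspace.
rewrite -[u_ n](subrK (u_ (phi K))) -addrA.
have L1 := subspaceB sL (Lu n) (Lv K); have L2 := subspaceB sL (Lv K) LW.
apply: le_trans (psdD_le sL dotp_psd L1 L2) _.
have := HW K; have := HN K n (phi K) Nn (Nphi _ _ (leqnn _)).
have : (1 / 8) ^+ K <= (1 / 2) ^+ K :> R by apply: lerXn2r; rewrite ?nnegrE//; lra.
have : (1 / 4) ^+ K <= (1 / 2) ^+ K :> R by apply: lerXn2r; rewrite ?nnegrE//; lra.
by move: HK; set X := dotp _ _; set Y := dotp _ _; lra.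
Qed.

End square_integrable.

(** * Test functions *)

Section borel_rV.
Context {R : realType} {n : nat}.
Local Notation E := 'rV[R]_n.
Implicit Types (a b : 'I_n -> R) (U : set E) (x : E).

Definition obox a b : set E := [set x | forall i, `]a i, b i[%classic (x 0 i)].
Definition cbox a b : set E := [set x | forall i, `[a i, b i]%classic (x 0 i)].

Lemma measurable_obox a b : measurable (obox a b).
Proof.
apply: (@measurable_rV_box R n (fun i => `]a i, b i[%classic)) => i.
exact: measurable_itv.
Qed.

Lemma obox_sub_cbox a b : obox a b `<=` cbox a b.
Proof. by move=> x xab i; apply: subset_itv_oo_cc; exact: xab. Qed.

(** Boxes with rational endpoints form a countable family. Those whose closed box stays in U are
    kept, since these carry bump functions that are test functions of U. *)
Lemma open_obox_cover U : open U -> exists (P : set nat) (a b : nat -> 'I_n -> R),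
  (forall k, P k -> cbox (a k) (b k) `<=` U) /\
  U = \bigcup_(k in P) obox (a k) (b k).
Proof.
move=> oU; pose C := ({ffun 'I_n -> rat} * {ffun 'I_n -> rat})%type.
pose a_ (p : C) i : R := ratr (p.1 i); pose b_ (p : C) i : R := ratr (p.2 i).
(* A number that codes no pair gives a default box, which the inclusion in U filters like any
   other. *)
pose dec k : C := odflt ([ffun=> 0], [ffun=> 0]) (unpickle k).
exists [set k | cbox (a_ (dec k)) (b_ (dec k)) `<=` U], (a_ \o dec), (b_ \o dec).
split => //; apply/seteqP; split; last first.
  by move=> x [k kU] /obox_sub_cbox; exact: kU.
move=> x Ux; have /nbhs_ballP[e /= e0 eU] : nbhs x U by exact: open_nbhs_nbhs.
have /choice[f Hf] : forall i, exists q, ratr q \in `]x 0 i - e, x 0 i[.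
  by move=> i; apply: rat_in_itvoo; rewrite ltrBlDr ltrDl.
have /choice[g Hg] : forall i, exists q, ratr q \in `]x 0 i, x 0 i + e[.
  by move=> i; apply: rat_in_itvoo; rewrite ltrDl.
pose p : C := ([ffun i => f i], [ffun i => g i]).
have decp : dec (pickle p) = p by rewrite /dec pickleK.
exists (pickle p); rewrite /= decp.
- move=> y yp; apply: eU; split => // i j; rewrite ord1 /ball/=.
  have := yp j; rewrite /a_ /b_ /= !ffunE !in_itv/=.
  have := Hf j; have := Hg j; rewrite !in_itv/= ltr_norml.
  move=> /andP[? ?] /andP[? ?] /andP[? ?]; apply/andP; split; lra.
- move=> i; rewrite /a_ /b_ /= !ffunE !in_itv/=.
  by have := Hf i; have := Hg i; rewrite !in_itv/= => /andP[-> _] /andP[_ ->].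
Qed.

Lemma open_measurable_rV U : open U -> measurable U.
Proof.
move=> /open_obox_cover[P [a [b [_ ->]]]]; apply: bigcup_measurable => k _.
exact: measurable_obox.
Qed.

Lemma continuous_measurable_rV (f : E -> R) : continuous f ->
  measurable_fun [set: E] f.
Proof.
move=> /continuousP cf; apply: (measurability _ (RGenOpens.measurableE R)).
move=> _ [_ [a [b ->] <-]]; rewrite setTI; apply: open_measurable_rV.
by apply: cf; exact: interval_open.
Qed.

Lemma bounded_set_box U : bounded_set U -> exists2 M, 0 < M & U `<=` box M.
Proof.
move=> [M [_ bM]]; pose N := `|M| + 1.
have MN : M < N by rewrite /N (le_lt_trans (ler_norm _))// ltrDl.
exists (N + 1); first by rewrite addr_gt0// /N ltr_wpDl.
move=> x Ux i; have xN := bM _ MN _ Ux.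
have : `|x 0 i| <= N.
  apply: le_trans xN; rewrite [leRHS]/Num.norm /= mx_normrE.
  by apply/bigmax_geP; right => /=; exists (0, i).
by rewrite /= in_itv/= ler_norml => /andP[? ?]; apply/andP; split; lra.
Qed.

Lemma upd_continuous x i : continuous (upd x i).
Proof.
move=> t; apply/cvg_ballP => e e0; near=> s; split => // k j.
rewrite !mxE; case: ifP => _; last exact: ballxx.
by near: s; exact: (nbhsx_ballx t e).
Unshelve. all: by end_near. Qed.

Lemma upd_shift x i t h : upd x i (h + t) = h *: delta_mx 0 i + upd x i t.
Proof.
apply/rowP => j; rewrite !mxE/=; case: ifP => _; first by rewrite mulr1.
by rewrite mulr0 add0r.
Qed.

Lemma derivable_upd (f : E -> R^o) x i t :
  derivable f (upd x i t) (delta_mx 0 i) ->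
  is_derive t 1 (fun s : R => f (upd x i s) : R) ('D_(delta_mx 0 i) f (upd x i t)).
Proof.
move=> df; have E_ : (fun h : R => h^-1 *: (((fun s : R => f (upd x i s) : R) \o shift t)
    (h *: 1) - f (upd x i t))) = (fun h : R => h^-1 *: ((f \o shift (upd x i t))
    (h *: (delta_mx 0 i : E)) - f (upd x i t))).
  by apply/funext => h /=; rewrite -upd_shift [_ *: 1]mulr1.
by split; [rewrite /derivable E_|rewrite /derive E_].
Qed.

End borel_rV.

Lemma Rintegral_FTC {R : realType} (p q : R -> R) (s t : R) : continuous q ->
  (forall r : R, is_derive r 1 p (q r)) -> s <= t ->
  p t - p s = \int[@lebesgue_measure R]_r (\1_(`[s, t]%classic) r * q r).
Proof.
move=> cq dp; rewrite le_eqVlt => /predU1P[->|st].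
  rewrite subrr; transitivity (\int[@lebesgue_measure R]_(r in [set t]) q r).
    by rewrite Rintegral_set1.
  rewrite Rintegral_mkcond; apply: eq_Rintegral => r _.
  rewrite set_itv1 patchE indicE; case: ifPn; rewrite ?mul1r ?mul0r//.
have cp : continuous p.
  by move=> r; apply: differentiable_continuous; apply/derivable1_diffP.
transitivity (\int[@lebesgue_measure R]_(r in `[s, t]) q r).
  rewrite /Rintegral (@continuous_FTC2 _ _ p)//.
  - exact: continuous_subspaceT.
  - split; [by move=> r _|exact/cvg_at_right_filter/cp|exact/cvg_at_left_filter/cp].
  - by move=> r _; rewrite derive1E; apply: derive_val.
rewrite Rintegral_mkcond; apply: eq_Rintegral => r _.
by rewrite patchE indicE; case: ifPn; rewrite ?mul1r ?mul0r.
Qed.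

Section test_functions.
Context {R : realType} {n : nat}.
Local Notation E := 'rV[R]_n.
Implicit Types (Omega : set E) (phi : E -> R).

Lemma test_function_notin Omega phi x : test_function Omega phi ->
  ~ Omega x -> phi x = 0.
Proof.
move=> [_ _ sO] nO; apply/eqP; apply: contraT => px; exfalso; apply/nO/sO.
exact: subset_closure.
Qed.

Lemma near_test_function0 Omega phi x : test_function Omega phi ->
  ~ Omega x -> \near x, phi x = 0.
Proof.
move=> [_ _ sO] nO; pose K := closure [set x | phi x != 0].
have : nbhs x (~` K).
  by apply: open_nbhs_nbhs; split; [exact/closed_openC/closed_closure|move=> /sO].
apply: filterS => y nK; apply/eqP; apply: contraT => py; exfalso; apply: nK.
exact: subset_closure.
Qed.

Lemma partial_notin Omega phi i x : test_function Omega phi ->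
  ~ Omega x -> partial i phi x = 0.
Proof.
move=> tphi nO; rewrite /partial.
rewrite (@near_eq_derive _ _ _ _ (cst 0 : E -> R^o)); first by rewrite derive_cst.
exact: near_test_function0 tphi nO.
Qed.

Lemma continuous_bounded Omega phi (f : E -> R) : test_function Omega phi ->
  continuous f -> (forall x, ~ closure [set x | phi x != 0] x -> f x = 0) ->
  exists B, forall x, `|f x| <= B.
Proof.
move=> [_ cK _] cf f0.
have /compact_bounded : compact (f @` closure [set x | phi x != 0]).
  by apply: continuous_compact => //; exact: continuous_subspaceT.
move=> [M [_ bM]]; exists (`|M| + 1) => x.
have [Kx|Kx] := pselect (closure [set x | phi x != 0] x); last first.
  by rewrite f0// normr0 addr_ge0.
by apply: bM; [rewrite (le_lt_trans (ler_norm _))// ltrDl|exists x].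
Qed.

Lemma test_function_C1supp Omega M phi : test_function Omega phi ->
  Omega `<=` box M -> C1supp M phi (partial ^~ phi).
Proof.
move=> tphi OM; have [sphi cK sO] := tphi.
have cphi : continuous phi by have [] := sphi [::].
have cpart i : continuous (partial i phi) by have [] := sphi [:: i].
have phi0 x : ~ closure [set x | phi x != 0] x -> phi x = 0.
  move=> nK; apply/eqP; apply: contraT => px; exfalso; apply: nK.
  exact: subset_closure.
(* phi is also a test function for its own support, so its partial derivatives vanish off a compact
   set and are bounded. *)
have tK : test_function (closure [set x | phi x != 0]) phi by split.
split.
- split; first exact: continuous_measurable_rV.
    exact: continuous_bounded tphi cphi phi0.
  by move=> x nM; apply: (test_function_notin tphi) => /OM.
- move=> i; split; first exact: continuous_measurable_rV.
    by apply: (continuous_bounded tphi) => // x; exact: partial_notin tK.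
  by move=> x nM; apply: (partial_notin i tphi) => /OM.
- move=> x i s t st; apply: (Rintegral_FTC (p := fun r => phi (upd x i r))) => //.
    move=> r; apply: continuous_comp; first exact: upd_continuous.
    exact: cpart.
  by move=> r; apply: derivable_upd; exact: (sphi [::]).2.
Qed.

End test_functions.


(** * Smooth functions of one variable *)

Section smooth_functions.
Context {R : realType}.
Implicit Types (f : R -> R) (x : R).

(* Flat at 0; up to linear combinations the family is closed under
   differentiation. *)
Definition theta k x : R := if 0 < x then x^-1 ^+ k * expR (- x^-1) else 0.

Lemma theta_gt0 k x : 0 < x -> theta k x = x^-1 ^+ k * expR (- x^-1).
Proof. by rewrite /theta => ->. Qed.

Lemma theta_le0 k x : x <= 0 -> theta k x = 0.
Proof. by rewrite /theta ltNge => ->. Qed.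

Lemma theta_ge0 k x : 0 <= theta k x.
Proof.
rewrite /theta; case: ifP => // x0.
by rewrite mulr_ge0 ?expR_ge0// exprn_ge0// invr_ge0 ltW.
Qed.

(** The exponential of 1 / x dominates the term of degree k + 2 of its series. The factor x^2 is
    what makes the derivative at 0 vanish. *)
Lemma theta_le k x : theta k x <= (k.+2)`!%:R * x ^+ 2.
Proof.
have [x0|x0] := leP x 0; first by rewrite theta_le0// mulr_ge0// sqr_ge0.
rewrite theta_gt0// expRN ler_pdivrMr ?expR_gt0//.
have y0 : 0 <= x^-1 by rewrite invr_ge0 ltW.
have := expR_ge1Dxn k.+1 y0; set e := expR _ => He.
have {}He : x^-1 ^+ k.+2 <= k.+2`!%:R * e.
  rewrite mulrC -ler_pdivrMr ?ltr0n ?fact_gt0//; apply: le_trans He.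
  by rewrite lerDr.
have -> : x^-1 ^+ k = x ^+ 2 * x^-1 ^+ k.+2.
  by rewrite -[k.+2]addn2 exprD mulrCA -exprMn divff ?gt_eqF// expr1n mulr1.
by rewrite [leRHS]mulrAC [leRHS]mulrC ler_wpM2l// sqr_ge0.
Qed.

Lemma is_derive_theta k x :
  is_derive x 1 (theta k) (theta k.+2 x - k%:R * theta k.+1 x).
Proof.
have [x0|x0|->] := ltgtP x 0.
- rewrite !theta_le0 ?ltW// mulr0 subr0.
  apply: (@near_eq_is_derive _ _ _ (cst 0 : R -> R^o)).
  near=> y; rewrite theta_le0//; apply/ltW; near: y.
  exact: lt_nbhsl.
- have xn0 : x != 0 by rewrite gt_eqF.
  apply: (@near_eq_is_derive _ _ _ (fun y : R => y^-1 ^+ k * expR (- y^-1) : R^o)).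
    near=> y; rewrite theta_gt0//; near: y; exact: lt_nbhsr.
  have dV : is_derive x 1 (fun y : R => y^-1 : R^o) (- x ^- 2).
    split; first exact: derivableV.
    by rewrite deriveV// derive_id [_ *: 1]mulr1.
  have dN : is_derive x 1 (fun y : R => - y^-1 : R^o) (x ^- 2).
    by apply: is_derive_eq; rewrite opprK.
  have dE := @is_derive1_comp R expR (fun y : R => - y^-1) x _ _ (is_derive_expR _) dN.
  have dX := is_deriveX k dV.
  have -> : (fun y : R => y^-1 ^+ k * expR (- y^-1) : R^o) =
      ((fun y : R => y^-1 : R^o) ^+ k) * (expR \o (fun y : R => - y^-1)).
    by apply/funext => y; rewrite mulrfctE exprfctE.
  apply: (is_derive_eq (is_deriveM dX dE)).
  rewrite exprfctE /= -exprVn !theta_gt0// /GRing.scale/=.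
  case: k {dX} => [|k]; rewrite ?expr0 /= ?exprS; ring.
- rewrite !theta_le0// mulr0 subr0.
  have lim0 : (fun h : R => h^-1 *: ((theta k \o shift 0) (h *: 1) - theta k 0)) @ 0^' --> (0 : R).
    apply/cvgrPdist_le => e e0; near=> h.
    rewrite sub0r normrN /= addr0 [h *: 1]mulr1 [theta k 0]theta_le0// subr0.
    rewrite normrM normfV.
    have h0 : 0 < `|h| by rewrite normr_gt0; near: h; exact: nbhs_dnbhs_neq.
    rewrite mulrC ler_pdivrMr// ger0_norm ?theta_ge0//.
    apply: le_trans (theta_le _ _) _; rewrite -[h ^+ 2]real_normK ?num_real//.
    rewrite expr2 mulrA ler_wpM2r// -ler_pdivlMl ?ltr0n ?fact_gt0//.
    near: h; apply: dnbhs0_le; by rewrite mulr_gt0// invr_gt0 ltr0n fact_gt0.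
  by split; [apply/cvg_ex; exists 0|exact: cvg_lim lim0].
Unshelve. all: by end_near. Qed.

(** A class of expressions closed under differentiation. Infinite differentiability follows by
    iteration, with no formula for higher derivatives. *)
Inductive smooth1 : (R -> R) -> Prop :=
| smooth1_theta k : smooth1 (theta k)
| smooth1_cst c : smooth1 (cst c)
| smooth1D f g : smooth1 f -> smooth1 g -> smooth1 (fun x => f x + g x)
| smooth1M f g : smooth1 f -> smooth1 g -> smooth1 (fun x => f x * g x)
| smooth1_affine f a b : smooth1 f -> smooth1 (fun x => f (a * x + b)).

Lemma smooth1_derive f : smooth1 f ->
  exists2 f', smooth1 f' & forall x, is_derive x 1 f (f' x).
Proof.
elim=> {f} [k|c|f g _ [f' sf' df] _ [g' sg' dg]|
            f g sf [f' sf' df] sg [g' sg' dg]|f a b sf [f' sf' df]].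
- exists (fun x => theta k.+2 x + cst (- k%:R) x * theta k.+1 x).
    by do !constructor.
  by move=> x; rewrite /= mulNr; exact: is_derive_theta.
- by exists (cst 0); [constructor|move=> x; exact: is_derive_cst].
- exists (fun x => f' x + g' x); first by constructor.
  by move=> x; exact: is_deriveD.
- exists (fun x => f x * g' x + g x * f' x); first by do !constructor.
  by move=> x; exact: is_deriveM.
- exists (fun x => cst a x * f' (a * x + b)); first by do !constructor.
  move=> x; rewrite /= mulrC.
  apply: (@is_derive1_comp R f (fun x => a * x + b)) => //.
  have := is_deriveD (is_deriveZ a (is_derive_id x 1)) (is_derive_cst b x 1).
  by rewrite addr0 /GRing.scale/= mulr1.
Qed.

Lemma smooth1_continuous f : smooth1 f -> continuous f.
Proof.
move=> /smooth1_derive[f' _ df] x.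
by apply: differentiable_continuous; apply/derivable1_diffP.
Qed.

End smooth_functions.

(** * Bump functions on boxes *)

Section bump_functions.
Context {R : realType} {n : nat}.
Local Notation E := 'rV[R]_n.

Definition tensor (psi : 'I_n -> R -> R) : E -> R := fun x => \prod_i psi i (x 0 i).

(** The difference quotient in direction j is that of the factor j times a constant, so the
    derivative is again a tensor product of functions in [smooth1]. *)
Lemma tensor_partial psi j : (forall i, smooth1 (psi i)) ->
  exists2 psi', forall i, smooth1 (psi' i) &
    forall x, is_derive x (delta_mx 0 j : E) (tensor psi : E -> R^o) (tensor psi' x).
Proof.
move=> spsi; have [f' sf' df] := smooth1_derive (spsi j).
exists (fun i => if i == j then f' else psi i) => [i|x]; first by case: ifP.
pose c := \prod_(i | i != j) psi i (x 0 i).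
have c_E f : \prod_i (if i == j then f else psi i) (x 0 i) = f (x 0 j) * c.
  rewrite (bigD1 j)//= eqxx; congr (_ * _).
  by apply: eq_bigr => i /negbTE ->.
have E_ : (fun h : R => h^-1 *: (((tensor psi : E -> R^o) \o shift x)
      (h *: (delta_mx 0 j : E)) - tensor psi x)) =
    (fun h : R => h^-1 *: (((c *: (psi j : R -> R^o)) \o shift (x 0 j)) (h *: 1) -
      (c *: (psi j : R -> R^o)) (x 0 j))).
  apply/funext => h /=; congr (_ *: (_ - _)); last first.
    by rewrite /tensor (bigD1 j)//= mulrC.
  rewrite /tensor (bigD1 j)//= !mxE !eqxx/= [h *: 1]mulr1 mulr1 mulrC; congr (_ * _).
  by apply: eq_bigr => i ij; rewrite !mxE (negbTE ij) andbF mulr0 add0r.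
have dc : is_derive (x 0 j) 1 (c *: (psi j : R -> R^o)) (c * f' (x 0 j)).
  exact: is_deriveZ.
have [dc1 dc2] := dc.
split; first by rewrite /derivable E_.
by rewrite /derive E_ {1}/tensor c_E mulrC -dc2.
Qed.

Lemma tensor_continuous psi : (forall i, smooth1 (psi i)) -> continuous (tensor psi).
Proof.
move=> spsi.
apply: (@continuous_big R _ *%R 1 xpredT (@mul_continuous R) E (index_enum _)
  (fun i x => psi i (x 0 i))) => i _ x; apply: (@continuous_comp E R R (fun x => x 0 i) (psi i)).
  exact: coord_continuous.
exact: smooth1_continuous.
Qed.

Lemma tensor_smooth psi : (forall i, smooth1 (psi i)) -> smooth (tensor psi).
Proof.
move=> spsi s; have [psi' [spsi' ->]] : exists psi', (forall i, smooth1 (psi' i)) /\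
    partials s (tensor psi) = tensor psi'.
  elim: s => [|j s [psi' [spsi' E_]]]; first by exists psi.
  have [psi'' spsi'' d''] := tensor_partial j spsi'; exists psi''; split => //.
  by apply/funext => x; rewrite /= E_; apply: derive_val.
split; first exact: tensor_continuous.
by move=> i x; have [psi'' _ d''] := tensor_partial i spsi'; have [] := d'' x.
Qed.

(** Since theta 0 s is exp (- 1 / s) for s > 0, this is positive exactly on the open box and tends
    to its indicator as m grows. The arguments are written in the form expected by
    [smooth1_affine]. *)
Definition bump (a b : 'I_n -> R) (m : nat) : E -> R :=
  tensor (fun i t => theta 0 (m.+1%:R * t + - (m.+1%:R * a i)) *
    theta 0 (- m.+1%:R * t + m.+1%:R * b i)).

Lemma bump_smooth a b m : smooth (bump a b m).
Proof. by apply: tensor_smooth => i; do !constructor. Qed.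

Lemma theta0_le1 x : theta 0 x <= 1 :> R.
Proof.
have [x0|x0] := leP x 0; first by rewrite theta_le0.
by rewrite theta_gt0// expr0 mul1r expR_le1 oppr_le0 invr_ge0 ltW.
Qed.

Lemma bump_ge0 a b m x : 0 <= bump a b m x.
Proof. by apply: prodr_ge0 => i _; rewrite mulr_ge0 ?theta_ge0. Qed.

Lemma bump_le1 a b m x : bump a b m x <= 1.
Proof.
apply: prodr_ile1 => i _; rewrite mulr_ge0 ?theta_ge0//=.
by rewrite mulr_ile1 ?theta_ge0 ?theta0_le1.
Qed.

Lemma bump_notin a b m x : ~ obox a b x -> bump a b m x = 0.
Proof.
move=> nab; apply/eqP; apply: contraT; rewrite prodf_seq_neq0 => /allP H.
exfalso; apply: nab => i; have := H i (mem_index_enum _).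
rewrite mulf_eq0 negb_or /= in_itv/= => /andP[/eqP h1 /eqP h2].
have m0 : 0 < m.+1%:R :> R by [].
apply/andP; split; rewrite ltNge; apply/negP => h.
  by apply: h1; rewrite theta_le0// -mulrBr pmulr_rle0// subr_le0.
by apply: h2; rewrite theta_le0// mulNr addrC -mulrBr pmulr_rle0// subr_le0.
Qed.

Lemma bump_cvg a b x : bump a b m x @[m --> \oo] --> (\1_(obox a b) x : R).
Proof.
have [xab|xab] := pselect (obox a b x); last first.
  rewrite indicE memNset//; under eq_fun do rewrite bump_notin//.
  exact: cvg_cst.
have th (s : R) : 0 < s -> theta 0 (m.+1%:R * s) @[m --> \oo] --> (1 : R).
  move=> s0; under eq_fun do rewrite theta_gt0 ?mulr_gt0// expr0 mul1r invfM.
  have H : - (m.+1%:R^-1 * s^-1) @[m --> \oo] --> - (0 * s^-1 : R).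
    by apply: cvgN; apply: cvgM; [exact: cvg_harmonic|exact: cvg_cst].
  have := continuous_cvg _ (@continuous_expR R _) H.
  by rewrite mul0r oppr0 expR0; apply.
rewrite indicE mem_set// (_ : true%:R = \prod_(i < n) 1); last by rewrite big1.
rewrite /bump /tensor.
apply: (@cvg_big R _ *%R 1 xpredT (@mul_continuous R)).
move=> i _; have := xab i; rewrite /= in_itv/= => /andP[ax xb].
rewrite -[X in _ --> X](mulr1 1); apply: cvgM.
  under eq_fun do rewrite -mulrBr.
  by apply: th; rewrite subr_gt0.
under eq_fun do rewrite mulNr addrC -mulrBr.
by apply: th; rewrite subr_gt0.
Qed.

Lemma closed_cbox (a b : 'I_n -> R) : closed (cbox a b).
Proof.
rewrite (_ : cbox a b = \bigcap_(i in [set: 'I_n])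
    ((fun x : E => x 0 i) @^-1` `[a i, b i]%classic)).
  apply: closed_bigI => i _; apply: closed_comp; last exact: interval_closed.
  by move=> x _; exact: coord_continuous.
by apply/seteqP; split => x H i => [_|]; exact: H.
Qed.

Lemma bump_test_function a b m (Omega : set E) : cbox a b `<=` Omega ->
  test_function Omega (bump a b m).
Proof.
move=> abO.
have sub : closure [set x | bump a b m x != 0] `<=` cbox a b.
  rewrite closureE; apply: smallest_sub; first exact: closed_cbox.
  move=> x /= bx; apply: obox_sub_cbox; apply: contrapT => /bump_notin.
  by move=> /(_ m) bx0; rewrite bx0 eqxx in bx.
split; first exact: bump_smooth.
  apply: (subclosed_compact _ _ sub); first exact: closed_closure.
  apply: (@rV_compact R n (fun i => `[a i, b i]%classic)) => i.
  exact: segment_compact.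
exact: subset_trans sub abO.
Qed.

End bump_functions.

(** * The fundamental lemma of the calculus of variations *)

Section fundamental_lemma.
Context {R : realType} {n : nat}.
Local Notation E := 'rV[R]_n.
Local Notation mu := (lebesgue_rV n).

Definition orthant (c : 'I_n -> R) : set E :=
  [set x | forall i, `]c i, +oo[%classic (x 0 i)].

Lemma measurable_orthant c : measurable (orthant c).
Proof.
apply: (@measurable_rV_box R n (fun i => `]c i, +oo[%classic)) => i.
exact: measurable_itv.
Qed.

Lemma orthantI c c' : orthant c `&` orthant c' =
  orthant (fun i => Num.max (c i) (c' i)).
Proof.
apply/seteqP; split => x /=.
  by move=> [H H'] i; have := H i; have := H' i; rewrite /= !in_itv/= !andbT gt_max => -> ->.
by move=> H; split => i; have := H i; rewrite /= !in_itv/= !andbT gt_max => /andP[].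
Qed.

(** A coordinate half-space is the countable union of the orthants whose remaining bounds are -k. *)
Lemma measurable_rV_orthants :
  @measurable _ E = <<s [set A | exists c, A = orthant c] >>.
Proof.
set G := [set A | _]; apply/seteqP; split; last first.
  apply: smallest_sub; first exact: sigma_algebra_measurable.
  by move=> _ [c ->]; exact: measurable_orthant.
apply: smallest_sub; first exact: smallest_sigma_algebra.
move=> A; rewrite -bigcup_seq => -[i _ [B mB <-]].
have mc : measurable_fun [set: g_sigma_algebraType G] (@coord_rV R n i).
  apply: (measurability _ (RGenOInfty.measurableE R)).
  move=> _ [_ [x ->] <-]; rewrite setTI.
  rewrite (_ : _ @^-1` _ = \bigcup_k orthant (fun j => if j == i then x else - k%:R)).
    apply: bigcupT_measurable => k; apply: sub_sigma_algebra.
    by exists (fun j => if j == i then x else - k%:R).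
  apply/seteqP; split => y; last first.
    by move=> [k _ /(_ i)]; rewrite eqxx.
  rewrite /coord_rV /= => xy.
  pose N := \max_(j < n) (Num.truncn `|y ord0 j|).+1.
  exists N => // j; case: ifP => [/eqP ->//|_]; rewrite /= in_itv/= andbT.
  have : `|y ord0 j| < N%:R.
    apply: lt_le_trans (truncnS_gt _) _; rewrite ler_nat.
    exact: (leq_bigmax (F := fun j => (Num.truncn `|y ord0 j|).+1) j).
  by rewrite ltr_norml => /andP[].
exact: mc.
Qed.

Variables (Omega : set E).
Hypotheses (oO : open Omega) (bO : bounded_set Omega).

Lemma measurable_Omega : measurable Omega. Proof. exact: open_measurable_rV. Qed.

Lemma lebesgue_Omega_lty : (mu Omega < +oo)%E.
Proof.
have [M M0 OM] := bounded_set_box bO.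
apply: le_lt_trans (@lebesgue_box_lty R n M).
by apply: le_measure => //; rewrite inE; [exact: measurable_Omega|exact: measurable_box].
Qed.

Let mO := measurable_Omega.

Lemma bounded_sq_integrable (f : E -> R) : measurable_fun setT f ->
  (exists B, forall x, `|f x| <= B) -> sq_integrable mu Omega f.
Proof.
move=> mf [B fB]; split; first exact: measurable_funTS.
apply: measurable_bounded_integrable => //.
- exact: lebesgue_Omega_lty.
- by apply: measurable_funX; exact: measurable_funTS.
exists (B ^+ 2); split; first exact: num_real.
move=> M BM x _; apply: le_trans (ltW BM); rewrite normrX.
by rewrite ler_sqr ?nnegrE ?normr_ge0// (le_trans _ (fB x)).
Qed.

Lemma sq_integrable_integrable u : sq_integrable mu Omega u ->
  mu.-integrable Omega (EFin \o (u : E -> R)).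
Proof.
move=> Lu; have L1 : sq_integrable mu Omega (cst 1 : E -> R).
  apply: bounded_sq_integrable; first exact: measurable_cst.
  by exists 1 => x; rewrite normr1.
have := sq_integrableM mO Lu L1; apply: eq_integrable => // x _ /=.
by rewrite mulr1.
Qed.

Section vanishing.
Variable u : E -> R.
Hypothesis Lu : sq_integrable mu Omega u.
Hypothesis u0 : forall phi, test_function Omega phi ->
  \int[mu]_(x in Omega) (u x * phi x) = 0.

Let iu := sq_integrable_integrable Lu.

Let bump_sq_integrable a b m : sq_integrable mu Omega (@bump R n a b m).
Proof.
apply: bounded_sq_integrable.
  by apply: continuous_measurable_rV; have [] := @bump_smooth R n a b m [::].
by exists 1 => x; rewrite ger0_norm ?bump_ge0 ?bump_le1.
Qed.

(** Dominated convergence along the bumps of the box, with |u| as dominating function, integrable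
    because Omega has finite measure. *)
Let obox_integral a b : cbox a b `<=` Omega ->
  (\int[mu]_(x in obox a b) (u x)%:E = 0)%E.
Proof.
move=> abO; have mu_ : measurable_fun Omega u by have [] := Lu.
have mb : measurable (obox a b : set E) by exact: measurable_obox.
have ObO : obox a b = Omega `&` obox a b.
  by rewrite setIidr// => x /obox_sub_cbox /abO.
rewrite ObO integral_mkcondr.
have [|||||_ _] := @dominated_convergence _ _ _ mu Omega mO
  (fun m x => (u x * bump a b m x)%:E) ((EFin \o u) \_ (obox a b)) (fun x => `|u x|%:E).
- move=> m; apply/measurable_EFinP; apply: measurable_funM => //.
  by have [] := bump_sq_integrable a b m.
- apply/(measurable_restrict _ mb mO) => //; apply/measurable_EFinP.
  by apply: measurable_funS mu_ => //; exact: subIsetl.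
- apply: aeW => x Ox; rewrite patchE (_ : (if _ then _ else _) = (u x * \1_(obox a b) x)%:E).
    apply: cvg_EFin; first exact: nearW.
    by apply: cvgM; [exact: cvg_cst|exact: bump_cvg].
  by rewrite indicE; case: ifPn; rewrite ?mulr1 ?mulr0.
- exact: integrable_norm.
- apply: aeW => x m Ox; rewrite lee_fin normrM.
  by rewrite ler_piMr// ger0_norm ?bump_ge0 ?bump_le1.
move=> H; apply/esym; apply: cvg_unique H => //.
rewrite (_ : (fun _ => _) = cst 0%E); first exact: cvg_cst.
apply/funext => m; have := u0 (bump_test_function m abO).
rewrite /Rintegral => h; rewrite -[LHS]fineK ?h//.
apply: integrable_fin_num => //.
exact: (sq_integrableM mO Lu (bump_sq_integrable a b m)).
Qed.

(* Orthants form a generating pi-system whose traces on a box are boxes. *)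
Let measurable_integral a b A : cbox a b `<=` Omega -> measurable A ->
  (\int[mu]_(x in A `&` obox a b) (u x)%:E = 0)%E.
Proof.
move=> abO mA; set B := obox a b.
have mB : measurable (B : set E) by exact: measurable_obox.
have BO : B `<=` Omega by move=> x /obox_sub_cbox /abO.
have iB : mu.-integrable B (EFin \o u) by apply: integrableS iu.
have intB := obox_integral abO.
move: A mA; rewrite measurable_rV_orthants.
apply: (dynkin_induction (P := fun A => (\int[mu]_(x in A `&` B) (u x)%:E = 0)%E)).
- exact: measurable_rV_orthants.
- by move=> _ _ [c ->] [c' ->]; rewrite orthantI; eexists; reflexivity.
- by rewrite setTI.
- move=> _ [c ->]; rewrite (_ : _ `&` _ = obox (fun i => Num.max (c i) (a i)) b).
    apply: obox_integral => x H; apply: abO => i; have := H i.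
    by rewrite /= !in_itv/= ge_max => /andP[/andP[_ ->] ->].
  apply/seteqP; split => x /=.
    move=> [H H'] i; have := H i; have := H' i.
    by rewrite /= !in_itv/= andbT gt_max => /andP[-> ->] ->.
  move=> H; split => i; have := H i; rewrite /= !in_itv/= gt_max.
    by rewrite andbT => /andP[/andP[]].
  by move=> /andP[/andP[_ ->]] ->.
- move=> A mA A0; have mAB : measurable (A `&` B) by exact: measurableI.
  have mCB : measurable (~` A `&` B) by apply: measurableI => //; exact: measurableC.
  have B_E : (A `&` B) `|` (~` A `&` B) = B by rewrite -setIUl setUv setTI.
  have := intB; rewrite -/B -{1}B_E integral_setU//= ?A0 ?add0e//.
  + by rewrite B_E; exact: (measurable_int mu iB).
  + by rewrite disj_set2E setIACA setICr set0I.
- move=> F mF tF F0; rewrite setI_bigcupl integral_bigcup//.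
  + by rewrite eseries0// => k _ _; exact: F0.
  + exact: trivIset_setIr.
  + by move=> k; exact: measurableI.
  + apply: (integrableS mB _ _ iB).
      by apply: bigcupT_measurable => k; exact: measurableI.
    by move=> x [k _ []].
Qed.

(** On each box of a countable cover u has zero integral over every measurable subset, hence
    vanishes off a null set; countably many null sets are discarded. *)
Lemma du_bois_reymond : u = cst 0 %[ae mu in Omega].
Proof.
have [P [a [b [abO O_E]]]] := open_obox_cover oO.
have H k : \forall x \ae mu, P k -> obox (a k) (b k) x -> u x = 0.
  have [Pk|nPk] := pselect (P k); last by apply: aeW => x /nPk.
  have mB : measurable (obox (a k) (b k) : set E) by exact: measurable_obox.
  have BO : obox (a k) (b k) `<=` Omega by move=> x /obox_sub_cbox /(abO _ Pk).
  have iB : mu.-integrable (obox (a k) (b k)) (EFin \o u) by apply: integrableS iu.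
  have := @integral_ae_eq _ _ _ mu _ mB (cst 0%E) _ iB (measurable_cst _).
  move=> /(_ _)/wrap[]; last first.
    by apply: filterS => x h _ Bx; have [] := h Bx.
  move=> A AB mA; rewrite integral0 -(setIidl AB).
  exact: measurable_integral (abO _ Pk) mA.
have := ae_foralln H; apply: filterS => x h; rewrite {1}O_E => -[k Pk Bx].
exact: h Pk Bx.
Qed.

End vanishing.

End fundamental_lemma.

(** * Weak derivatives and the space H^1_0 *)

Section weak_derivatives.
Context {R : realType} {n : nat}.
Local Notation E := 'rV[R]_n.
Local Notation mu := (lebesgue_rV n).
Variables (Omega : set E).
Hypotheses (oO : open Omega) (bO : bounded_set Omega).
Implicit Types (u v g phi psi : E -> R^o) (i : 'I_n).

Let mO := measurable_Omega oO.
Local Notation L := (sq_integrable mu Omega).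
Local Notation dot := (dotp mu Omega).

Let sL := sq_integrable_subspace mu mO.
Let pL := dotp_psd mu mO.

Lemma bsupp_sq_integrable M (f : E -> R) : bsupp (box M) f -> L f.
Proof. by move=> [mf bf _]; exact: bounded_sq_integrable. Qed.

Lemma test_function_L2 phi : test_function Omega phi -> L phi.
Proof.
have [M _ OM] := bounded_set_box bO.
by move=> /test_function_C1supp/(_ OM)[+ _ _]; exact: bsupp_sq_integrable.
Qed.

Lemma test_partial_L2 phi i : test_function Omega phi -> L (partial i phi).
Proof.
have [M _ OM] := bounded_set_box bO.
by move=> /test_function_C1supp/(_ OM)[_ + _] => /(_ i); exact: bsupp_sq_integrable.
Qed.

Lemma is_derive_test phi i x : test_function Omega phi ->
  is_derive x (delta_mx 0 i : E) phi (partial i phi x).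
Proof. by move=> [sphi _ _]; apply: derivableP; have [_] := sphi [::]; apply. Qed.

(** The product rule along coordinate lines is all that integration by parts asks of the product. *)
Lemma test_product_C1supp M phi psi : Omega `<=` box M ->
  test_function Omega phi -> test_function Omega psi ->
  C1supp M (fun x => phi x * psi x)
    (fun i x => partial i phi x * psi x + phi x * partial i psi x).
Proof.
move=> OM tphi tpsi; have [sphi _ _] := tphi; have [spsi _ _] := tpsi.
have [b1 b1' _] := test_function_C1supp tphi OM.
have [b2 b2' _] := test_function_C1supp tpsi OM.
split; first exact: bsuppM.
  by move=> i; apply: bsuppD; exact: bsuppM.
move=> x i s t st.
have cont (f : E -> R) : continuous f -> continuous (fun r => f (upd x i r)).
  move=> cf r; apply: continuous_comp; first exact: upd_continuous.
  exact: cf.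
have [c1 _] := sphi [::]; have [c1' _] := sphi [:: i].
have [c2 _] := spsi [::]; have [c2' _] := spsi [:: i].
apply: (Rintegral_FTC (p := fun r => phi (upd x i r) * psi (upd x i r))
  (q := fun r => partial i phi (upd x i r) * psi (upd x i r) +
                 phi (upd x i r) * partial i psi (upd x i r))) => //.
  by move=> r; apply: cvgD; apply: cvgM; exact: cont.
move=> r; have d1 : is_derive r 1 (fun r : R => phi (upd x i r) : R) (partial i phi (upd x i r)).
  by apply: derivable_upd; have [] := is_derive_test i (upd x i r) tphi.
have d2 : is_derive r 1 (fun r : R => psi (upd x i r) : R) (partial i psi (upd x i r)).
  by apply: derivable_upd; have [] := is_derive_test i (upd x i r) tpsi.
by apply: (is_derive_eq (is_deriveM d1 d2)); rewrite addrC /GRing.scale/= [_ * partial _ _ _]mulrC.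
Qed.

Lemma Rintegral_Omega_ext (f : E -> R) : (forall x, ~ Omega x -> f x = 0) ->
  \int[mu]_(x in Omega) f x = \int[mu]_x f x.
Proof.
move=> f0; rewrite Rintegral_mkcond; apply: eq_Rintegral => x _.
by rewrite patchE; case: ifPn => //; rewrite notin_setE => /f0 ->.
Qed.

Lemma test_weak_deriv phi i : test_function Omega phi ->
  is_weak_deriv Omega i phi (partial i phi).
Proof.
move=> tphi; split; first exact: test_partial_L2.
move=> psi tpsi; have [M M0 OM] := bounded_set_box bO.
have := Rintegral_partial0 i M0 (test_product_C1supp OM tphi tpsi).
rewrite -Rintegral_Omega_ext; last first.
  by move=> x nO; rewrite !(test_function_notin tphi nO, test_function_notin tpsi nO) mulr0 mul0r addr0.
rewrite RintegralD//; last 2 first.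
- by apply: (sq_integrableM mO); [exact: test_partial_L2|exact: test_function_L2].
- by apply: (sq_integrableM mO); [exact: test_function_L2|exact: test_partial_L2].
by move=> /eqP; rewrite addrC addr_eq0 => /eqP.
Qed.

Lemma weak_deriv_unique u i g g' : is_weak_deriv Omega i u g ->
  is_weak_deriv Omega i u g' -> g = g' %[ae mu in Omega].
Proof.
move=> [Lg Hg] [Lg' Hg'].
have Ld : L (g - g') by exact: (subspaceB sL Lg Lg').
have H : forall phi, test_function Omega phi -> \int[mu]_(x in Omega) ((g - g') x * phi x) = 0.
  move=> phi tphi; have Lphi := test_function_L2 tphi.
  have := linear_onB (psd_linl sL pL Lphi) Lg Lg'; rewrite /dotp => ->.
  apply/eqP; rewrite subr_eq0; apply/eqP; apply: oppr_inj.
  by rewrite -Hg// -Hg'.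
have := du_bois_reymond oO bO Ld H; apply: filterS => x h Ox; have := h Ox.
by move=> /eqP; rewrite subr_eq0 => /eqP.
Qed.

Lemma weak_derivP u i : H1 Omega u -> is_weak_deriv Omega i u (weak_deriv Omega i u).
Proof. by move=> [_ /(_ i)[g Hg]]; apply: xgetPex; exists g. Qed.

Lemma weak_deriv_L2 u i : H1 Omega u -> L (weak_deriv Omega i u).
Proof. by move=> /weak_derivP => /(_ i)[]. Qed.

Lemma weak_deriv_ae u i g : H1 Omega u -> is_weak_deriv Omega i u g ->
  weak_deriv Omega i u = g %[ae mu in Omega].
Proof. by move=> Hu; apply: weak_deriv_unique; exact: weak_derivP. Qed.

Lemma is_weak_deriv_lin k u v g h i : L u -> L v ->
  is_weak_deriv Omega i u g -> is_weak_deriv Omega i v h ->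
  is_weak_deriv Omega i (k *: u + v) (k *: g + h).
Proof.
move=> Lu Lv [Lg Hg] [Lh Hh]; split; first exact: sL.2.
move=> phi tphi; have Lphi := test_function_L2 tphi.
have Ldphi := test_partial_L2 i tphi.
have := psd_linl sL pL Lphi k Lg Lh; have := psd_linl sL pL Ldphi k Lu Lv.
by rewrite /dotp => -> ->; rewrite Hg// Hh//; ring.
Qed.

(** Both sides of the defining identity are inner products with a fixed square integrable function,
    hence continuous in u and in g. *)
Lemma is_weak_deriv_lim (u_ g_ : nat -> E -> R^o) u g i :
  (forall k, L (u_ k)) -> (forall k, is_weak_deriv Omega i (u_ k) (g_ k)) ->
  L u -> L g -> tends_to dot u_ u -> tends_to dot g_ g ->
  is_weak_deriv Omega i u g.
Proof.
move=> Lu_ Hg_ Lu Lg uu gg; split=> // phi tphi.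
have Lphi := test_function_L2 tphi; have Ldphi := test_partial_L2 i tphi.
have Lg_ k : L (g_ k) by have [] := Hg_ k.
have c1 := tends_to_cvg sL pL Lu_ Lu Ldphi uu.
have c2 := tends_to_cvg sL pL Lg_ Lg Lphi gg.
have /funext E_ : forall k, dot (u_ k) (partial i phi) = - dot (g_ k) phi.
  by move=> k; have [_] := Hg_ k; apply.
move: c1; rewrite E_ => c1.
by have := cvg_unique _ c1 (cvgN c2); apply.
Qed.

Lemma H1_subspace : subspace (H1 Omega : set (E -> R^o)).
Proof.
split.
  split; first exact: sL.1.
  move=> i; exists (0 : E -> R^o); split; first exact: sL.1.
  move=> phi tphi.
  have := linear_on0 sL (psd_linl sL pL (test_function_L2 tphi)).
  have := linear_on0 sL (psd_linl sL pL (test_partial_L2 i tphi)).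
  by rewrite /dotp => -> ->; rewrite oppr0.
move=> k u v [Lu Hu] [Lv Hv]; split; first exact: sL.2.
move=> i; have [g Hg] := Hu i; have [h Hh] := Hv i.
by exists (k *: g + h); exact: is_weak_deriv_lin.
Qed.

Lemma weak_deriv_lin k u v i : H1 Omega u -> H1 Omega v ->
  weak_deriv Omega i (k *: u + v) =
  k *: (weak_deriv Omega i u : E -> R^o) + weak_deriv Omega i v %[ae mu in Omega].
Proof.
move=> Hu Hv; apply: weak_deriv_ae; first exact: H1_subspace.2.
by apply: is_weak_deriv_lin; [case: Hu|case: Hv|exact: weak_derivP|exact: weak_derivP].
Qed.

(** Representatives of weak derivatives are chosen independently for each function, so linearity
    holds only almost everywhere; [dotp_ae] absorbs the difference. *)
Lemma a_form_psd : psd_form (H1 Omega : set (E -> R^o)) (a_form Omega).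
Proof.
split=> [u v Hu Hv|w Hw k u v Hu Hv|v Hv].
- apply: eq_bigr => i _.
  exact: (psd_sym pL (weak_deriv_L2 i Hu) (weak_deriv_L2 i Hv)).
- rewrite /a_form mulr_sumr -big_split/=; apply: eq_bigr => i _.
  have Lw := weak_deriv_L2 i Hw; have Lu := weak_deriv_L2 i Hu.
  have Lv := weak_deriv_L2 i Hv.
  have Hs := H1_subspace.2 k _ _ Hu Hv.
  rewrite -(psd_lin pL Lw k Lu Lv) -/(dot _ _).
  rewrite (psd_sym pL Lw (weak_deriv_L2 i Hs)) (psd_sym pL Lw (sL.2 k _ _ Lu Lv)).
  apply: dotp_ae => //; [exact: weak_deriv_L2|exact: sL.2|exact: weak_deriv_lin].
- by apply: sumr_ge0 => i _; exact: (psd_ge0 pL (weak_deriv_L2 i Hv)).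
Qed.

Lemma b_form_psd : psd_form (H1 Omega : set (E -> R^o)) (b_form Omega).
Proof. by apply: psd_formS pL => u []. Qed.

End weak_derivatives.


(** * The vector space of test functions *)

Section test_space.
Context {R : realType} {n : nat}.
Local Notation E := 'rV[R]_n.
Implicit Types (Omega : set E) (phi psi : E -> R^o).

Lemma smooth_lin k phi psi : smooth phi -> smooth psi -> smooth (k *: phi + psi).
Proof.
move=> sphi spsi s.
have -> : partials s (k *: phi + psi) = k *: (partials s phi : E -> R^o) + partials s psi.
  elim: s => //= i s ->; apply/funext => x; rewrite /partial.
  have d1 := (sphi s).2 i x; have d2 := (spsi s).2 i x.
  by rewrite (deriveD (derivableZ (k := k) d1) d2) (deriveZ k d1).
split=> [x|i x].
  apply: continuousD; last exact: (spsi s).1.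
  by apply: continuousZl_tmp; exact: (sphi s).1.
by apply: derivableD; [apply: derivableZ; exact: (sphi s).2|exact: (spsi s).2].
Qed.

Lemma test_function_lin Omega k phi psi : test_function Omega phi ->
  test_function Omega psi -> test_function Omega (k *: phi + psi).
Proof.
move=> [s1 c1 o1] [s2 c2 o2].
have sub : closure [set x | (k *: phi + psi) x != 0] `<=`
    closure [set x | phi x != 0] `|` closure [set x | psi x != 0].
  rewrite -closureU; apply: closure_subset => x /= nz.
  case: (eqVneq (phi x) 0) => [p0|]; last by left.
  right; apply: contra_neq nz => q0.
  by have -> : (k *: phi + psi) x = k * phi x + psi x by []; rewrite p0 q0 mulr0 addr0.
split; first exact: smooth_lin.
  exact: (subclosed_compact (@closed_closure _ _) (compactU c1 c2) sub).
by move=> x /sub[/o1|/o2].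
Qed.

Lemma test_function0 Omega : test_function Omega (0 : E -> R^o).
Proof.
have e0 : [set x | (0 : E -> R^o) x != 0] = set0.
  by apply/seteqP; split => // x /=; rewrite eqxx.
split; rewrite ?e0 ?closure0//; last exact: compact0.
move=> s; have -> : partials s (0 : E -> R^o) = cst 0.
  elim: s => //= i s ->; apply/funext => x; rewrite /partial.
  exact: derive_cst.
by split=> [x|i x]; [exact: cst_continuous|exact: derivable_cst].
Qed.

End test_space.

(** * Inequalities and completeness for H^1_0 *)

Section H10_theory.
Context {R : realType} {n : nat}.
Local Notation E := 'rV[R]_n.+1.
Local Notation mu := (lebesgue_rV n.+1).
Variables (Omega : set E).
Hypotheses (oO : open Omega) (bO : bounded_set Omega).
Implicit Types (u v g phi psi : E -> R^o) (i : 'I_n.+1).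

Let mO := measurable_Omega oO.
Local Notation L := (sq_integrable mu Omega).
Local Notation dot := (dotp mu Omega).
Local Notation H1 := (H1 Omega : set (E -> R^o)).
Local Notation H10 := (H10 Omega : set (E -> R^o)).
Local Notation a := (a_form Omega).
Local Notation b := (b_form Omega).

Let sL := sq_integrable_subspace mu mO.
Let pL := dotp_psd mu mO.
Let sH := H1_subspace oO bO.
Let pa := a_form_psd oO bO.
Let pb := b_form_psd oO.

Definition h1_form u v : R := b u v + a u v.

Lemma h1_form_psd : psd_form H1 h1_form.
Proof. exact: psd_formD pb pa. Qed.

Lemma test_function_H1 phi : test_function Omega phi -> H1 phi.
Proof.
move=> tphi; split; first exact: test_function_L2.
by move=> i; exists (partial i phi); exact: test_weak_deriv.
Qed.

Let tests : set (E -> R^o) := [set phi | test_function Omega phi].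

Let s_tests : subspace tests.
Proof.
split; first exact: test_function0.
by move=> k phi psi; exact: test_function_lin.
Qed.

Let tests_H1 : tests `<=` H1. Proof. by move=> phi; exact: test_function_H1. Qed.

(** Since [norm_H1] is the square root of [h1_form], tolerances are squared; a sequence is chosen
    among the approximants at distance (1/2)^k. *)
Lemma H10_closure : H10 = form_closure H1 tests h1_form.
Proof.
apply/seteqP; split=> u [Hu].
  move=> [phi tphi cphi]; split => // e e0.
  have se0 : 0 < Num.sqrt e by rewrite sqrtr_gt0.
  have /cvgrPdist_le/(_ _ se0)[N _ /(_ N (leqnn _))] := cphi.
  rewrite sub0r normrN ger0_norm ?sqrtr_ge0// ler_sqrt => [H|]; last exact: ltW.
  by exists (phi N); first exact: tphi.
move=> H; split => //.
have /choice[phi Hphi] : forall k : nat, exists phi : E -> R^o, test_function Omega phi /\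
    h1_form (u - phi) (u - phi) <= ((1 / 2) ^+ k) ^+ 2.
  move=> k; have /H[phi tphi Hphi] : 0 < ((1 / 2) ^+ k) ^+ 2 :> R by rewrite !exprn_gt0.
  by exists phi.
exists phi; first by move=> k; have [] := Hphi k.
apply/cvgrPdist_le => e e0; have [N HN] := exists_geometric_le e0.
exists N => // k /= Nk; rewrite sub0r normrN ger0_norm ?sqrtr_ge0//.
apply: le_trans HN; have [_ Hk] := Hphi k.
apply: (@le_trans _ _ ((1 / 2) ^+ k)).
  by rewrite -[leRHS]ger0_norm ?exprn_ge0// -sqrtr_sqr; apply: ler_wsqrtr.
by apply: ler_wiXn2l => //; lra.
Qed.

Lemma H10_H1 : H10 `<=` H1. Proof. by move=> u []. Qed.

Lemma H10_subspace : subspace H10.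
Proof. by rewrite H10_closure; exact: form_closure_subspace sH h1_form_psd s_tests tests_H1. Qed.

Lemma a_form_test phi : test_function Omega phi ->
  a phi phi = \sum_i \int[mu]_x (partial i phi x ^+ 2).
Proof.
move=> tphi; apply: eq_bigr => i _; have Hphi := test_function_H1 tphi.
have Lw := weak_deriv_L2 i Hphi; have Lp := test_partial_L2 oO bO i tphi.
have ae := weak_deriv_ae oO bO Hphi (test_weak_deriv oO bO i tphi).
transitivity (dot (partial i phi) (partial i phi)).
  rewrite -/(dot _ _) (dotp_ae mO Lw Lp Lw ae) (psd_sym pL Lp Lw).
  exact: (dotp_ae mO Lw Lp Lp ae).
rewrite /dotp (@Rintegral_Omega_ext R n.+1 Omega).
  by apply: eq_Rintegral => x _; rewrite expr2.
by move=> x nO; rewrite (partial_notin i tphi nO) mulr0.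
Qed.

Lemma b_form_test phi : test_function Omega phi ->
  b phi phi = \int[mu]_x (phi x ^+ 2).
Proof.
move=> tphi; rewrite /b_form (@Rintegral_Omega_ext R n.+1 Omega).
  by apply: eq_Rintegral => x _; rewrite expr2.
by move=> x nO; rewrite (test_function_notin tphi nO) mulr0.
Qed.

Let h1_formE u v : h1_form u v = b u v + a u v. Proof. by []. Qed.

Lemma H10_friedrichs : exists2 C, 0 < C & forall u, H10 u -> b u u <= C * a u u.
Proof.
have [M M0 OM] := bounded_set_box bO.
pose C := (2 * M + 1) * (2 * M); have C0 : 0 < C by rewrite mulr_gt0// ?addr_gt0// mulr_gt0.
exists (4 * C); first by rewrite mulr_gt0.
rewrite H10_closure; apply: (form_closure_le sH tests_H1 pa pb h1_formE C0).
move=> phi tphi; rewrite b_form_test// a_form_test// big_ord_recl.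
have C1phi := test_function_C1supp tphi OM.
apply: le_trans (friedrichs M0 C1phi) _; rewrite ler_pM2l// lerDl.
by apply: sumr_ge0 => i _; apply: Rintegral_ge0 => x _; exact: sqr_ge0.
Qed.

(** The functionals are inner products with the indicators of the cells of a box containing Omega;
    test functions vanish off Omega, so these are their averages up to scaling. The tolerance e / 4
    absorbs the factor 4 of [form_closure_compact]. *)
Lemma H10_compact e : 0 < e -> exists ls : seq ((E -> R^o) -> R),
  (forall l, List.In l ls -> linear_on H10 l /\ bounded_for H10 a l) /\
  forall v, H10 v -> (forall l, List.In l ls -> l v = 0) -> b v v <= e * a v v.
Proof.
move=> e0; have [M M0 OM] := bounded_set_box bO.
have e4 : 0 < e / 4 by rewrite divr_gt0.
have [J [S [K [K0 mS HS]]]] := @compactness_inequality R n.+1 M _ M0 e4.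
pose ind j : E -> R^o := \1_(S j).
have Lind j : L (ind j).
  apply: bounded_sq_integrable => //; first exact: measurable_indic.
  by exists 1 => x; rewrite /ind indicE; case: (_ \in _); rewrite ?normr1 ?normr0.
pose l j v := dot (ind j) v.
have lH j : linear_on H1 (l j).
  by move=> k u v [Lu _] [Lv _]; exact: (psd_lin pL (Lind j)).
pose B := \sum_j dot (ind j) (ind j).
have B0 : 0 <= B by apply: sumr_ge0 => j _; exact: (psd_ge0 pL).
have lB j v : H1 v -> l j v ^+ 2 <= B * b v v.
  move=> Hv; apply: le_trans (psd_cauchy_schwarz sL pL (Lind j) Hv.1) _.
  apply: ler_wpM2r; first exact: (psd_ge0 pb Hv).
  by rewrite /B (bigD1 j)//= lerDl; apply: sumr_ge0 => k _; exact: (psd_ge0 pL).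
have [C C0 HC] := H10_friedrichs.
exists [seq l j | j <- enum J]; split.
  move=> l' /List.in_map_iff[j [<- _]]; split.
    by move=> k u v /H10_H1 Hu /H10_H1 Hv; exact: lH.
  exists (B * C) => v Hv; apply: le_trans (lB j v (H10_H1 Hv)) _.
  by rewrite -mulrA ler_wpM2l// HC.
move=> v Hv lv.
have lv0 j : l j v = 0.
  apply: lv; apply/List.in_map_iff; exists j; split => //.
  have : j \in enum J by rewrite mem_enum.
  by elim: (enum J) => //= k s IH; rewrite inE => /predU1P[->|/IH]; [left|right].
have E_ : e = 4 * (e / 4) by field.
rewrite [in leRHS]E_; move: Hv; rewrite H10_closure => Hv.
apply: (form_closure_compact sH tests_H1 pa pb h1_formE e4 K0 B0 lH lB) => //.
move=> phi tphi; rewrite b_form_test// a_form_test//.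
apply: le_trans (HS _ _ (test_function_C1supp tphi OM)) _.
rewrite lerD2l ler_wpM2l// le_eqVlt; apply/orP; left; apply/eqP.
apply: eq_bigr => j _; congr (_ ^+ 2); apply/esym.
apply: Rintegral_Omega_ext => x nO.
by rewrite (test_function_notin tphi nO) mulr0.
Qed.

(** The functions and each of their weak derivatives converge in L^2 separately, and
    [is_weak_deriv_lim] identifies the limits of the latter as weak derivatives of the limit. *)
Lemma H1_complete : complete_for H1 h1_form.
Proof.
move=> u_ Hu_ cauchy.
have Lu_ k : L (u_ k) by have [] := Hu_ k.
have h_ge k m : b (u_ k - u_ m) (u_ k - u_ m) <= h1_form (u_ k - u_ m) (u_ k - u_ m).
  by rewrite /h1_form lerDl (psd_ge0 pa)//; exact: subspaceB.
have [e e0|u Lu uu] := sq_integrable_complete mO Lu_.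
  have [N HN] := cauchy _ e0; exists N => k m Nk Nm.
  exact: le_trans (h_ge k m) (HN _ _ Nk Nm).
pose g_ i k : E -> R^o := weak_deriv Omega i (u_ k).
have Lg_ i k : L (g_ i k) by exact: weak_deriv_L2.
have wd_B i v w : H1 v -> H1 w ->
    weak_deriv Omega i (v - w) = (weak_deriv Omega i v : E -> R^o) - weak_deriv Omega i w
    %[ae mu in Omega].
  move=> Hv Hw; have := weak_deriv_lin oO bO (- 1) i Hw Hv.
  by rewrite !scaleN1r [- w + v]addrC [- (_ : E -> R^o) + _]addrC.
have a_dot v w : H1 v -> H1 w -> a (v - w) (v - w) =
    \sum_i dot ((weak_deriv Omega i v : E -> R^o) - weak_deriv Omega i w)
      ((weak_deriv Omega i v : E -> R^o) - weak_deriv Omega i w).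
  move=> Hv Hw; apply: eq_bigr => i _.
  have Ld := subspaceB sL (weak_deriv_L2 i Hv) (weak_deriv_L2 i Hw).
  have Lw := weak_deriv_L2 i (subspaceB sH Hv Hw).
  rewrite -/(dot _ _) (dotp_ae mO Lw Ld Lw (wd_B i _ _ Hv Hw)) (psd_sym pL Ld Lw).
  exact: (dotp_ae mO Lw Ld Ld (wd_B i _ _ Hv Hw)).
have /choice[g Hg] : forall i, exists g, L g /\ tends_to dot (g_ i) g.
  move=> i; have [e e0|g Lg gg] := sq_integrable_complete mO (Lg_ i); last by exists g.
  have [N HN] := cauchy _ e0; exists N => k m Nk Nm.
  apply: le_trans (HN _ _ Nk Nm); rewrite /h1_form a_dot// (bigD1 i)//= addrCA.
  rewrite lerDl addr_ge0//; first by rewrite (psd_ge0 pb)//; exact: subspaceB.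
  by apply: sumr_ge0 => j _; apply: (psd_ge0 pL); apply: (subspaceB sL); exact: weak_deriv_L2.
have wd i : is_weak_deriv Omega i u (g i).
  apply: (@is_weak_deriv_lim _ _ _ oO bO u_ (g_ i)) => //.
  - by move=> k; exact: weak_derivP.
  - by have [] := Hg i.
  - by have [] := Hg i.
have Hu : H1 u by split => // i; exists (g i).
exists u => // e e0.
(* One share for the function and one for each of the n + 1 derivatives. *)
have d0 : 0 < e / n.+2%:R by rewrite divr_gt0.
have [N0 HN0] := uu _ d0.
have /choice[N HN] : forall i, exists N, forall k, (N <= k)%N ->
    dot (g_ i k - g i) (g_ i k - g i) <= e / n.+2%:R.
  by move=> i; have [_ /(_ _ d0)] := Hg i.
exists (maxn N0 (\max_i N i)) => k; rewrite geq_max => /andP[N0k Nk].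
have sum_le : a (u_ k - u) (u_ k - u) <= \sum_(i < n.+1) e / n.+2%:R.
  rewrite a_dot//; apply: ler_sum => i _.
  have Lwu := weak_deriv_L2 i Hu; have [Lgi _] := Hg i.
  have ae := weak_deriv_ae oO bO Hu (wd i).
  have ae' : g_ i k - (weak_deriv Omega i u : E -> R^o) = g_ i k - g i %[ae mu in Omega].
    by apply: filterS ae => x h Ox; congr (g_ i k x - _); exact: h.
  have L1 := subspaceB sL (Lg_ i k) Lwu; have L2 := subspaceB sL (Lg_ i k) Lgi.
  rewrite (dotp_ae mO L1 L2 L1 ae') (psd_sym pL L2 L1) (dotp_ae mO L1 L2 L2 ae').
  by apply: HN; apply: leq_trans Nk; exact: leq_bigmax.
rewrite /h1_form; have := HN0 _ N0k; rewrite -/(b _ _) => b_le.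
apply: le_trans (lerD b_le sum_le) _.
by rewrite sumr_const card_ord -mulrS -[leLHS]mulr_natr divfK ?pnatr_eq0.
Qed.

Lemma H10_complete : complete_for H10 a.
Proof.
have cH : complete_for H10 h1_form.
  by rewrite H10_closure; exact: form_closure_complete sH h1_form_psd tests_H1 H1_complete.
have [C C0 HC] := H10_friedrichs.
have ph := psd_formS H10_H1 h1_form_psd.
apply: (@complete_equiv _ _ H10 h1_form a 1 H10_subspace ph cH).
  by move=> v /H10_H1 Hv; rewrite mul1r /h1_form lerDr (psd_ge0 pb).
exists (1 + C)^-1; first by rewrite invr_gt0 addr_gt0.
move=> v Hv; rewrite mulrC ler_pdivrMr ?addr_gt0// /h1_form mulrDr mulr1 addrC.
by rewrite lerD2l mulrC HC.
Qed.

End H10_theory.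

(** * Eigenvalues and the mixed problem *)

Section eigenvalues.
Context {R : realType} {n : nat}.
Local Notation E := 'rV[R]_n.+1.
Local Notation mu := (lebesgue_rV n.+1).
Variables (Omega : set E).
Hypotheses (oO : open Omega) (bO : bounded_set Omega).
Implicit Types (u v w : E -> R^o).

Local Notation H10 := (H10 Omega : set (E -> R^o)).
Local Notation a := (a_form Omega).
Local Notation b := (b_form Omega).

Let mO := measurable_Omega oO.
Let sV := H10_subspace oO bO.
Let aV := psd_formS (@H10_H1 R n Omega) (a_form_psd oO bO).
Let bV := psd_formS (@H10_H1 R n Omega) (b_form_psd oO).

Lemma H10_L2 u : H10 u -> sq_integrable mu Omega u.
Proof. by move=> [[]]. Qed.

Lemma b_form_eq0 u : H10 u -> b u u = 0 -> eqae Omega u (cst 0).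
Proof. by move=> /H10_L2; exact: dotp_eq0. Qed.

Lemma b_form_ae u u' v : H10 u -> H10 u' -> H10 v -> eqae Omega u u' -> b u v = b u' v.
Proof. by move=> /H10_L2 Lu /H10_L2 Lu' /H10_L2 Lv; exact: dotp_ae. Qed.

Lemma eigfun_space0 l : eigfun_space Omega l (0 : E -> R^o).
Proof.
split; first exact: sV.1.
move=> v Hv; rewrite (linear_on0 sV (psd_linl sV aV Hv)).
by rewrite (linear_on0 sV (psd_linl sV bV Hv)) mulr0.
Qed.

Variable lambda : nat -> R.
Hypothesis hlambda : eigenvalue_sequence Omega lambda.

(** A value that is never listed has multiplicity 0, so its eigenfunctions are almost everywhere
    equal to an empty sum. *)
Lemma eigenvalue_in_sequence l u : eigfun_space Omega l u -> 0 < b u u ->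
  exists k, lambda k = l.
Proof.
have [_ _ /(_ l)[m card_m [e [_ He]]]] := hlambda => Uu bu.
apply: contrapT => nk; have Hu := Uu.1.
have S0 : [set k | lambda k = l] = `I_0.
  by rewrite II0; apply/seteqP; split => // k lk; apply: nk; exists k.
move: card_m; rewrite S0 => /card_eq_II m0; move: e He; rewrite -m0 => e He.
have [c [Hc _]] := He _ Uu; suff bu0 : b u u = 0 by rewrite bu0 ltxx in bu.
apply: (ae_eq0_dotp mO); last exact: H10_L2.
by apply: filterS Hc => x h Ox; rewrite h// big_ord0.
Qed.

Hypothesis gap : lambda 0%N < lambda 1%N.

(** The gap makes the first value occur exactly once, so its eigenspace is one-dimensional; a
    generator is then normalized for b. *)
Lemma first_eigenvector : exists e, [/\ eigfun_space Omega (lambda 0%N) e, b e e = 1 &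
  forall w, eigfun_space Omega (lambda 0%N) w ->
    exists c : R, eqae Omega w (c *: e)].
Proof.
have [mono _ /(_ (lambda 0%N))[m card_m [e [Ue He]]]] := hlambda.
have S1 : [set k | lambda k = lambda 0%N] = [set 0%N].
  apply/seteqP; split => [[|k]|k ->]//= lk.
  by have := lt_le_trans gap (mono 1%N k.+1 isT); rewrite lk ltxx.
move: card_m; rewrite S1 => card_m.
have m1 : (1 = m)%N.
  by apply/card_eq_II; exact: card_eq_trans (card_esym card_set1) card_m.
move: e Ue He; rewrite -m1 => e Ue He.
pose e0 : E -> R^o := e ord0; have Ue0 : eigfun_space Omega (lambda 0%N) e0 by exact: Ue.
have He0 := Ue0.1.
have span w : eigfun_space Omega (lambda 0%N) w -> exists c : R, eqae Omega w (c *: e0).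
  move=> /He[c [Hc _]]; exists (c 0 ord0).
  by apply: filterS Hc => x h Ox; rewrite h// big_ord1.
have be0 : b e0 e0 != 0.
  apply/eqP => be; have e0_ae := b_form_eq0 He0 be.
  have [c [_ cu]] := He _ (eigfun_space0 (lambda 0%N)).
  (* If the generator were null, every coefficient would represent the zero function, against
     uniqueness of coordinates. *)
  have cE k : c = const_mx k.
    apply: cu; apply: filterS e0_ae => x h Ox.
    by rewrite big_ord1 -/e0 [e0 x]h// mulr0.
  have : const_mx 0 = const_mx 1 :> 'rV[R]_1 by rewrite -(cE 0) (cE 1).
  by move=> /matrixP/(_ 0 0)/eqP; rewrite !mxE eq_sym oner_eq0.
have bpos : 0 < b e0 e0 by rewrite lt_def be0 (psd_ge0 bV).
pose s := Num.sqrt (b e0 e0); have s0 : 0 < s by rewrite sqrtr_gt0.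
have Hse := subspaceZ sV s^-1 He0.
exists (s^-1 *: e0); split.
- split=> // v Hv.
  rewrite (linear_onZ sV (psd_linl sV aV Hv) s^-1 He0).
  rewrite (linear_onZ sV (psd_linl sV bV Hv) s^-1 He0) (Ue0.2 _ Hv).
  by rewrite mulrCA.
- by rewrite (psdZ sV bV s^-1 He0) exprVn sqr_sqrtr ?ltW// mulVf.
- move=> w /span[c Hc]; exists (c * s); apply: filterS Hc => x h Ox.
  by rewrite h// -scalerA scalerKV// gt_eqF.
Qed.

(** m occurs in the sequence, and not only as its first term: there u would be a multiple of e
    almost everywhere and, being b-orthogonal to e, null. *)
Lemma second_eigenvalue e m u : b e e = 1 -> eigfun_space Omega (lambda 0%N) e ->
  (forall w, eigfun_space Omega (lambda 0%N) w -> exists c : R, eqae Omega w (c *: e)) ->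
  H10 u -> 0 < b u u -> b e u = 0 ->
  (forall v, H10 v -> a u v = m * b u v) -> lambda 1%N <= m.
Proof.
move=> bee Ue span Hu bu beu eig.
have Um : eigfun_space Omega m u by [].
have [k lk] := eigenvalue_in_sequence Um bu.
have [mono _ _] := hlambda.
case: k lk => [lk|k <-]; last exact: mono.
have [c uce] : exists c : R, eqae Omega u (c *: e) by apply: span; rewrite lk.
have Hce := subspaceZ sV c Ue.1.
have := b_form_ae Hu Hce Hu uce.
rewrite (linear_onZ sV (psd_linl sV bV Hu) c Ue.1).
by rewrite beu mulr0 => bu0; rewrite bu0 ltxx in bu.
Qed.

Lemma first_eigenvalue_gt0 e : b e e = 1 -> eigfun_space Omega (lambda 0%N) e ->
  0 < lambda 0%N.
Proof.
move=> bee [He eig]; have [C C0 /(_ _ He)] := H10_friedrichs oO bO.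
rewrite eig// bee mulr1 => h; have := lt_le_trans ltr01 h.
by rewrite pmulr_rgt0.
Qed.

(** An element within delta of the infimum is taken instead of a minimizer; hence the distance 2
    delta. *)
Lemma near_eigenspace u0 (delta : R) : 0 < delta -> H10 u0 ->
  inf [set norm_a Omega (u0 \- w) | w in eigfun_space Omega (lambda 0%N)] <= delta ->
  exists2 w, eigfun_space Omega (lambda 0%N) w &
    a (u0 - w) (u0 - w) <= 4 * delta ^+ 2.
Proof.
move=> d0 Hu0; set S := [set _ | _ in _] => Sd.
have hS : has_inf S.
  split; last by exists 0 => _ [w _ <-]; exact: sqrtr_ge0.
  pose z : E -> R^o := 0; exists (norm_a Omega (u0 \- z)).
  by exists z; [exact: eigfun_space0|reflexivity].
have [_ [w Uw <-] Hw] := inf_adherent d0 hS.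
exists w => //; have Hd := subspaceB sV Hu0 Uw.1.
have {}Hw : norm_a Omega (u0 - w) <= 2 * delta.
  by apply: le_trans (ltW Hw) _; rewrite mulr_natl mulr2n lerD2r.
have <- : norm_a Omega (u0 - w) ^+ 2 = a (u0 - w) (u0 - w).
  by rewrite /norm_a sqr_sqrtr// (psd_ge0 aV).
have -> : 4 * delta ^+ 2 = (2 * delta) ^+ 2 by ring.
by rewrite ler_sqr ?nnegrE ?sqrtr_ge0// mulr_ge0// ltW.
Qed.

(** The witness is u0 with the sign opposite to that of nu, for which the quotient equals |nu| /
    sqrt (a u0 u0). *)
Lemma B_form_sup u0 (nu : R) : H10 u0 -> b u0 u0 = 1 -> 0 < a u0 u0 ->
  ((Num.sqrt (a u0 u0)^-1 * `|nu|)%:E <=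
   ereal_sup [set (B_form Omega u0 v nu / norm_a Omega v)%:E |
     v in [set v | H10 v /\ ~ eqae Omega v (cst 0)%R]])%E.
Proof.
move=> Hu0 bu0 au0.
have nae k v : k ^+ 2 = 1 -> v = k *: u0 -> ~ eqae Omega v (cst 0).
  move=> k1 -> v0; have Hv := subspaceZ sV k Hu0.
  have bv0 : b (k *: u0) (k *: u0) = 0 := ae_eq0_dotp mO v0 (H10_L2 Hv).
  move: bv0; rewrite (psdZ sV bV k Hu0) k1 bu0 mulr1 => /eqP.
  by rewrite oner_eq0.
pose k : R := if 0 <= nu then -1 else 1.
have k2 : k ^+ 2 = 1 by rewrite /k; case: ifP => _; rewrite ?sqrrN expr1n.
have Hv := subspaceZ sV k Hu0.
apply: ereal_sup_ubound; exists (k *: u0); first by split => //; exact: nae k2 _.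
congr EFin; rewrite /B_form /norm_a (psdZ sV aV k Hu0) k2 mul1r sqrtrV ?ltW//.
rewrite (linear_onZ sV (psd_lin bV Hu0) k Hu0) bu0 mulr1 mulrC; congr (_ * _).
rewrite /k; case: ifPn => [nu0|]; first by rewrite mulrN1 opprK ger0_norm.
by rewrite -ltNge mulr1 => nu0; rewrite ltr0_norm.
Qed.

(** By linearity g is determined by g 1, and the second equation reduces to b u0 u = - g 1.
    Friedrichs' inequality turns uniqueness up to a-null vectors into uniqueness almost
    everywhere. *)
Lemma mixed_problem u0 m (f : (E -> R) -> R) (g : {linear R^o -> R^o}) :
  H10 u0 -> b u0 u0 = 1 ->
  coercive_on [set v | H10 v /\ b u0 v = 0] a (A_form Omega m) ->
  H10_dual Omega f ->
  exists u l, mixed_solution Omega m u0 f g u l /\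
    forall u' l', mixed_solution Omega m u0 f g u' l' -> eqae Omega u' u /\ l' = l.
Proof.
move=> Hu0 bu0 coA [flin [Cf Hf]].
have [C C0 HC] := H10_friedrichs oO bO.
have bf : bounded_for H10 a f.
  (* f is bounded for the H^1 norm, and b + a <= (C + 1) a. *)
  exists (Cf ^+ 2 * (C + 1)) => v Hv.
  have h0 : 0 <= b v v + a v v by rewrite addr_ge0 ?(psd_ge0 bV)// (psd_ge0 aV).
  have : `|f v| ^+ 2 <= (Cf * norm_H1 Omega v) ^+ 2.
    rewrite ler_sqr ?nnegrE//; first exact: Hf.
    exact: le_trans (normr_ge0 _) (Hf _ Hv).
  rewrite real_normK ?num_real// exprMn sqr_sqrtr// => /le_trans; apply.
  by rewrite -mulrA ler_wpM2l ?sqr_ge0// mulrDl mul1r lerD2r; exact: HC.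
have gE nu : g nu = nu * g 1 by rewrite -[nu in LHS]mulr1 [LHS]linearZ.
have [u [l [Hu sol bu uniq]]] := saddle_point sV aV bV (H10_complete oO bO) HC
  Hu0 bu0 coA (- g 1) flin bf.
have split_sol v w s : A_form Omega m w v + B_form Omega u0 v s =
    a w v - m * b w v - s * b u0 v by rewrite /A_form /B_form mulNr.
exists u, l; split.
  split => // [v Hv|nu]; first by rewrite split_sol sol.
  by rewrite /B_form bu (gE nu) mulrNN.
move=> u' l' [Hu' sol' bu'].
have bu'E : b u0 u' = - g 1.
  by have := bu' 1; rewrite /B_form mulN1r => <-; rewrite opprK.
have [|a0 ->] := uniq u' l' Hu' _ bu'E.
  by move=> v Hv; rewrite -split_sol sol'.
split => //; have Hd := subspaceB sV Hu' Hu.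
have b0 : b (u' - u) (u' - u) = 0.
  by apply/eqP; rewrite eq_le (psd_ge0 bV)// andbT (le_trans (HC _ Hd))// a0 mulr0.
have := b_form_eq0 Hd b0; apply: filterS => x h Ox.
by apply/eqP; rewrite -subr_eq0; apply/eqP; exact: h.
Qed.

End eigenvalues.

Theorem theorem3p1 (R : realType) (d : nat) (hd : d = 2%N \/ d = 3%N)
    (Omega : set 'rV[R]_d) (dom : is_domain Omega) (bnd : bounded_set Omega)
    (lambda : nat -> R) (hlambda : eigenvalue_sequence Omega lambda)
    (gap : lambda 0%N < lambda 1%N) :
  exists (delta0 : R) (alpha sigma : R -> R),
    [/\ 0 < delta0, forall t, 0 < t -> 0 < alpha t,
        forall t, 0 < t -> 0 < sigma t
      & forall u0 : 'rV[R]_d -> R, H10 Omega u0 -> norm_b Omega u0 = 1 ->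
        inf [set norm_a Omega (u0 \- w) | w in eigfun_space Omega (lambda 0%N)]
          <= delta0 ->
        let mu0 := a_form Omega u0 u0 / b_form Omega u0 u0 in
        [/\ V0 Omega u0 = [set v | H10 Omega v /\ b_form Omega u0 v = 0],
            forall v, V0 Omega u0 v ->
              alpha (lambda 1%N - lambda 0%N) * norm_a Omega v ^+ 2
                <= A_form Omega mu0 v v,
            forall nu : R,
              ((sigma mu0^-1 * `|nu|)%:E <=
               ereal_sup [set (B_form Omega u0 v nu / norm_a Omega v)%:E |
                 v in [set v | H10 Omega v /\ ~ eqae Omega v (cst 0)%R]])%E
          & forall (f : ('rV[R]_d -> R) -> R) (g : {linear R^o -> R^o}),
              H10_dual Omega f ->
              exists u l, mixed_solution Omega mu0 u0 f g u l /\
                forall u' l', mixed_solution Omega mu0 u0 f g u' l' ->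
                  eqae Omega u' u /\ l' = l]].
Proof.
have [oO _ _] := dom.
(* A first coordinate direction is made visible, along which Friedrichs' inequality integrates. *)
have [n d_E] : exists n, d = n.+1 by case: hd => ->; eexists.
subst d.
have sV := H10_subspace oO bnd.
have aV := psd_formS (@H10_H1 R n Omega) (a_form_psd oO bnd).
have bV := psd_formS (@H10_H1 R n Omega) (b_form_psd oO).
have cV := H10_complete oO bnd.
have [e [Ue bee span]] := first_eigenvector oO bnd hlambda gap.
have l0 := first_eigenvalue_gt0 oO bnd bee Ue; have l1 := lt_trans l0 gap.
have G0 : 0 < lambda 1%N - lambda 0%N by rewrite subr_gt0.
have [C C0 HC] := H10_friedrichs oO bnd.
(* Chosen so that 4 delta0^2 is a quarter of the gap, the closeness asked by
   [shifted_form_coercive]. *)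
pose delta0 := Num.sqrt (lambda 1%N - lambda 0%N) / 4.
pose alpha := (lambda 1%N - lambda 0%N) / (4 * lambda 1%N).
have alpha0 : 0 < alpha by rewrite divr_gt0// mulr_gt0.
have delta00 : 0 < delta0 by rewrite divr_gt0// sqrtr_gt0.
(* [alpha] involves the gap and [lambda 1], both fixed by Omega, so it is given as a constant
   function; sigma is the square root of 1 / mu0, where mu0 = a u0 u0. *)
exists delta0, (fun=> alpha), Num.sqrt; split => //.
  by move=> t; rewrite sqrtr_gt0.
move=> u0 Hu0 nb /(near_eigenspace oO bnd delta00 Hu0)[w Uw Hw] /=.
have bu0 : b_form Omega u0 u0 = 1.
  by rewrite -[LHS]sqr_sqrtr ?(psd_ge0 bV)// -/(norm_b Omega u0) nb expr1n.
have au0 : 0 < a_form Omega u0 u0.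
  have : 1 <= C * a_form Omega u0 u0 by rewrite -{1}bu0; exact: HC.
  by move=> /(lt_le_trans ltr01); rewrite pmulr_rgt0.
have {}Hw : a_form Omega (u0 \- w) (u0 \- w) <= (lambda 1%N - lambda 0%N) / 4.
  apply: le_trans Hw _; rewrite /delta0 expr_div_n (sqr_sqrtr (ltW G0)).
  by rewrite le_eqVlt; apply/orP; left; apply/eqP; field.
have V0_E : V0 Omega u0 = [set v | H10 Omega v /\ b_form Omega u0 v = 0].
  apply/seteqP; split => v [Hv Bv]; split => //.
    by have := Bv (-1); rewrite /B_form opprK mul1r.
  by move=> nu; rewrite /B_form Bv mulr0.
have coer v : V0 Omega u0 v ->
    alpha * a_form Omega v v <= A_form Omega (a_form Omega u0 u0) v v.
  rewrite V0_E => -[Hv Bv].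
  exact: (shifted_form_coercive sV aV bV cV HC (H10_compact oO bnd) Ue.1 bee Ue.2
    (fun m u => second_eigenvalue oO bnd hlambda bee Ue span (m := m) (u := u))
    gap l0 Hu0 bu0 Uw.1 Uw.2 Hw Hv Bv).
rewrite bu0 divr1; split => //.
- move=> v Vv; have Hv : H10 Omega v by case: Vv.
  by rewrite sqr_sqrtr ?(psd_ge0 aV)//; exact: coer.
- by move=> nu; exact: B_form_sup.
- move=> f g Hf; apply: mixed_problem => //; rewrite -V0_E.
  by exists alpha.
Qed.
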